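(* Let $N>1$ and let $\mathcal H$ denote either $H^2(B_N)$ or $A^2_\alpha(B_N)$ with $\alpha>-1$. Suppose $\varphi$ and $\psi$ are linear-fractional self-maps of $B_N$ with $\|\varphi\|_\infty=\|\psi\|_\infty=1$, and assume at least one of $\varphi,\psi$ is univalent (one-to-one) on $B_N$. If $C_\varphi-C_\psi$ is compact on $\mathcal H$, then $\varphi=\psi$.
   Context: $B_N$ is the open unit ball of $\mathbb C^N$ with inner product $\langle z,w\rangle=\sum z_j\overline{w_j}$. $H^2(B_N)$ is the space of analytic $f$ on $B_N$ with $\sup_{0<r<1}\int_{\partial B_N}|f(r\zeta)|^2d\sigma(\zeta)<\infty$ ($\sigma$ normalized surface measure); $A^2_\alpha(B_N)$ is the space of analytic $f$ with $\int_{B_N}|f|^2\frac{\Gamma(N+\alpha+1)}{\Gamma(N+1)\Gamma(\alpha+1)}(1-|z|^2)^\alpha d\nu<\infty$ ($\nu$ normalized volume measure). A linear-fractional self-map of $B_N$ is a map $\varphi(z)=\frac{Az+B}{\langle z,C\rangle+d}$ ($A$ an $N\times N$ matrix, $B,C\in\mathbb C^N$, $d\in\mathbb C$) analytic on $B_N$ with $\varphi(B_N)\subseteq B_N$; it is analytic on a neighborhood of $\overline{B_N}$. $C_\varphi f=f\circ\varphi$ and $\|\varphi\|_\infty=\sup_{z\in B_N}|\varphi(z)|$. *)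

(* Defs.v *)
From mathcomp Require Import all_boot all_order all_algebra.
Import Order.TTheory GRing.Theory Num.Theory.
From mathcomp Require Import all_classical all_reals all_analysis.
From mathcomp Require Import complex.
Import numFieldNormedType.Exports.

Set Implicit Arguments.
Unset Strict Implicit.
Unset Printing Implicit Defensive.

Local Open Scope classical_set_scope.
Local Open Scope ring_scope.
Local Open Scope complex_scope.

Definition cabs2 (R : realType) (w : R[i]) : R := Re w ^+ 2 + Im w ^+ 2.

Definition vnorm2 (R : realType) (N : nat) (z : 'rV[R[i]]_N) : R :=
  \sum_(j < N) cabs2 (z ord0 j).
Definition vnorm (R : realType) (N : nat) (z : 'rV[R[i]]_N) : R :=
  Num.sqrt (vnorm2 z).

Definition ballN (R : realType) (N : nat) : set 'rV[R[i]]_N :=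
  [set z | vnorm2 z < 1].
Arguments ballN {R} N.

Definition cinner (R : realType) (N : nat) (z c : 'rV[R[i]]_N) : R[i] :=
  \sum_(j < N) z ord0 j * (Re (c ord0 j) -i* Im (c ord0 j)).

(* analytic (holomorphic) on B_N: complex (R[i]-linear) Frechet
   differentiable at every point of the open ball *)
Definition cdifferentiable_at (R : realType) (N : nat)
  (f : 'rV[R[i]]_N -> (R[i])^o) := fun z => differentiable f z.

Definition holomorphic_on_ball (R : realType) (N : nat)
  (f : 'rV[R[i]]_N -> R[i]) : Prop :=
  forall z : 'rV[R[i]]_N, ballN N z -> @cdifferentiable_at R N f z.

(* iterated Lebesgue integral over the first n real coordinates
   (for nonnegative integrands this is the integral w.r.t. the
   n-dimensional Lebesgue measure, by Tonelli) *)
Fixpoint iint (R : realType) (n : nat) (g : (nat -> R) -> \bar R) : \bar R :=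
  match n with
  | 0 => g (fun _ => 0)
  | n'.+1 => (\int[@lebesgue_measure R]_(t in setT)
                iint n' (fun x => g (fun k => if k == n' then t else x k)))%E
  end.

Definition of_coords (R : realType) (N : nat) (x : nat -> R) : 'rV[R[i]]_N :=
  \row_(j < N) (x (2 * j)%N +i* x (2 * j + 1)%N).

Definition vol_int (R : realType) (N : nat) (g : 'rV[R[i]]_N -> \bar R) : \bar R :=
  iint (2 * N) (fun x => g (of_coords N x)).

Definition ball_ind (R : realType) (N : nat) (z : 'rV[R[i]]_N) : R :=
  if vnorm2 z < 1 then 1 else 0.

Definition nu_int (R : realType) (N : nat) (g : 'rV[R[i]]_N -> \bar R) : \bar R :=
  (vol_int (fun z => (ball_ind z)%:E * g z)
   * ((fine (vol_int (fun z : 'rV[R[i]]_N => (ball_ind z)%:E)))^-1)%:E)%E.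

(* integral over the sphere w.r.t. the normalized surface measure sigma,
   via the cone identity  int_S h dsigma = int_{B_N} h(z/|z|) dnu(z) *)
Definition sigma_int (R : realType) (N : nat) (h : 'rV[R[i]]_N -> \bar R) : \bar R :=
  nu_int (fun z => h (((vnorm z)^-1)%:C *: z)).

Definition H2norm2 (R : realType) (N : nat) (f : 'rV[R[i]]_N -> R[i]) : \bar R :=
  ereal_sup [set sigma_int (fun zeta => (cabs2 (f (r%:C *: zeta)))%:E)
            | r in [set r : R | 0 < r < 1]].

Definition in_H2 (R : realType) (N : nat) (f : 'rV[R[i]]_N -> R[i]) : Prop :=
  holomorphic_on_ball f /\ (H2norm2 f < +oo)%E.

Definition bweight (R : realType) (N : nat) (alpha : R) (z : 'rV[R[i]]_N) : R :=
  powR (1 - vnorm2 z) alpha.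

(* ||f||_{A^2_alpha}^2 = c_alpha int_{B_N} |f|^2 (1-|z|^2)^alpha dnu, where
   c_alpha = Gamma(N+alpha+1)/(Gamma(N+1)Gamma(alpha+1)) is the constant
   making c_alpha (1-|z|^2)^alpha dnu a probability measure on B_N *)
Definition A2norm2 (R : realType) (N : nat) (alpha : R)
  (f : 'rV[R[i]]_N -> R[i]) : \bar R :=
  (nu_int (fun z => (cabs2 (f z) * bweight alpha z)%:E)
   * ((fine (nu_int (fun z : 'rV[R[i]]_N => (bweight alpha z)%:E)))^-1)%:E)%E.

Definition in_A2 (R : realType) (N : nat) (alpha : R)
  (f : 'rV[R[i]]_N -> R[i]) : Prop :=
  holomorphic_on_ball f /\ (A2norm2 alpha f < +oo)%E.

Definition compact_diff (R : realType) (N : nat)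
  (inH : ('rV[R[i]]_N -> R[i]) -> Prop)
  (nrm2 : ('rV[R[i]]_N -> R[i]) -> \bar R)
  (phi psi : 'rV[R[i]]_N -> 'rV[R[i]]_N) : Prop :=
  forall (f : nat -> 'rV[R[i]]_N -> R[i]) (M : R),
    (forall n, inH (f n)) -> (forall n, (nrm2 (f n) <= M%:E)%E) ->
    exists (s : nat -> nat) (g : 'rV[R[i]]_N -> R[i]),
      (forall n, (s n < s n.+1)%N) /\ inH g /\
      forall e : R, 0 < e ->
        \forall n \near \oo,
          (nrm2 (fun z => (f (s n) (phi z) - f (s n) (psi z) - g z)%R) < e%:E)%E.

Definition linear_fractional_selfmap (R : realType) (N : nat)
  (phi : 'rV[R[i]]_N -> 'rV[R[i]]_N) : Prop :=
  exists (A : 'M[R[i]]_N) (B Cv : 'rV[R[i]]_N) (d : R[i]),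
    (forall z, ballN N z -> cinner z Cv + d != 0) /\
    (forall z, ballN N z -> phi z = (cinner z Cv + d)^-1 *: (z *m A^T + B)) /\
    (forall z, ballN N z -> ballN N (phi z)).

Definition supnorm (R : realType) (N : nat) (phi : 'rV[R[i]]_N -> 'rV[R[i]]_N) : R :=
  sup [set vnorm (phi z) | z in ballN N].

Definition univalent_on_ball (R : realType) (N : nat)
  (phi : 'rV[R[i]]_N -> 'rV[R[i]]_N) : Prop :=
  forall z w, ballN N z -> ballN N w -> phi z = phi w -> z = w.

(* Main.v *)
(* Let zeta be a unit vector with |phi zeta| = 1, which exists because phi is
   linear fractional with supremum norm 1, and put eta = phi zeta and
   F z = (1 + <z, eta>)/2.  With n = m^2, the functions F^n and m <z, e> F^n
   (e orthogonal to eta) satisfy |f_m z|^2 <= C exp(- n (1 - Re <z, eta>) / 4) on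
   the ball, so that their squared norms are O(rho m) for an explicit power rho m
   of 1/m.  On the region where m (z - zeta) is close to a tangent vector tau and
   n (1 - |z|^2) is between 1 and 4, whose weighted measure is itself of order
   rho m, |f_m (phi z) - f_m (psi z)| stays bounded below for suitable f_m and tau
   as soon as phi and psi differ.  To see this, write
   phi (zeta + w) = (v0 + w M)/(1 + <w, C>); Julia's lemma gives
   1 - <phi (zeta + w), eta> = - lam <w, zeta>/(1 + <w, C>) with lam > 0.  One
   compares successively v0, lam, C and M for phi and psi: different v0 or lam
   change the modulus of F^n, different C its phase, and different M are detected
   by m <z, e> F^n.  Hence (C_phi - C_psi)(f_m / sqrt (rho m)) has no norm
   convergent subsequence: each term is bounded on the ball while the later ones
   carry a fixed amount of norm on ever smaller regions.
   Volume integrals are handled as iterated integrals over the real coordinates. *)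
Require Import Defs.
From mathcomp Require Import all_boot all_order all_algebra.
Import Order.TTheory GRing.Theory Num.Theory.
From mathcomp Require Import all_classical all_reals all_analysis.
From mathcomp Require Import complex measurable_realfun ring lra zify.
Import numFieldNormedType.Exports.

Set Implicit Arguments.
Unset Strict Implicit.
Unset Printing Implicit Defensive.

Local Open Scope classical_set_scope.
Local Open Scope ring_scope.

(** * Iterated integrals *)

Section slices.
Context {R : realType}.
Local Open Scope ereal_scope.
Implicit Types (g h : (nat -> R) -> \bar R) (x : nat -> R) (s : seq nat).

(** All the data of the two maps must be visible on one kind of region, and this dictates its shape.
    [|F|^2] is [1 - O(1/n)] as soon as [1 - Re <z, eta>] is [O(1/n)], whatever the imaginary part,
    so [F^n] stays bounded below on a set of width [1/m] in every real tangent direction, [i zeta]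
    included. There [w = z - zeta] has [Re <w, zeta> = O(1/n)], while [Im <w, zeta>] may be of order
    [1/m]. Hence [<w, zeta> <w, C>] can reach the order [1/n], and [C] becomes visible after taking
    [n]-th powers. The same shape fixes [rho m]: a factor [1/m] for each of the [2N - 1] tangential
    real directions, a radial factor [1/m^2], and [m^(-2 alpha)] from the weight. For the Hardy
    space only the tangential factors remain, and the radius is tied to [m] by [1 - r^2 = 2/m^2].
    Upper bounds come from domination by products of one-variable functions, lower bounds from
    coordinate boxes. Both are proved one coordinate at a time, so no change of variables in several
    dimensions is required. *)

Definition upd x k (t : R) : nat -> R := fun j => if j == k then t else x j.

Definition slice k g : (nat -> R) -> \bar R :=
  fun x => \int[@lebesgue_measure R]_(t in setT) g (upd x k t).

Definition slices s g := foldr slice g s.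

(** [nat -> R] is given no sigma-algebra here. Measurability is tested on every measurable family of
    coordinates, a notion that survives integrating out one coordinate and gives joint measurability
    in any two of them. *)
Definition coord_measurable g := forall d (T : measurableType d) (u : nat -> T -> R),
  (forall k, measurable_fun setT (u k)) ->
  measurable_fun setT (fun t => g (fun k => u k t)).

Lemma coord_measurable_upd g k d (T : measurableType d) (u : nat -> T -> R) :
  coord_measurable g -> (forall k, measurable_fun setT (u k)) ->
  measurable_fun setT (fun p : T * R => g (upd (fun j => u j p.1) k p.2)).
Proof.
move=> mg mu.
apply: (mg _ _ (fun j (p : T * R) => if j == k then p.2 else u j p.1)) => j.
case: (j == k); first exact: measurable_snd.
exact: (measurableT_comp (mu j) measurable_fst).
Qed.

Lemma coord_measurable_upd1 g k x : coord_measurable g ->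
  measurable_fun setT (fun t : R => g (upd x k t)).
Proof.
move=> mg; apply: (mg _ _ (fun j (t : R) => if j == k then t else x j)) => j.
case: (j == k); [exact: measurable_id|exact: measurable_cst].
Qed.

Lemma slice_ge0 k g : (forall x, 0 <= g x) -> forall x, 0 <= slice k g x.
Proof. by move=> g0 x; apply: integral_ge0. Qed.

Lemma slices_ge0 s g : (forall x, 0 <= g x) -> forall x, 0 <= slices s g x.
Proof. by move=> g0; elim: s => //= k s IH; apply: slice_ge0. Qed.

Lemma coord_measurable_slice k g : (forall x, 0 <= g x) ->
  coord_measurable g -> coord_measurable (slice k g).
Proof.
move=> g0 mg d T u mu.
have := @measurable_fun_fubini_tonelli_F _ _ T (measurableTypeR R) R
  (@lebesgue_measure R) (fun p : T * R => g (upd (fun j => u j p.1) k p.2))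
  (coord_measurable_upd k mg mu) (fun=> g0 _).
exact.
Qed.

Lemma coord_measurable_slices s g : (forall x, 0 <= g x) ->
  coord_measurable g -> coord_measurable (slices s g).
Proof.
move=> g0 mg; elim: s => //= k s IH.
by apply: coord_measurable_slice => //; exact: slices_ge0.
Qed.

Lemma upd_comm x i j t r : i != j -> upd (upd x i t) j r = upd (upd x j r) i t.
Proof.
move=> ij; apply/funext => k; rewrite /upd.
by case: eqP => // ->; case: eqP => // ji; rewrite ji eqxx in ij.
Qed.

Lemma sliceC i j g : (forall x, 0 <= g x) -> coord_measurable g ->
  slice i (slice j g) = slice j (slice i g).
Proof.
move=> g0 mg; have [->//|ij] := eqVneq i j.
apply/funext => x; rewrite /slice.
have mf : measurable_fun setT (fun p : R * R => g (upd (upd x i p.1) j p.2)).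
  apply: (mg _ _ (fun k (p : R * R) => if k == j then p.2 else
     if k == i then p.1 else x k)) => k.
  case: (k == j); first exact: measurable_snd.
  case: (k == i); [exact: measurable_fst|exact: measurable_cst].
have := @fubini_tonelli _ _ (measurableTypeR R) (measurableTypeR R) R
  (@lebesgue_measure R) (@lebesgue_measure R) _ mf (fun=> g0 _).
rewrite /fubini_F /fubini_G /= => ->.
by apply: eq_integral => t _; apply: eq_integral => r _; rewrite upd_comm.
Qed.

Lemma slices_rcons s k g : slices (rcons s k) g = slices s (slice k g).
Proof. by rewrite /slices foldr_rcons. Qed.

(** Tonelli, one transposition at a time. Any chosen coordinate can then be integrated first or
    last, which later isolates a coordinate where the peak direction is nonzero. *)
Lemma perm_slices s1 s2 g : (forall x, 0 <= g x) -> coord_measurable g ->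
  perm_eq s1 s2 -> slices s1 g = slices s2 g.
Proof.
move=> g0 mg; elim: s1 s2 => [|k s1 IH] s2.
  by move=> /perm_size/esym/size0nil ->.
move=> p; have ks2 : k \in s2 by rewrite -(perm_mem p) mem_head.
have p2 := perm_to_rem ks2.
have p1 : perm_eq s1 (rem k s2).
  by rewrite -(perm_cons k) (permPl p).
rewrite /= (IH _ p1).
elim: s2 ks2 {p p1 p2 IH} => //= i s2 IH; rewrite inE.
have [->//|ki/=] := eqVneq k i.
move=> /IH <-; rewrite sliceC//; first exact: slices_ge0.
exact: coord_measurable_slices.
Qed.

(** Only signs matter: the integral of a nonnegative function is a supremum over the simple
    functions below it, hence monotone without any measurability. *)
Lemma le_slice k g h x :
  (forall x, 0 <= g x) -> (forall x, 0 <= h x) ->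
  (forall t, g (upd x k t) <= h (upd x k t)) -> slice k g x <= slice k h x.
Proof.
move=> g0 h0 gh; rewrite /slice !(@ge0_integralTE _ (measurableTypeR R) R)//.
by apply: le_ereal_sup => _ [f fg <-]; exists f => // t; apply: le_trans (gh t).
Qed.

Lemma iint_slices n g : iint n g = slices (rev (iota 0 n)) g (fun=> 0%R).
Proof.
(* The induction needs an arbitrary background point [x], since the outer coordinates are already
   fixed when the inner integrals are reached. The list is reversed because [iint] integrates its
   last coordinate outermost. *)
suff H x : slices (rev (iota 0 n)) g x =
    iint n (fun y => g (fun k => if (k < n)%N then y k else x k)).
  rewrite H; elim: n g {H} => [//|n IH] g /=; apply: eq_integral => t _.
  rewrite IH [RHS]IH; congr iint; apply/funext => y; congr g; apply/funext => k.
  by rewrite ltnS; case: (ltngtP k n) => // ->; rewrite eqxx.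
elim: n g x => [//|n IH] g x.
rewrite -{1}addn1 iotaD rev_cat/= add0n; apply: eq_integral => t _; rewrite IH; congr iint.
apply/funext => y; congr g; apply/funext => k.
by rewrite /upd [in RHS]ltnS; case: (ltngtP k n).
Qed.

Lemma eq_slices s g h : g =1 h -> slices s g = slices s h.
Proof. by move=> /funext ->. Qed.

Definition outside s (y x : nat -> R) := forall k, k \notin s -> y k = x k.

Lemma outside_upd s k (x y : nat -> R) t :
  outside s y (upd x k t) -> outside (k :: s) y x.
Proof. by move=> H i; rewrite inE negb_or => /andP[ik /H ->]; rewrite /upd (negPf ik). Qed.

Lemma le_slices s g h x :
  (forall x, 0 <= g x) -> (forall x, 0 <= h x) ->
  (forall y, outside s y x -> g y <= h y) -> slices s g x <= slices s h x.
Proof.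
move=> g0 h0; elim: s x => [|k s IH] x gh /=; first exact: gh.
apply: le_slice => [||t]; [exact: slices_ge0..|].
by apply: IH => y /outside_upd; apply: gh.
Qed.

Lemma slicesZl s g (c : R) : (0 <= c)%R -> (forall x, 0 <= g x) -> coord_measurable g ->
  slices s (fun x => c%:E * g x) = fun x => c%:E * slices s g x.
Proof.
move=> c0 g0 mg; elim: s => //= k s ->; apply/funext => x.
rewrite /slice ge0_integralZl//.
- apply: coord_measurable_upd1; exact: coord_measurable_slices.
- by move=> *; exact: slices_ge0.
Qed.

Lemma slicesD s g h : (forall x, 0 <= g x) -> coord_measurable g ->
  (forall x, 0 <= h x) -> coord_measurable h ->
  slices s (fun x => g x + h x) = fun x => slices s g x + slices s h x.
Proof.
move=> g0 mg h0 mh; elim: s => //= k s ->; apply/funext => x.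
rewrite /slice ge0_integralD//; try by move=> *; exact: slices_ge0.
- apply: coord_measurable_upd1; exact: coord_measurable_slices.
- apply: coord_measurable_upd1; exact: coord_measurable_slices.
Qed.

Lemma slices_sum s (I : Type) (r : seq I) (G : I -> (nat -> R) -> \bar R) :
  (forall i x, 0 <= G i x) -> (forall i, coord_measurable (G i)) ->
  slices s (fun x => \sum_(i <- r) G i x) = fun x => \sum_(i <- r) slices s (G i) x.
Proof.
move=> G0 mG; elim: r => [|i r IH].
  rewrite (eq_slices _ (fun x => big_nil _ _ _ _)); apply/funext => x; rewrite big_nil.
  elim: s x => //= k s IH x; rewrite /slice.
  by rewrite (eq_integral (fun=> 0)) ?integral0// => t _; rewrite IH.
rewrite (eq_slices _ (fun x => big_cons _ _ _ _ _ _)) slicesD//.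
- by rewrite IH; apply/funext => x; rewrite big_cons.
- by move=> x; apply: sume_ge0.
- move=> d T u mu; apply: emeasurable_sum => // j; exact: mG.
Qed.

(** The constant [c] is kept general because each induction step absorbs into it the factor of the
    coordinate just fixed. *)
Lemma slices_ub s g x (c : R) (b : nat -> R -> R) (B : R) :
  uniq s -> (0 <= c)%R -> (0 <= B)%R ->
  (forall k : nat, k \in s -> measurable_fun setT (b k)) -> (forall k t, (0 <= b k t)%R) ->
  (forall k : nat, k \in s -> \int[@lebesgue_measure R]_(t in setT) (b k t)%:E <= B%:E) ->
  (forall x, 0 <= g x) ->
  (forall y, outside s y x -> g y <= (c * \prod_(k <- s) b k (y k))%:E) ->
  slices s g x <= (c * B ^+ size s)%:E.
Proof.
move=> us c0 B0 mb b0 bB g0; elim: s x c us c0 mb bB => [|k s IH] x c /=.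
  by move=> _ _ _ _ /(_ x); rewrite big_nil expr0; apply.
move=> /andP[ks us] c0 mb bB gb.
have -> : ((c * B ^+ (size s).+1)%:E = (c * B ^+ size s)%:E * B%:E)%E.
  by rewrite -EFinM exprSr mulrA.
apply: le_trans (lee_wpmul2l _ (bB k (mem_head _ _))); last first.
  by rewrite lee_fin mulr_ge0// exprn_ge0.
rewrite -ge0_integralZl//; last 3 first.
- by apply/measurable_EFinP; apply: mb; rewrite mem_head.
- by move=> t _; rewrite lee_fin.
- by rewrite lee_fin mulr_ge0// exprn_ge0.
rewrite /slice; apply: (@le_trans _ _
  (\int[lebesgue_measure]_t ((c * b k t) * B ^+ size s)%:E)); last first.
  by rewrite le_eqVlt; apply/orP; left; apply/eqP; apply: eq_integral => t _;
   rewrite -EFinM; congr EFin; ring.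
rewrite !(@ge0_integralTE _ (measurableTypeR R) R)//; last by move=> t; exact: slices_ge0.
  apply: le_ereal_sup => _ [f fg <-]; exists f => // t; apply: le_trans (fg t) _.
  apply: IH => //; first by rewrite mulr_ge0.
  - by move=> i si; apply: mb; rewrite inE si orbT.
  - by move=> i si; apply: bB; rewrite inE si orbT.
  - move=> y oy; apply: (le_trans (gb y (outside_upd oy))).
    by rewrite big_cons -mulrA; rewrite (oy k)// /upd eqxx.
by move=> t; rewrite lee_fin mulr_ge0 ?exprn_ge0// mulr_ge0.
Qed.

(** [outside] lets the corner [l] of the box depend on the coordinates held fixed, so nested
    applications reach regions that are not products. *)
Lemma slices_lb s g x (c w : R) (l : nat -> R) :
  uniq s -> (0 <= c)%R -> (0 <= w)%R -> (forall x, 0 <= g x) ->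
  (forall y, outside s y x -> (forall k : nat, k \in s -> (l k <= y k <= l k + w)%R) ->
     c%:E <= g y) ->
  (c * w ^+ size s)%:E <= slices s g x.
Proof.
move=> us c0 w0 g0; elim: s x us => [|k s IH] x /=.
  by move=> _ /(_ x); rewrite expr0 mulr1; apply.
move=> /andP[ks us] gb.
have -> : ((c * w ^+ (size s).+1)%:E = (c * w ^+ size s)%:E * w%:E)%E.
  by rewrite -EFinM exprSr mulrA.
have <- : lebesgue_measure `[l k, (l k + w)%R]%classic = w%:E.
  rewrite lebesgue_measure_itv/= lte_fin.
  case: ltP => [_|]; first by rewrite -EFinB; congr EFin; ring.
  by rewrite gerDl => w0'; congr EFin; apply/eqP; rewrite eq_le w0 w0'.
rewrite -integral_cst//; rewrite integral_mkcond /slice.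
rewrite !(@ge0_integralTE _ (measurableTypeR R) R)//; last 2 first.
- by move=> t; exact: slices_ge0.
- move=> t; rewrite patchE; case: ifP => // _; rewrite lee_fin mulr_ge0// exprn_ge0//.
apply: le_ereal_sup => _ [f fg <-]; exists f => // t; apply: le_trans (fg t) _.
rewrite patchE; case: ifPn => [|_]; last exact: slices_ge0.
rewrite inE/= in_itv/= => lt.
apply: IH => // y oy yl; apply: gb; first exact: outside_upd oy.
move=> i; rewrite inE => /predU1P[->|/yl//].
by rewrite (oy k)// /upd eqxx.
Qed.

End slices.

(** * Integrals over the line *)

Section line_integrals.
Context {R : realType}.
Local Open Scope ereal_scope.
Notation mu := (@lebesgue_measure R).

(** [b] lies below the series of the indicators of [A j] weighted by [c j]. Dyadic covers then bound
    integrals without antiderivatives and without measurability of [b]. *)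
Lemma integral_le_cover (b : R -> R) (c d : nat -> R) (A : nat -> set R) (B : R) :
  (forall x, (0 <= b x)%R) -> (forall j, (0 <= c j)%R) ->
  (forall j, measurable (A j)) -> (forall j, mu (A j) <= (d j)%:E) ->
  (forall n, (\sum_(0 <= j < n) c j * d j <= B)%R) ->
  (forall x, (b x <= 0)%R \/ exists j, A j x /\ (b x <= c j)%R) ->
  \int[mu]_x (b x)%:E <= B%:E.
Proof.
move=> b0 c0 mA Ad cdB cov.
pose f j x := (c j)%:E * (\1_(A j) x)%:E : \bar R.
have f0 j x : 0 <= f j x by rewrite mule_ge0 ?lee_fin.
have mA' j : measurable_fun setT (fun x : R => (\1_(A j) x)%:E : \bar R).
  by apply/measurable_EFinP; exact: measurable_indic.
have mf j : measurable_fun setT (f j) by exact: measurable_funeM.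
apply: (@le_trans _ _ (\int[mu]_x (\sum_(j <oo) f j x))).
  rewrite !(@ge0_integralTE _ (measurableTypeR R) R); last 2 first.
  - by move=> x; apply: nneseries_ge0.
  - by move=> x; rewrite lee_fin.
  apply: le_ereal_sup => _ [h hb <-]; exists h => // x; apply: le_trans (hb x) _.
  have [bx|[j [Ax bx]]] := cov x.
    by apply: (@le_trans _ _ 0); [rewrite lee_fin|exact: nneseries_ge0].
  rewrite (@nneseriesD1 _ _ j)//; apply: (@le_trans _ _ (f j x)).
    by rewrite /f indicE mem_set// mule1 lee_fin.
  by rewrite leeDl// nneseries_ge0.
rewrite integral_nneseries//; apply: lime_le.
  by apply: is_cvg_nneseries => n _ _; apply: integral_ge0.
near=> n; apply: le_trans (_ : (\sum_(0 <= j < n) c j * d j)%:E <= _); last first.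
  by rewrite lee_fin.
rewrite -sumEFin; apply: lee_sum => j _.
rewrite /f ge0_integralZl//; [|exact: mA'|by rewrite lee_fin].
have := @integral_indic _ _ R mu setT measurableT (A j) (mA j).
rewrite setIT => ->; rewrite EFinM; apply: lee_wpmul2l; [by rewrite lee_fin|exact: Ad].
Unshelve. all: by end_near. Qed.

Lemma geometric_sum_le (q : R) n : (0 <= q < 1)%R ->
  (\sum_(0 <= j < n) q ^+ j <= (1 - q)^-1)%R.
Proof.
move=> /andP[q0 q1]; have q1' : (0 < 1 - q)%R by rewrite subr_gt0.
rewrite -[leRHS]mul1r ler_pdivlMr// mulrC big_mkord.
have /esym := subrX1 q n; rewrite -opprB mulNr => /eqP.
by rewrite eqr_oppLR opprB => /eqP ->; rewrite gerBl exprn_ge0.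
Qed.

Lemma pow2_bracket (v : R) : (0 <= v)%R ->
  exists j : nat, (v <= 2 ^+ j)%R /\ (j = 0%N \/ (2 ^+ j < 2 * v)%R).
Proof.
move=> v0.
have H : exists j, (v <= 2 ^+ j)%R.
  exists (Num.bound v); apply: ltW; apply: lt_le_trans (_ : ((Num.bound v)%:R <= _)%R).
    by have := archi_boundP v0.
  by rewrite -natrX ler_nat ltnW// ltn_expl.
case: (ex_minnP H) => j vj jmin; exists j; split=> //.
case: j vj jmin => [|j] vj jmin; [by left|right].
rewrite exprS ltr_pM2l// ltNge; apply/negP => /jmin; by rewrite ltnn.
Qed.

Lemma four_exp j : (4 ^+ j = (2 ^+ j) ^+ 2 :> R)%R.
Proof. by rewrite -exprM mulnC exprM; congr (_ ^+ _)%R; ring. Qed.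

Lemma pow2_bracketV (v : R) : (0 < v <= 1)%R ->
  exists j : nat, (2^-1 ^+ j.+1 < v <= 2^-1 ^+ j)%R.
Proof.
move=> /andP[v0 v1].
have H : exists j, (2^-1 ^+ j.+1 < v)%R.
  have [|j [vj _]] := @pow2_bracket v^-1; first by rewrite invr_ge0 ltW.
  exists j; rewrite exprSr; apply: (@lt_le_trans _ _ (2^-1 ^+ j)%R).
    by rewrite gtr_pMr ?exprn_gt0// invf_lt1// ltr1n.
  by rewrite exprVn -[leRHS]invrK lef_pV2 ?posrE ?invr_gt0 ?exprn_gt0.
case: (ex_minnP H) => j vj jmin; exists j; rewrite vj/=.
case: j {vj} jmin => [//|j] jmin; rewrite leNgt; apply/negP => /jmin.
by rewrite ltnn.
Qed.

Lemma integral_rational_bump (k c : R) : (0 < k)%R ->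
  \int[mu]_x ((1 + (k * (x - c)) ^+ 2)^-1)%:E <= (16 / k)%:E.
Proof.
move=> k0.
(* On [|k (x - c)| <= 2^j], an interval of length [2 * 2^j / k], and outside the previous one, the
   integrand is at most [4 / 4^j]; the series [8 / k * 2^(-j)] sums to [16 / k]. *)
apply: (@integral_le_cover _ (fun j => 4 * 4^-1 ^+ j)%R (fun j => 2 * 2 ^+ j / k)%R
  (fun j => `[(c - 2 ^+ j / k)%R, (c + 2 ^+ j / k)%R]%classic)).
- by move=> x; rewrite invr_ge0 addr_ge0// sqr_ge0.
- by move=> j; rewrite mulr_ge0// exprn_ge0.
- by move=> j; exact: measurable_itv.
- move=> j; rewrite lebesgue_measure_itv/= lte_fin; case: ifP => _.
    by rewrite -EFinB lee_fin; lra.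
  by rewrite lee_fin !mulr_ge0 ?invr_ge0 ?exprn_ge0// ltW.
- move=> n; rewrite (eq_bigr (fun j => 8 / k * (2^-1) ^+ j)%R) => [|j _].
    rewrite -mulr_sumr; apply: le_trans (ler_wpM2l _ (geometric_sum_le n _)) _.
    + by rewrite divr_ge0// ltW.
    + by rewrite invr_ge0 ler0n /= invf_lt1// ltr1n.
    + by rewrite le_eqVlt; apply/orP; left; apply/eqP; field; rewrite gt_eqF.
  have : (2 ^+ j != 0 :> R)%R by rewrite expf_neq0.
  rewrite !exprVn four_exp; set z := (2 ^+ j)%R => z0; field.
  by rewrite z0 gt_eqF.
- move=> x; right.
  have [j [vj h]] := @pow2_bracket `|k * (x - c)|%R (normr_ge0 _).
  exists j; split.
    have : (`|x - c| <= 2 ^+ j / k)%R.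
      by rewrite ler_pdivlMr// mulrC -{1}[k](gtr0_norm k0) -normrM.
    by rewrite ler_norml /= in_itv/= => /andP[? ?]; apply/andP; split; lra.
  case: h => [->|h].
    rewrite expr0 mulr1 invf_ple ?posrE// ?ltr_pwDl// ?sqr_ge0//.
    rewrite (@le_trans _ _ 1%R)//; first by rewrite invf_le1// ler1n.
    by rewrite lerDl sqr_ge0.
  rewrite -real_normK ?num_real//; set v := `|_|%R in vj h *.
  have v0 : (0 <= v)%R by exact: normr_ge0.
  rewrite (_ : 4 * _ = (2 ^+ j ^+ 2 / 4)^-1)%R.
    rewrite lef_pV2 ?posrE ?ltr_pwDl ?sqr_ge0// ?divr_gt0 ?exprn_gt0//.
    have z0 : (0 < 2 ^+ j :> R)%R by rewrite exprn_gt0.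
    by nra.
  by rewrite exprVn four_exp; field; rewrite expf_neq0.
Qed.

Lemma le0_ger_powR (a x y : R) : (a <= 0)%R -> (0 < x)%R -> (x <= y)%R ->
  (y `^ a <= x `^ a)%R.
Proof.
move=> a0 x0 xy; have y0 : (0 < y)%R := lt_le_trans x0 xy.
rewrite -[a]opprK !(powRN _ (- a)) lef_pV2 ?posrE ?powR_gt0//.
by rewrite ge0_ler_powR ?nnegrE ?oppr_ge0 ?(ltW x0) ?(ltW y0).
Qed.

Lemma powR_exp (h a : R) j : (0 <= h)%R -> ((h ^+ j) `^ a = (h `^ a) ^+ j)%R.
Proof. by move=> h0; rewrite -powR_mulrn// powRAC powR_mulrn// powR_ge0. Qed.

Lemma expR_ge_exp (v : R) k : (0 <= v)%R -> (0 < k)%N ->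
  ((1 + v) ^+ k <= k%:R ^+ k * expR v)%R.
Proof.
move=> v0 k0; have kR : (1 <= k%:R :> R)%R by rewrite ler1n.
have {2}-> : (v = k%:R * (v / k%:R))%R by field; rewrite pnatr_eq0 -lt0n.
rewrite expRM_natl -exprMn lerXn2r ?nnegrE ?addr_ge0// ?mulr_ge0 ?expR_ge0 ?ler0n//.
apply: (@le_trans _ _ (k%:R * (1 + v / k%:R))%R).
  rewrite mulrDr mulr1 mulrCA divff ?pnatr_eq0 -?lt0n// mulr1; lra.
by rewrite ler_wpM2l ?ler0n// expR_ge1Dx.
Qed.

(** The exponential beats every power, so the product is dominated by an integrable rational
    function, except for the singularity at [0] when [a < 0], which is kept as a separate term. *)
Lemma powR_expR_le (a : R) : exists K : R, (0 < K)%R /\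
  forall v, (0 < v)%R -> (v `^ a * expR (- v) <=
    K * (1 + v ^+ 2)^-1 + if (v <= 1) && (a < 0) then v `^ a else 0)%R.
Proof.
(* [Num.bound] of [|a|] factors [1 + v] dominate the power; the two extra ones produce [1 + v^2]. *)
pose k := (Num.bound `|a|).+2; exists (k%:R ^+ k)%R; split.
  by rewrite exprn_gt0// ltr0n.
move=> v v0; have s0 : (0 < 1 + v ^+ 2)%R by rewrite ltr_pwDl// sqr_ge0.
case: ifPn => [/andP[v1 a0]|].
  apply: (@le_trans _ _ (v `^ a)%R).
    by rewrite ger_pMr ?powR_gt0// expR_le1 oppr_le0 ltW.
  by rewrite lerDr mulr_ge0 ?exprn_ge0 ?ler0n// invr_ge0 ltW.
move=> h; rewrite addr0 ler_pdivlMr// expRN mulrAC ler_pdivrMr ?expR_gt0//.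
apply: le_trans (expR_ge_exp _ _); rewrite ?(ltW v0)//.
have -> : ((1 + v) ^+ k = (1 + v) ^+ Num.bound `|a| * (1 + v) ^+ 2)%R.
  by rewrite -exprD addn2.
rewrite ler_pM ?powR_ge0 ?(ltW s0)//; last first.
  by rewrite sqrrD expr1n mul1r lerD2r lerDl mulrn_wge0// ltW.
have v1 : (1 <= 1 + v)%R by rewrite lerDl ltW.
have [a0|a0] := leP 0%R a.
  apply: (@le_trans _ _ ((1 + v) `^ a)%R).
    by rewrite ge0_ler_powR ?nnegrE//; lra.
  rewrite -powR_mulrn; last lra.
  rewrite ler_powR// -[leLHS]ger0_norm//; apply: ltW; exact: archi_boundP.
rewrite a0 andbT -ltNge in h.
apply: (@le_trans _ _ 1%R); last by rewrite exprn_ege1.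
by rewrite -(powRr0 v) ler_powR// ltW.
Qed.

(** Scaling by [k] extracts [k^(-a) / k]. The sign [s] covers both orientations of the half line,
    since a cap of the ball may face either end of a coordinate axis. *)
Lemma integral_powR_expR (a : R) : (-1 < a)%R -> exists C : R, (0 < C)%R /\
  forall k g s : R, (0 < k)%R -> (s = 1 \/ s = -1)%R ->
  \int[mu]_x (if (0 < g - s * x)%R then (g - s * x) `^ a * expR (- (k * (g - s * x)))
              else 0)%:E <= (C * k `^ (- a) / k)%:E.
Proof.
move=> a1; have [K [K0 HK]] := powR_expR_le a.
pose h : R := 2^-1%R; have h0 : (0 < h)%R by rewrite invr_gt0.
have h1 : (h < 1)%R by rewrite invf_lt1// ltr1n.
(* [q = h^(1 + a)] is the ratio of the dyadic series near the singularity: interval length [h^j]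
   times the value [h^(j a)]. It is below [1] exactly because [-1 < a]. *)
pose q := (h * h `^ a)%R.
have q01 : (0 <= q < 1)%R.
  rewrite mulr_ge0 ?powR_ge0 ?(ltW h0)//=.
  rewrite /q -{1}(powRr1 (ltW h0)) -powRD; last by apply/implyP => _; rewrite gt_eqF.
  have a1' : (0 < 1 + a)%R by lra.
  apply: (lt_le_trans (gt0_ltr_powR a1' _ _ h1)); last by rewrite powR1.
    by rewrite nnegrE ltW.
  by rewrite nnegrE.
pose C2 := (h `^ a * (1 - q)^-1)%R.
have C20 : (0 <= C2)%R by rewrite mulr_ge0 ?powR_ge0// invr_ge0; case/andP: q01; lra.
exists (K * 16 + C2)%R; split; first by rewrite ltr_pwDl// mulr_gt0.
move=> k g s k0 s1; pose ka := (k `^ (- a))%R.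
have ka0 : (0 <= ka)%R by exact: powR_ge0.
pose b1 x := (ka * K * (1 + (k * (x - s * g)) ^+ 2)^-1)%R.
pose b2 x := (if [&& 0 < g - s * x, k * (g - s * x) <= 1 & a < 0] then
    ka * (k * (g - s * x)) `^ a else 0)%R.
have b10 x : (0 <= b1 x)%R.
  by rewrite /b1 !mulr_ge0// ?(ltW K0)// invr_ge0 addr_ge0// sqr_ge0.
have b20 x : (0 <= b2 x)%R by rewrite /b2; case: ifP => // _; rewrite mulr_ge0 ?powR_ge0.
have mb0 : measurable_fun setT (fun x : R => (1 + (k * (x - s * g)) ^+ 2)^-1)%R.
  apply: continuous_measurable_fun => x.
  apply: cvgV; first by rewrite gt_eqF// ltr_pwDl// sqr_ge0.
  apply: cvgD; first exact: cvg_cst.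
  have lc : (k * (y - s * g))%R @[y --> x] --> (k * (x - s * g))%R.
    by apply: cvgM; [exact: cvg_cst|apply: cvgB; [exact: cvg_id|exact: cvg_cst]].
  exact: (cvgM lc lc).
have mb1 : measurable_fun setT (fun x : R => (b1 x)%:E).
  by apply/measurable_EFinP; apply: measurable_funM => //; exact: measurable_cst.
have mlin : measurable_fun setT (fun x : R => (g - s * x)%R).
  apply: measurable_funB; first exact: measurable_cst.
  by apply: measurable_funM; [exact: measurable_cst|exact: measurable_id].
have mb2 : measurable_fun setT (fun x : R => (b2 x)%:E).
  apply/measurable_EFinP; apply: measurable_fun_ifT.
  - apply: measurable_and; first exact: measurable_fun_ltr (measurable_cst _) mlin.
    apply: measurable_and; last exact: measurable_cst.
    apply: measurable_fun_ler; last exact: measurable_cst.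
    by apply: measurable_funM => //; exact: measurable_cst.
  - apply: measurable_funM; first exact: measurable_cst.
    apply: (@measurableT_comp _ _ _ R R R (fun y => y `^ a)%R); first exact: measurable_powR.
    by apply: measurable_funM => //; exact: measurable_cst.
  - exact: measurable_cst.
apply: (@le_trans _ _ (\int[mu]_x ((b1 x)%:E + (b2 x)%:E))).
  rewrite !(@ge0_integralTE _ (measurableTypeR R) R); last 2 first.
  - by move=> x; rewrite -EFinD lee_fin addr_ge0.
  - by move=> x; rewrite lee_fin; case: ifP => // _; rewrite mulr_ge0 ?powR_ge0 ?expR_ge0.
  apply: le_ereal_sup => _ [f hb <-]; exists f => // x; apply: le_trans (hb x) _.
  rewrite -EFinD lee_fin; case: ifPn => [t0|_]; last by rewrite addr_ge0.
  have {HK} := HK (k * (g - s * x))%R (mulr_gt0 k0 t0).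
  rewrite /b1 /b2 t0/= => H.
  have -> : ((k * (x - s * g)) ^+ 2 = (k * (g - s * x)) ^+ 2)%R.
    by case: s1 => ->; ring.
  have -> : ((g - s * x) `^ a = ka * (k * (g - s * x)) `^ a)%R.
    rewrite powRM ?(ltW k0) ?(ltW t0)// mulrA /ka powRN mulVf ?mul1r//.
    by rewrite gt_eqF// powR_gt0.
  rewrite -mulrA -mulrA -[X in (_ <= _ + X)%R](_ : ka * (if (k * (g - s * x) <= 1) && (a < 0)
    then (k * (g - s * x)) `^ a else 0) = _)%R.
    by rewrite -mulrDr ler_wpM2l.
  by case: ifP => // _; rewrite mulr0.
rewrite ge0_integralD//; [|by move=> x _; rewrite lee_fin|by move=> x _; rewrite lee_fin].
have -> : ((K * 16 + C2) * k `^ (- a) / k)%:E =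
   (ka * K)%:E * (16 / k)%:E + (ka * C2 / k)%:E :> \bar R.
  by rewrite -EFinM -EFinD; congr EFin; rewrite /ka; ring.
apply: leeD.
  under eq_integral do rewrite /b1 EFinM.
  rewrite ge0_integralZl//; last 3 first.
  - exact/measurable_EFinP.
  - by move=> x _; rewrite lee_fin invr_ge0 addr_ge0// sqr_ge0.
  - by rewrite lee_fin mulr_ge0// ltW.
  by rewrite lee_wpmul2l ?integral_rational_bump// lee_fin mulr_ge0// ltW.
(* The interval of centre [p j] and radius [r j] is the set where [0 <= g - s x <= h^j / k], for
   either sign of [s]. *)
pose r j := (h ^+ j / k / 2)%R; pose p j := (s * g - s * r j)%R.
have r0 j : (0 <= r j)%R by rewrite !mulr_ge0 ?invr_ge0 ?exprn_ge0// ltW.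
apply: (@integral_le_cover _ (fun j => ka * (h ^+ j.+1) `^ a)%R (fun j => h ^+ j / k)%R
  (fun j => `[(p j - r j)%R, (p j + r j)%R]%classic)) => //.
- by move=> j; rewrite mulr_ge0 ?powR_ge0.
- move=> j; rewrite lebesgue_measure_itv/= lte_fin; case: ifP => _.
    by rewrite -EFinB lee_fin /r; lra.
  by rewrite lee_fin mulr_ge0 ?invr_ge0 ?exprn_ge0 ?(ltW h0) ?(ltW k0).
- move=> n; rewrite (eq_bigr (fun j => ka * h `^ a / k * q ^+ j)%R) => [|j _].
    rewrite -mulr_sumr (_ : ka * C2 / k = ka * h `^ a / k * (1 - q)^-1)%R; last first.
      by rewrite /C2; ring.
    by rewrite ler_wpM2l ?geometric_sum_le// !mulr_ge0 ?powR_ge0 ?invr_ge0// ltW.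
  by rewrite powR_exp ?(ltW h0)// /q exprMn exprS; ring.
- move=> x; rewrite /b2; case: ifPn => [|_]; last by left.
  move=> /and3P[t0 t1 a0]; right.
  have [|j /andP[jv vj]] := @pow2_bracketV (k * (g - s * x))%R.
    by rewrite t1 mulr_gt0.
  exists j; split.
    have : (g - s * x <= h ^+ j / k)%R by rewrite ler_pdivlMr// mulrC.
    rewrite /= in_itv/= /p /r; move: (h ^+ j / k)%R => z hz.
    by case: s1 t0 hz => -> t0 hz; apply/andP; split; lra.
  rewrite ler_wpM2l//; apply: le0_ger_powR; [exact: ltW|exact: exprn_gt0|exact: ltW].
Qed.

End line_integrals.

(** * Integrals over the unit ball of a real space *)

Section real_estimates.
Context {R : realType}.
Implicit Types (x y h tau : nat -> R) (s : seq nat) (m : R).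

Definition rdot s x y : R := \sum_(k <- s) x k * y k.

Lemma rdot_ge0 s x : 0 <= rdot s x x.
Proof. by apply: sumr_ge0 => k _; rewrite -expr2 sqr_ge0. Qed.

Lemma perm_rdot s1 s2 x y : perm_eq s1 s2 -> rdot s1 x y = rdot s2 x y.
Proof. exact: perm_big. Qed.

Lemma rdot_cons k s x y : rdot (k :: s) x y = x k * y k + rdot s x y.
Proof. by rewrite /rdot big_cons. Qed.

Lemma rdotC s x y : rdot s x y = rdot s y x.
Proof. by apply: eq_bigr => k _; rewrite mulrC. Qed.

Lemma rdotDl s x y h : rdot s (fun k => x k + y k) h = rdot s x h + rdot s y h.
Proof. by rewrite /rdot -big_split/=; apply: eq_bigr => k _; rewrite mulrDl. Qed.

Lemma rdotZl s (c : R) x h : rdot s (fun k => c * x k) h = c * rdot s x h.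
Proof. by rewrite /rdot mulr_sumr; apply: eq_bigr => k _; rewrite mulrA. Qed.

Lemma rdotNl s x h : rdot s (fun k => - x k) h = - rdot s x h.
Proof. by rewrite /rdot -sumrN; apply: eq_bigr => k _; rewrite mulNr. Qed.

Lemma rdotDr s x y h : rdot s h (fun k => x k + y k) = rdot s h x + rdot s h y.
Proof. by rewrite !(rdotC _ h) rdotDl. Qed.

Lemma rdotZr s (c : R) x h : rdot s h (fun k => c * x k) = c * rdot s h x.
Proof. by rewrite !(rdotC _ h) rdotZl. Qed.

Lemma rdotNr s x h : rdot s h (fun k => - x k) = - rdot s h x.
Proof. by rewrite !(rdotC _ h) rdotNl. Qed.

Lemma rdot_sqB s x h :
  rdot s (fun k => x k - h k) (fun k => x k - h k) =
  rdot s x x - 2 * rdot s x h + rdot s h h.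
Proof.
by rewrite rdotDl !rdotDr !rdotNl !rdotNr (rdotC _ h x); ring.
Qed.

Lemma rdot_sqD s x h :
  rdot s (fun k => x k + h k) (fun k => x k + h k) =
  rdot s x x + 2 * rdot s x h + rdot s h h.
Proof. by rewrite rdotDl !rdotDr (rdotC _ h x); ring. Qed.

Lemma rdot_sqD_le s x h :
  rdot s (fun k => x k + h k) (fun k => x k + h k) <=
  2 * rdot s x x + 2 * rdot s h h.
Proof.
rewrite rdot_sqD; have := rdot_ge0 s (fun k => x k - h k).
by rewrite rdot_sqB; lra.
Qed.

Lemma rdot_le_coord s x k : k \in s -> x k ^+ 2 <= rdot s x x.
Proof.
move=> ks; rewrite /rdot (perm_big _ (perm_to_rem ks)) big_cons -expr2 lerDl.
exact: rdot_ge0.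
Qed.

Lemma rdot_cauchy s x y : rdot s x y ^+ 2 <= rdot s x x * rdot s y y.
Proof.
have [y0|y0] := eqVneq (rdot s y y) 0.
  have yk k : k \in s -> y k = 0.
    move=> /(rdot_le_coord y); rewrite y0 => h.
    by apply/eqP; rewrite -sqrf_eq0 eq_le h sqr_ge0.
  have -> : rdot s x y = 0.
    by rewrite /rdot big_seq big1// => k /yk ->; rewrite mulr0.
  by rewrite expr0n/= mulr_ge0 ?rdot_ge0.
have yp : 0 < rdot s y y by rewrite lt0r y0 rdot_ge0.
have := rdot_ge0 s (fun k => rdot s y y * x k - rdot s x y * y k).
rewrite rdot_sqB !(rdotZl, rdotZr).
set a := rdot s x x; set b := rdot s y y in yp *; set c := rdot s x y => H.
have : 0 <= b * (a * b - c ^+ 2) by apply: le_trans H _; rewrite le_eqVlt; apply/orP; left; apply/eqP; ring.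
by rewrite pmulr_rge0// subr_ge0.
Qed.

Lemma rdot_le_sum s x y (d : R) : 0 <= d -> rdot s x x <= 1 ->
  (forall k, k \in s -> `|y k| <= d) -> `|rdot s x y| <= (size s)%:R * d.
Proof.
move=> d0 x1 yd; apply: (@le_trans _ _ (\sum_(k <- s) d)); last first.
  by rewrite big_const_seq count_predT iter_addr_0 mulr_natl.
apply: le_trans (ler_norm_sum _ _ _) _; rewrite big_seq [leRHS]big_seq.
apply: ler_sum => k ks; rewrite normrM -[leRHS]mul1r ler_pM//; last exact: yd.
rewrite -(ler_pXn2r (_ : (0 < 2)%N)) ?nnegrE// real_normK ?num_real// expr1n.
exact: le_trans (rdot_le_coord _ ks) x1.
Qed.

Lemma rdot_sq_le s y (d : R) : (forall k, k \in s -> `|y k| <= d) ->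
  rdot s y y <= (size s)%:R * d ^+ 2.
Proof.
move=> yd; apply: (@le_trans _ _ (\sum_(k <- s) d ^+ 2)); last first.
  by rewrite big_const_seq count_predT iter_addr_0 mulr_natl.
rewrite /rdot big_seq [leRHS]big_seq; apply: ler_sum => k ks.
by rewrite -expr2 -real_normK ?num_real// lerXn2r ?nnegrE// ?yd// (le_trans _ (yd _ ks)).
Qed.

Lemma measurable_rdot d (T : measurableType d) (u v : nat -> T -> R) s :
  (forall k, measurable_fun setT (u k)) -> (forall k, measurable_fun setT (v k)) ->
  measurable_fun setT (fun t => rdot s (fun k => u k t) (fun k => v k t)).
Proof. by move=> mu mv; apply: measurable_sum => k; apply: measurable_funM. Qed.

End real_estimates.

Section ball_integrals.
Context {R : realType}.
Implicit Types (x y h tau : nat -> R) (s : seq nat) (m : R).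
Notation mu := (@lebesgue_measure R).

Lemma measurable_powR_expR (a k g sg : R) : measurable_fun setT (fun x : R =>
  if 0 < g - sg * x then (g - sg * x) `^ a * expR (- (k * (g - sg * x))) else 0).
Proof.
have mlin : measurable_fun setT (fun x : R => g - sg * x).
  apply: measurable_funB; first exact: measurable_cst.
  by apply: measurable_funM; [exact: measurable_cst|exact: measurable_id].
apply: measurable_fun_ifT.
- exact: measurable_fun_ltr (measurable_cst _) mlin.
- apply: measurable_funM.
    exact: (@measurableT_comp _ _ _ _ _ _ (fun y : R => y `^ a) setT _ (measurable_powR a) mlin).
  apply: (@measurableT_comp _ _ _ R R R (@expR R)); first exact: measurable_expR.
  by apply: measurableT_comp => //; apply: measurable_funM => //; exact: measurable_cst.
- exact: measurable_cst.
Qed.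

Lemma rdot_upd s k x t : k \notin s -> rdot s (upd x k t) (upd x k t) = rdot s x x.
Proof.
move=> ks; rewrite /rdot big_seq [RHS]big_seq; apply: eq_bigr => i si.
by rewrite /upd; case: eqP => // ik; rewrite -ik si in ks.
Qed.

Lemma prod_upd s k x t (b : nat -> R -> R) : k \notin s ->
  \prod_(i <- s) b i (upd x k t i) = \prod_(i <- s) b i (x i).
Proof.
move=> ks; rewrite big_seq [RHS]big_seq; apply: eq_bigr => i si.
by rewrite /upd; case: eqP => // ik; rewrite -ik si in ks.
Qed.

(* Along the line through [y] in the direction [k0], with [g = sqrt (1 - |y|^2)],
   the weight factors as (1 - S)^a = (g - sg x)^a (g + sg x)^a and only the
   first factor is singular on the half line where sg x >= b. *)
Lemma slices_near (a b : R) : -1 < a -> 0 < b -> exists C : R, 0 < C /\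
  forall k0 s (sg kap c B : R) (bump : nat -> R -> R) (g : (nat -> R) -> \bar R) x,
  uniq (k0 :: s) -> (sg = 1 \/ sg = -1) -> 0 < kap -> 0 <= c -> 0 <= B ->
  (forall k, measurable_fun setT (bump k)) -> (forall k t, 0 <= bump k t) ->
  (forall k, \int[mu]_t (bump k t)%:E <= B%:E)%E ->
  (forall y, 0 <= g y)%E -> coord_measurable g ->
  (forall y, g y <= (if (rdot (k0 :: s) y y < 1) && (b <= sg * y k0) then
      c * (\prod_(k <- s) bump k (y k)) * ((1 - rdot (k0 :: s) y y) `^ a *
      expR (- (kap * (Num.sqrt (1 - rdot s y y) - sg * y k0)))) else 0)%:E)%E ->
  (slices (k0 :: s) g x <= (C * c * kap `^ (- a) / kap * B ^+ size s)%:E)%E.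
Proof.
move=> a1 b0; have [C1 [C10 HC1]] := integral_powR_expR a1.
(* The nonsingular factor satisfies [b <= G + sg t <= 2], so its power [a] is at most [2^a] or [b^a]
   according to the sign of [a]. *)
pose Ca : R := 2 `^ a + b `^ a.
have Ca0 : 0 < Ca by rewrite addr_gt0 ?powR_gt0.
exists (C1 * Ca); split; first by rewrite mulr_gt0.
move=> k0 s sg kap c B bump g x /= /andP[k0s us] sg1 kap0 c0 B0 mb b0' bB g0 mg gle.
(* The singular coordinate becomes the innermost one. After its integration only a product of bumps
   is left, which is the form that [slices_ub] accepts. *)
have -> : slice k0 (slices s g) = slices (rcons s k0) g.
  have := @perm_slices _ (k0 :: s) (rcons s k0) g g0 mg; rewrite /= => ->//.
  by rewrite perm_sym perm_rcons.
rewrite slices_rcons.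
have P0 y : 0 <= \prod_(k <- s) bump k (y k) by apply: prodr_ge0.
apply: slices_ub => //.
- by rewrite !mulr_ge0 ?powR_ge0 ?invr_ge0// ltW.
- exact: slice_ge0.
move=> y _; pose G := Num.sqrt (1 - rdot s y y).
pose T t := if 0 < G - sg * t then (G - sg * t) `^ a * expR (- (kap * (G - sg * t))) else 0.
have T0 t : 0 <= T t by rewrite /T; case: ifP => // _; rewrite mulr_ge0 ?powR_ge0 ?expR_ge0.
pose A := c * (\prod_(k <- s) bump k (y k)) * Ca.
have A0 : 0 <= A by rewrite !mulr_ge0// ltW.
apply: (@le_trans _ _ (\int[mu]_t (A%:E * (T t)%:E))%E).
  rewrite /slice !(@ge0_integralTE _ (measurableTypeR R) R)//; last first.
    by move=> t; rewrite -EFinM lee_fin mulr_ge0.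
  apply: le_ereal_sup => _ [f fg <-]; exists f => // t; apply: le_trans (fg t) _.
  apply: le_trans (gle _) _; rewrite -EFinM lee_fin.
  rewrite rdot_cons rdot_upd// prod_upd// {1 2 3 4}/upd eqxx.
  case: ifPn => [/andP[S1 bt]|_]; last by rewrite mulr_ge0.
  pose q := rdot s y y; rewrite -/q in S1 *.
  have q0 : 0 <= q by exact: rdot_ge0.
  have q1 : 0 <= 1 - q by rewrite -expr2 in S1; have := sqr_ge0 t; lra.
  have G0 : 0 <= G by exact: sqrtr_ge0.
  have G2 : G ^+ 2 = 1 - q by rewrite sqr_sqrtr.
  have st2 : (sg * t) ^+ 2 = t * t by case: sg1 => ->; ring.
  have stG : sg * t < G.
    by rewrite -ltr_sqr ?nnegrE// ?st2 ?G2 ?(le_trans (ltW b0) bt)//; lra.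
  rewrite /T /upd eqxx -/G subr_gt0 stG.
  rewrite (_ : 1 - (t * t + q) = (G - sg * t) * (G + sg * t)); last first.
    by rewrite -subr_sqr st2 G2; ring.
  have st0 : 0 < sg * t by exact: lt_le_trans bt.
  rewrite powRM ?subr_ge0 ?(ltW stG) ?addr_ge0 ?(ltW st0)//.
  rewrite /A -!mulrA ler_wpM2l// ler_wpM2l//.
  rewrite mulrCA ler_wpM2r ?mulr_ge0 ?powR_ge0 ?expR_ge0//.
  have G1 : G <= 1 by rewrite -(ler_pXn2r (_ : (0 < 2)%N)) ?nnegrE ?G2 ?expr1n//; lra.
  have [a0|a0] := leP 0 a.
    apply: (@le_trans _ _ (2 `^ a)); last by rewrite lerDl powR_ge0.
    by clear -G1 stG st0 a0; apply: ge0_ler_powR => //; rewrite ?nnegrE; lra.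
  apply: (@le_trans _ _ (b `^ a)); last by rewrite lerDr powR_ge0.
  by clear -G1 G0 bt b0 a0; apply: le0_ger_powR; lra.
have mT : measurable_fun setT (fun t : R => (T t)%:E).
  by apply/measurable_EFinP; exact: measurable_powR_expR.
rewrite (@ge0_integralZl _ (measurableTypeR R) R mu setT measurableT _ mT)//; last 1 first.
  by move=> t _; rewrite lee_fin.
apply: (@le_trans _ _ (A%:E * (C1 * kap `^ (- a) / kap)%:E)%E).
  by rewrite lee_wpmul2l ?lee_fin//; exact: HC1.
by rewrite -EFinM lee_fin /A le_eqVlt; apply/orP; left; apply/eqP; ring.
Qed.

Lemma coord_measurable_if (P : (nat -> R) -> bool) (f : (nat -> R) -> R) :
  (forall d (T : measurableType d) (u : nat -> T -> R),
    (forall k, measurable_fun setT (u k)) ->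
    measurable_fun setT (fun t => P (fun k => u k t)) /\
    measurable_fun setT (fun t => f (fun k => u k t))) ->
  coord_measurable (fun x => (if P x then f x else 0)%:E).
Proof.
move=> H d T u mu0; apply/measurable_EFinP; have [mP mf] := H d T u mu0.
by apply: measurable_fun_ifT => //; exact: measurable_cst.
Qed.

Definition bump m c (t : R) : R := (1 + (m * (t - c)) ^+ 2)^-1.

Lemma bump_ge0 m c t : 0 <= bump m c t.
Proof. by rewrite invr_ge0 addr_ge0// sqr_ge0. Qed.

Lemma measurable_bump m c (K : R) : measurable_fun setT (fun t => K * bump m c t).
Proof.
apply: continuous_measurable_fun => x.
apply: cvgM; first exact: cvg_cst.
apply: cvgV; first by rewrite gt_eqF// ltr_pwDl// sqr_ge0.
apply: cvgD; first exact: cvg_cst.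
have lc : (m * (y - c)) @[y --> x] --> (m * (x - c)).
  by apply: cvgM; [exact: cvg_cst|apply: cvgB; [exact: cvg_id|exact: cvg_cst]].
exact: (cvgM lc lc).
Qed.

Lemma integral_bump m c (K : R) : 0 < m -> 0 <= K ->
  (\int[mu]_t (K * bump m c t)%:E <= (K * 16 / m)%:E)%E.
Proof.
move=> m0 K0; under eq_integral do rewrite EFinM.
have mb : measurable_fun setT (fun t : R => (bump m c t)%:E).
  apply/measurable_EFinP; rewrite (_ : bump m c = fun t => 1 * bump m c t).
    exact: measurable_bump.
  by apply/funext => t; rewrite mul1r.
rewrite (@ge0_integralZl _ (measurableTypeR R) R mu setT measurableT _ mb)//; last 1 first.
  by move=> t _; rewrite lee_fin bump_ge0.
by rewrite -mulrA EFinM lee_wpmul2l ?lee_fin// integral_rational_bump.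
Qed.

(** [exp(-u) <= 1 / (1 + u)] trades a Gaussian for a rational function whose integral has an
    elementary bound. *)
Lemma expR_bump (th m c t : R) : 0 < th <= 1 ->
  expR (- (th * (m * (t - c)) ^+ 2)) <= th^-1 * bump m c t.
Proof.
move=> /andP[th0 th1]; rewrite expRN -invfM lef_pV2 ?posrE ?expR_gt0 ?mulr_gt0//; last first.
  by rewrite ltr_pwDl// sqr_ge0.
apply: le_trans (expR_ge1Dx _); have := sqr_ge0 (m * (t - c)); nra.
Qed.

Lemma measurable_gap_powR s (a : R) d (T : measurableType d) (u : nat -> T -> R) :
  (forall k, measurable_fun setT (u k)) ->
  measurable_fun setT (fun t => (1 - rdot s (fun k => u k t) (fun k => u k t)) `^ a).
Proof.
move=> mu0; apply: (@measurableT_comp _ _ _ _ _ _ (fun y : R => y `^ a) setT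
  (fun t => 1 - rdot s (fun k => u k t) (fun k => u k t)) (measurable_powR a)).
by apply: measurable_funB; [exact: measurable_cst|exact: measurable_rdot].
Qed.

Lemma measurable_ball_weight (s : seq nat) (a : R) : coord_measurable (fun x =>
  (if rdot s x x < 1 then (1 - rdot s x x) `^ a else 0)%:E).
Proof.
apply: coord_measurable_if => d T u mu0.
split; last exact: measurable_gap_powR.
exact: measurable_fun_ltr (measurable_rdot s mu0 mu0) (measurable_cst _).
Qed.

End ball_integrals.

(** * Finiteness of the weighted volume of the ball *)

Section ball_upper.
Context {R : realType}.
Implicit Types (x y h : nat -> R) (s L : seq nat) (m : R).
Local Notation sq L x := (rdot L x x).

Definition near_weight L a (b sg : R) k x : R :=
  if (sq L x < 1) && (b <= sg * x k) then (1 - sq L x) `^ a else 0.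

Lemma near_weight_ge0 L a b sg k x : 0 <= near_weight L a b sg k x.
Proof. by rewrite /near_weight; case: ifP => // _; rewrite powR_ge0. Qed.

Lemma measurable_near_weight L a b sg k :
  coord_measurable (fun x => (near_weight L a b sg k x)%:E).
Proof.
apply: coord_measurable_if => d T u mu0.
have mr := measurable_rdot L mu0 mu0; split; last exact: measurable_gap_powR.
apply: measurable_and; first exact: measurable_fun_ltr mr (measurable_cst _).
apply: measurable_fun_ler; first exact: measurable_cst.
by apply: measurable_funM => //; exact: measurable_cst.
Qed.

Lemma prod_bump_ge1 L x : sq L x < 1 -> 1 <= \prod_(k <- L) (2 * bump 1 0 (x k)).
Proof.
move=> x1; rewrite big_seq; elim/big_ind: _ => //.
  by move=> u v u1 v1; rewrite mulr_ege1.
move=> k kL; rewrite /bump subr0 mul1r ler_pdivlMr ?ltr_pwDl ?sqr_ge0//.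
by have := rdot_le_coord x kL; lra.
Qed.

Lemma perm_sq L k x : k \in L -> sq L x = sq (k :: rem k L) x.
Proof. by move=> kL; apply: perm_rdot; exact: perm_to_rem. Qed.

Lemma sqrt_gap L k (sg : R) x : k \in L -> (sg = 1 \/ sg = -1) -> sq L x < 1 ->
  let g := Num.sqrt (1 - sq (rem k L) x) in
  [/\ 0 < g, g <= 1, g ^+ 2 = 1 - sq (rem k L) x & sg * x k < g].
Proof.
move=> kL sg1; rewrite (perm_sq _ kL) rdot_cons => S1 g.
have q0 := rdot_ge0 (rem k L) x; have x2 := sqr_ge0 (x k); rewrite expr2 in x2.
have g2 : g ^+ 2 = 1 - sq (rem k L) x by rewrite sqr_sqrtr//; lra.
have g0 : 0 < g by rewrite sqrtr_gt0; lra.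
split=> //.
  by rewrite -(ler_pXn2r (_ : (0 < 2)%N)) ?nnegrE ?g2 ?expr1n ?(ltW g0)//; lra.
have [//|gx] := ltP (sg * x k) g.
have : g ^+ 2 <= (sg * x k) ^+ 2 by rewrite lerXn2r ?nnegrE ?(ltW g0)// (le_trans (ltW g0)).
have -> : (sg * x k) ^+ 2 = x k * x k by case: sg1 => ->; ring.
by rewrite g2; lra.
Qed.

(** The weight is bounded where [|x|^2 <= 1/2]. The rest of the ball is covered by the caps where
    some coordinate has modulus at least [b], and [slices_near] integrates the weight over each
    cap. *)
Lemma ball_weight_finite L (a : R) x : uniq L -> -1 < a -> exists W : R, 0 <= W /\
  (slices L (fun x => (if sq L x < 1 then (1 - sq L x) `^ a else 0)%:E) x <= W%:E)%E.
Proof.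
(* If all coordinates were below [b] in modulus, then [|x|^2 <= n b^2 < 1/2]. *)
move=> uL a1; pose n := size L; pose b : R := (2 * n.+1%:R)^-1.
have n0 : 0 < n.+1%:R :> R by rewrite ltr0n.
have b0 : 0 < b by rewrite invr_gt0 mulr_gt0.
have [C [C0 HC]] := slices_near a1 b0.
pose c0 : R := 1 + 2^-1 `^ a.
have c00 : 0 <= c0 by rewrite addr_ge0// powR_ge0.
pose G0 x := (c0 * if sq L x < 1 then 1 else 0)%:E : \bar R.
pose G k x := (near_weight L a b 1 k x)%:E + (near_weight L a b (-1) k x)%:E : \bar R.
have G00 y : (0 <= G0 y)%E by rewrite lee_fin mulr_ge0//; case: ifP.
have Gk0 k y : (0 <= G k y)%E by rewrite adde_ge0// lee_fin near_weight_ge0.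
have mG0 : coord_measurable G0.
  move=> d T u mu0; apply/measurable_EFinP; apply: measurable_funM; first exact: measurable_cst.
  apply: measurable_fun_ifT; [|exact: measurable_cst|exact: measurable_cst].
  exact: measurable_fun_ltr (measurable_rdot L mu0 mu0) (measurable_cst _).
have mG k : coord_measurable (G k).
  by move=> d T u mu0; apply: emeasurable_funD; exact: measurable_near_weight.
have bnd (sg : R) k : k \in L -> (sg = 1 \/ sg = -1) ->
  (slices L (fun y => (near_weight L a b sg k y)%:E) x <=
   (C * expR 1 * 1 `^ (- a) / 1 * (2 * 16 / 1) ^+ size (rem k L))%:E)%E.
  move=> kL sg1; rewrite (perm_slices _ _ (perm_to_rem kL)); last 2 first.
  - by move=> y; rewrite lee_fin near_weight_ge0.
  - exact: measurable_near_weight.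
  (* [slices_near] expects bumps and an exponential factor. Both are inserted at bounded cost: each
     [2 * bump 1 0] is at least [1] on the ball, and [expR 1] compensates an exponent of size at
     most [1]. *)
  apply: (@HC k (rem k L) sg 1 (expR 1) (2 * 16 / 1) (fun _ t => 2 * bump 1 0 t)) => //.
  - by rewrite -(perm_uniq (perm_to_rem kL)).
  - by move=> ?; exact: measurable_bump.
  - by move=> ? ?; rewrite mulr_ge0// bump_ge0.
  - by move=> ?; exact: integral_bump.
  - by move=> y; rewrite lee_fin near_weight_ge0.
  - exact: measurable_near_weight.
  move=> y; rewrite lee_fin /near_weight (perm_sq y kL); case: ifPn => // /andP[S1 by1].
  have S1' : sq L y < 1 by rewrite (perm_sq y kL).
  have [g0 g1 g2 yg] := sqrt_gap kL sg1 S1'.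
  have P1 : 1 <= \prod_(i <- rem k L) (2 * bump 1 0 (y i)).
    by apply: prod_bump_ge1; move: S1; rewrite rdot_cons; have := sqr_ge0 (y k); rewrite expr2; lra.
  set p := _ `^ a; rewrite mulrCA -[leLHS]mulr1 ler_wpM2l ?powR_ge0//.
  rewrite mulrAC -expRD -[leLHS]mulr1 ler_pM//.
  by apply: le_trans (expR_ge1Dx _); rewrite mul1r lerDl; lra.
pose W0 : R := c0 * (2 * 16 / 1) ^+ size L.
pose W1 : R := \sum_(k <- L) (C * expR 1 * 1 `^ (- a) / 1 * (2 * 16 / 1) ^+ size (rem k L)) *+ 2.
have W00 : 0 <= W0 by rewrite mulr_ge0// exprn_ge0.
have W10 : 0 <= W1.
  apply: sumr_ge0 => k _; rewrite mulrn_wge0// !mulr_ge0 ?expR_ge0 ?powR_ge0 ?exprn_ge0 ?(ltW C0)//.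
exists (W0 + W1); split; first by rewrite addr_ge0.
apply: (@le_trans _ _ (slices L (fun y => G0 y + \sum_(k <- L) G k y)%E x)).
  apply: le_slices.
  - by move=> y; rewrite lee_fin; case: ifP => // _; rewrite powR_ge0.
  - by move=> y; rewrite adde_ge0// sume_ge0.
  move=> y _; case: ifPn => [S1|_]; last by rewrite adde_ge0// sume_ge0.
  have [Sh|Sh] := leP (sq L y) 2^-1.
    apply: (@le_trans _ _ (G0 y)); last by rewrite leeDl// sume_ge0.
    rewrite /G0 S1 lee_fin mulr1 /c0.
    have [a0|a0] := leP 0 a.
      apply: (@le_trans _ _ 1); last by rewrite lerDl powR_ge0.
      have e1 : 1 `^ a = 1 :> R by rewrite powR1.
      rewrite -[leRHS]e1; apply: ge0_ler_powR => //; rewrite ?nnegrE; have := rdot_ge0 L y; lra.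
    apply: (@le_trans _ _ (2^-1 `^ a)); last by rewrite lerDr.
    by apply: le0_ger_powR; lra.
  have [k kL bk] : exists2 k, k \in L & b <= `|y k|.
    apply/hasP; rewrite -[has _ _]negbK -all_predC; apply/negP => /allP yb.
    have : sq L y <= n%:R * b ^+ 2.
      apply: rdot_sq_le => k kL; apply: ltW; rewrite ltNge; exact: yb.
    apply/negP; rewrite -ltNge; apply: le_lt_trans Sh.
    rewrite /b exprVn ler_pdivrMr ?exprn_gt0 ?mulr_gt0// exprMn.
    have : (n%:R <= n.+1%:R :> R) by rewrite ler_nat.
    have : (1 <= n.+1%:R :> R) by rewrite ler1n.
    nra.
  apply: (@le_trans _ _ (\sum_(k <- L) G k y)%E); last by rewrite leeDr.
  rewrite (perm_big _ (perm_to_rem kL)) big_cons.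
  apply: (@le_trans _ _ (G k y)); last by rewrite leeDl// sume_ge0.
  rewrite /G; have [yk|yk] := leP 0 (y k).
    apply: (@le_trans _ _ (near_weight L a b 1 k y)%:E); last by rewrite leeDl// lee_fin near_weight_ge0.
    by rewrite /near_weight S1 mul1r; rewrite ger0_norm// in bk; rewrite bk.
  apply: (@le_trans _ _ (near_weight L a b (-1) k y)%:E); last by rewrite leeDr// lee_fin near_weight_ge0.
  by rewrite /near_weight S1 mulN1r; rewrite ltr0_norm// in bk; rewrite bk.
rewrite slicesD//; last 2 first.
- by move=> y; apply: sume_ge0.
- by move=> d T u mu0; apply: emeasurable_sum => k; exact: mG.
rewrite EFinD leeD//.
  apply: (@slices_ub _ _ _ _ c0 (fun _ t => 2 * bump 1 0 t)) => //.
  - by move=> k _; exact: measurable_bump.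
  - by move=> k t; rewrite mulr_ge0// bump_ge0.
  - by move=> k _; exact: integral_bump.
  move=> y _; rewrite lee_fin ler_wpM2l//; case: ifPn => [/prod_bump_ge1//|_].
  by apply: prodr_ge0 => k _; rewrite mulr_ge0// bump_ge0.
rewrite slices_sum// /W1 -sumEFin big_seq [leRHS]big_seq; apply: lee_sum => k kL.
rewrite slicesD; last 4 first.
- by move=> y; rewrite lee_fin near_weight_ge0.
- exact: measurable_near_weight.
- by move=> y; rewrite lee_fin near_weight_ge0.
- exact: measurable_near_weight.
by rewrite mulr2n EFinD leeD// bnd//; [left|right].
Qed.

End ball_upper.

(** * Upper bounds for integrals of peaks over the ball and over cones *)

Section peak_upper.
Context {R : realType}.
Implicit Types (x y h : nat -> R) (s L : seq nat) (m : R).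
Local Notation sq L x := (rdot L x x).

Lemma rdot1_coord L h : sq L h = 1 -> exists2 k, k \in L & h k != 0.
Proof.
move=> h1; apply/hasP; rewrite -[has _ _]negbK -all_predC; apply/negP => /allP h0.
have : sq L h = 0.
  by rewrite /rdot big_seq big1// => k /h0/=; rewrite negbK => /eqP ->; rewrite mulr0.
by rewrite h1 => /eqP; rewrite oner_eq0.
Qed.

Lemma sgn_abs (t : R) : t != 0 -> exists sg : R, (sg = 1 \/ sg = -1) /\ 0 < sg * t.
Proof.
move=> t0; have [tp|tn] := ltP 0 t; [exists 1|exists (-1)].
  by split; [left|rewrite mul1r].
by split; [right|rewrite mulN1r oppr_gt0 lt_neqAle t0].
Qed.

Lemma measurable_peak_weight L h (c a : R) : coord_measurable (fun x =>
  (if sq L x < 1 then expR (- (c * (1 - rdot L x h))) * (1 - sq L x) `^ a else 0)%:E).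
Proof.
apply: coord_measurable_if => d T u mu0.
have mr := measurable_rdot L mu0 mu0; split.
  exact: measurable_fun_ltr mr (measurable_cst _).
apply: measurable_funM; last exact: measurable_gap_powR.
apply: (@measurableT_comp _ _ _ _ _ _ (@expR R) setT); first exact: measurable_expR.
apply: measurableT_comp => //; apply: measurable_funM; first exact: measurable_cst.
apply: measurable_funB; first exact: measurable_cst.
by apply: measurable_rdot => // k; exact: measurable_cst.
Qed.

Lemma measurable_inv_sqrt d (T : measurableType d) (f : T -> R) :
  measurable_fun setT f -> (forall t, 0 <= f t) ->
  measurable_fun setT (fun t => (Num.sqrt (f t))^-1).
Proof.
move=> mf f0.
rewrite (_ : (fun t => _) = (fun y : R => (y `^ 2^-1) `^ (-1)) \o f).
  apply: measurableT_comp => //.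
  exact: (@measurableT_comp _ _ _ _ _ _ (fun y : R => y `^ (-1)) setT _ (measurable_powR _)
    (measurable_powR _)).
apply/funext => t /=; by rewrite powR12_sqrt// powR_inv1// sqrtr_ge0.
Qed.

Lemma expR_powR_le (p : R) : 0 <= p -> exists2 K : R, 0 < K &
  forall v, 0 < v -> expR (- v) <= K * v `^ (- p).
Proof.
move=> p0; have [K [K0 HK]] := powR_expR_le p; exists K => // v v0.
have := HK v v0; rewrite [p < 0]ltNge p0 andbF addr0 => H.
rewrite powRN ler_pdivlMr ?powR_gt0// mulrC; apply: le_trans H _.
rewrite ler_pdivrMr ?ltr_pwDl ?sqr_ge0// ler_peMr ?(ltW K0)//.
by rewrite lerDl sqr_ge0.
Qed.

(** Near [h] the exponent dominates a Gaussian in all coordinates but one plus a multiple of the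
    distance to the sphere along the last one. This gives [size L - 1] factors [1/m] and a radial
    factor [m^(-2a) / m^2]. Away from [h] the exponential is negligible against the total weight
    [W]. *)
Lemma slices_peak_ball L (a : R) h x0 : uniq L -> -1 < a -> sq L h = 1 ->
  exists2 C : R, 0 <= C & forall m, 1 <= m ->
  (slices L (fun x => (if sq L x < 1 then
      expR (- (m ^+ 2 / 4 * (1 - rdot L x h))) * (1 - sq L x) `^ a else 0)%:E) x0 <=
   (C * m^-1 ^+ (size L).-1 * (m ^+ 2) `^ (- a) / m ^+ 2)%:E)%E.
Proof.
move=> uL a1 h1; have [k kL hk] := rdot1_coord h1.
have [sg [sg1]] := sgn_abs hk; move bE : (sg * h k) => b b0.
have [W [W0 HW]] := ball_weight_finite x0 uL a1.
have b20 : 0 < b / 2 by rewrite divr_gt0.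
have [C [C0 HC]] := slices_near a1 b20.
pose s := rem k L; have szs : size s = (size L).-1 by exact: size_rem.
(* With this exponent [(m^2)^(-p)] is [m^(-2 size s)] times the radial factor, so the far part is
   below the required order. *)
pose p : R := (size s)%:R + (a + 1).
have p0 : 0 <= p by rewrite addr_ge0// ltW//; lra.
have [K K0 HK] := expR_powR_le p0.
(* A quarter of [b^2 / 8], which bounds [1 - <x, h>] from below where [sg x_k < b / 2]. *)
pose th : R := b ^+ 2 / 32.
have th0 : 0 < th by rewrite divr_gt0 ?exprn_gt0.
pose C1 := C * ((b / 4) `^ (- a) / (b / 4) * 128 ^+ size s).
pose C2 := K * th `^ (- p) * W.
have C10 : 0 <= C1.
  by rewrite !mulr_ge0 ?invr_ge0 ?powR_ge0 ?exprn_ge0 ?(ltW C0) ?mulr_ge0 ?(ltW b0) ?invr_ge0 ?ler0n.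
have C20 : 0 <= C2 by rewrite !mulr_ge0 ?powR_ge0 ?(ltW K0).
exists (C1 + C2); first by rewrite addr_ge0.
move=> m m1; have m0 : 0 < m by exact: lt_le_trans m1.
have m20 : 0 < m ^+ 2 by rewrite exprn_gt0.
pose Nr x := ((fun x => if (sq L x < 1) && (b / 2 <= sg * x k) then
  expR (- (m ^+ 2 / 4 * (1 - rdot L x h))) * (1 - sq L x) `^ a else 0) x)%:E : \bar R.
pose Fr x := ((expR (- (th * m ^+ 2)))%:E * (if sq L x < 1 then (1 - sq L x) `^ a else 0)%:E)%E : \bar R.
have w0 x : 0 <= if sq L x < 1 then (1 - sq L x) `^ a else 0.
  by case: ifP => // _; rewrite powR_ge0.
have Nr0 x : (0 <= Nr x)%E.
  by rewrite lee_fin; case: ifP => // _; rewrite mulr_ge0 ?powR_ge0 ?expR_ge0.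
have Fr0 x : (0 <= Fr x)%E by rewrite mule_ge0// lee_fin// expR_ge0.
have mFr : coord_measurable Fr.
  by move=> d T u mu0; apply: measurable_funeM; exact: measurable_ball_weight.
have mNr : coord_measurable Nr.
  have E x : Nr x = (if b / 2 <= sg * x k then (if sq L x < 1 then
      expR (- (m ^+ 2 / 4 * (1 - rdot L x h))) * (1 - sq L x) `^ a else 0) else 0)%:E.
    by rewrite /Nr andbC; case: (b / 2 <= _).
  rewrite (funext E); apply: coord_measurable_if => d T u mu0; split.
    apply: measurable_fun_ler; first exact: measurable_cst.
    by apply: measurable_funM => //; exact: measurable_cst.
  by have := @measurable_peak_weight L h (m ^+ 2 / 4) a d T u mu0 => /measurable_EFinP.
apply: (@le_trans _ _ (slices L (fun x => Nr x + Fr x)%E x0)).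
  apply: le_slices => [x|x|x _].
  - by rewrite lee_fin; case: ifP => // _; rewrite mulr_ge0 ?powR_ge0 ?expR_ge0.
  - by rewrite adde_ge0.
  have [S1|S1] := ltP (sq L x) 1; last by rewrite adde_ge0.
  have [bx|bx] := leP (b / 2) (sg * x k).
    by rewrite /Nr S1 bx/= leeDl.
  rewrite /Fr S1; apply: (@le_trans _ _ ((expR (- (th * m ^+ 2)))%:E * ((1 - sq L x) `^ a)%:E)%E);
    last by rewrite leeDr.
  rewrite -EFinM lee_fin ler_wpM2r ?powR_ge0// ler_expR lerN2.
  have := rdot_le_coord (fun i => x i - h i) kL; rewrite rdot_sqB h1.
  have : (b / 2) ^+ 2 <= (x k - h k) ^+ 2.
    have -> : (x k - h k) ^+ 2 = (b - sg * x k) ^+ 2 by rewrite -bE; case: sg1 => ->; ring.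
    by clear -b0 bx; rewrite lerXn2r ?nnegrE; lra.
  rewrite /th; set z := 1 - rdot L x h => zb xb.
  have : b ^+ 2 / 8 <= z by rewrite /z; nra.
  by move=> zb'; rewrite mulrC -mulrA ler_pM2l//; lra.
have w0' x : (0 <= (if sq L x < 1 then (1 - sq L x) `^ a else 0)%:E)%E by rewrite lee_fin.
rewrite slicesD// /Fr (slicesZl L (expR_ge0 _) w0' (@measurable_ball_weight _ L a)).
rewrite (_ : (C1 + C2) * _ * _ / _ =
   C1 * m^-1 ^+ (size L).-1 * (m ^+ 2) `^ (- a) / m ^+ 2 +
   C2 * m^-1 ^+ (size L).-1 * (m ^+ 2) `^ (- a) / m ^+ 2); last by ring.
rewrite EFinD leeD//.
  rewrite (perm_slices _ _ (perm_to_rem kL))//.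
  have kap0 : 0 < m ^+ 2 * (b / 4) by rewrite !mulr_gt0.
  have th8 : (0 < 8^-1 :> R) && (8^-1 <= 1 :> R) by rewrite invr_gt0 ltr0n invf_le1 ?ltr0n// ler1n.
  apply: le_trans (_ : (_ <= (C * 1 * (m ^+ 2 * (b / 4)) `^ (- a) / (m ^+ 2 * (b / 4)) *
     (8^-1^-1 * 16 / m) ^+ size s)%:E)%E) _.
    apply: (@HC k s sg (m ^+ 2 * (b / 4)) 1 (8^-1^-1 * 16 / m) (fun i t => 8^-1^-1 * bump m (h i) t)) => //.
    - by rewrite -(perm_uniq (perm_to_rem kL)).
    - by rewrite !mulr_ge0 ?invr_ge0 ?(ltW m0).
    - by move=> i; exact: measurable_bump.
    - by move=> i t; apply: mulr_ge0; [rewrite !invr_ge0|exact: bump_ge0].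
    - by move=> i; apply: integral_bump; rewrite ?invr_ge0.
    move=> y; rewrite lee_fin -(perm_sq y kL).
    case: ifPn => // /andP[S1 bx]; rewrite mul1r.
    rewrite [leLHS]mulrC [leRHS]mulrCA ler_wpM2l ?powR_ge0//.
    have [g0 g1 g2 yg] := sqrt_gap kL sg1 S1.
    rewrite -/s in g0 g1 g2 yg *; set g := Num.sqrt _ in g0 g1 g2 yg *.
    apply: (@le_trans _ _ (\prod_(i <- s) expR (- (8^-1 * (m * (y i - h i)) ^+ 2)) *
       expR (- (m ^+ 2 * (b / 4) * (g - sg * y k))))); last first.
      rewrite ler_wpM2r ?expR_ge0//; apply: ler_prod => i _.
      by rewrite expR_ge0/= expR_bump.
    rewrite -expR_sum -expRD ler_expR sumrN -opprD lerN2.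
    have -> : \sum_(i <- s) 8^-1 * (m * (y i - h i)) ^+ 2 =
      m ^+ 2 / 8 * sq s (fun i => y i - h i).
      by rewrite /rdot mulr_sumr; apply: eq_bigr => i _; field.
    rewrite rdot_sqB (perm_rdot y h (perm_to_rem kL)) rdot_cons -/s.
    have hs : h k * h k + sq s h = 1 by rewrite -h1 (perm_sq h kL) rdot_cons.
    have hb : b ^+ 2 = h k * h k by rewrite -bE; case: sg1 => ->; ring.
    have yb : y k * h k = b * (sg * y k) by rewrite -bE; case: sg1 => ->; ring.
    have -> : sq s y = 1 - g ^+ 2 by rewrite g2; ring.
    have -> : sq s h = 1 - b ^+ 2 by rewrite hb -hs; ring.
    (* With [y'], [h'] the remaining coordinates and [t = sg y_k], the identity is [1 - <y, h> = |y'
       - h'|^2 / 2 + b (g - t) + (g - b)^2 / 2]; the last square is dropped. *)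
    rewrite yb -subr_ge0; set t := sg * y k; set d := rdot s y h.
    have -> : m ^+ 2 / 4 * (1 - (b * t + d)) - (m ^+ 2 / 8 *
       (1 - g ^+ 2 - 2 * d + (1 - b ^+ 2)) + m ^+ 2 * (b / 4) * (g - t)) =
       m ^+ 2 / 8 * (g - b) ^+ 2 by field.
    by rewrite mulr_ge0 ?sqr_ge0// divr_ge0 ?sqr_ge0.
  rewrite lee_fin powRM ?(ltW m20)//; last by rewrite divr_ge0 // ltW.
  rewrite szs invrK le_eqVlt; apply/orP; left; apply/eqP; rewrite /C1 szs.
  rewrite (_ : 8 * 16 / m = 128 * m^-1); last by rewrite -natrM.
  rewrite exprMn; move: (_ ^+ (size L).-1) => u; move: (_ ^+ (size L).-1) => v.
  by field; rewrite !gt_eqF.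
apply: (@le_trans _ _ ((expR (- (th * m ^+ 2)))%:E * W%:E)%E).
  by rewrite lee_wpmul2l// lee_fin expR_ge0.
rewrite -EFinM lee_fin mulrC /C2.
rewrite (_ : K * _ * W * _ * _ / _ = W * (K * (th `^ (- p) *
   (m^-1 ^+ (size L).-1 * (m ^+ 2) `^ (- a) / m ^+ 2)))); last by ring.
rewrite ler_wpM2l//; apply: le_trans (HK _ (mulr_gt0 th0 m20)) _.
rewrite ler_wpM2l ?(ltW K0)// powRM ?(ltW th0) ?(ltW m20)// ler_wpM2l ?powR_ge0//.
have -> : (m ^+ 2) `^ (- p) = (m ^+ 2)^-1 ^+ (size L).-1 * ((m ^+ 2) `^ (- a) / m ^+ 2).
  rewrite /p !opprD !powRD ?(gt_eqF m20) ?implybT//.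
  by rewrite powR_invn ?(ltW m20)// powR_inv1 ?(ltW m20)// szs exprVn.
rewrite -mulrA ler_wpM2r ?divr_ge0 ?powR_ge0 ?(ltW m20)//.
apply: lerXn2r; rewrite ?nnegrE ?invr_ge0 ?(ltW m20) ?(ltW m0)//.
by rewrite lef_pV2 ?posrE// expr2 ler_peMr// ltW.
Qed.

Lemma measurable_cone_peak L h (c r : R) : coord_measurable (fun x =>
  (if sq L x < 1 then expR (- (c * (1 - r * ((Num.sqrt (sq L x))^-1 * rdot L x h)))) else 0)%:E).
Proof.
apply: coord_measurable_if => d T u mu0.
have mr := measurable_rdot L mu0 mu0; split.
  exact: measurable_fun_ltr mr (measurable_cst _).
apply: (@measurableT_comp _ _ _ _ _ _ (@expR R) setT); first exact: measurable_expR.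
apply: measurableT_comp => //; apply: measurable_funM; first exact: measurable_cst.
apply: measurable_funB; first exact: measurable_cst.
apply: measurable_funM; first exact: measurable_cst.
apply: measurable_funM; first by apply: measurable_inv_sqrt => // t; exact: rdot_ge0.
by apply: measurable_rdot => // i; exact: measurable_cst.
Qed.

(** The integrand is constant along rays, so it does not decay in the radial direction and
    concentrates around the line of [h]. With [x_k = t] fixed, the other coordinates are Gaussian
    around [t h_i / h_k]. The bound is uniform in [r], as a supremum over [r] will be taken. *)
Lemma slices_peak_cone L h x0 : uniq L -> sq L h = 1 ->
  exists2 C : R, 0 <= C & forall m r, 1 <= m -> 0 < r < 1 ->
  (slices L (fun x => (if sq L x < 1 then
      expR (- (m ^+ 2 / 4 * (1 - r * ((Num.sqrt (sq L x))^-1 * rdot L x h)))) else 0)%:E) x0 <=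
   (C * m^-1 ^+ (size L).-1)%:E)%E.
Proof.
move=> uL h1; have [k kL hk] := rdot1_coord h1.
pose s := rem k L; have szs : size s = (size L).-1 by exact: size_rem.
pose mu i := h i / h k.
(* [th] is small enough that the squared deviations, each at most [2 (1 + 1 / h_k^2) |w - h|^2] for
   the normalized point [w], add up with weight [4 th] to at most [|w - h|^2 / 4]. *)
move thE : (32 * (size s).+1%:R * (1 + (h k)^-1 ^+ 2))^-1 => th.
have den0 : 1 <= 32 * (size s).+1%:R * (1 + (h k)^-1 ^+ 2).
  rewrite !mulr_ege1 ?ler1n//; last by rewrite lerDl sqr_ge0.
have th1 : 0 < th <= 1.
  by rewrite -thE invr_gt0 (lt_le_trans _ den0)//= invf_le1// (lt_le_trans _ den0).
have th0 : 0 < th by case/andP: th1.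
pose C := 2 * 16 / 1 * (th^-1 * 16) ^+ size s.
have C0 : 0 <= C by rewrite !mulr_ge0 ?exprn_ge0 ?mulr_ge0 ?invr_ge0 ?(ltW th0) ?ler0n.
exists C => // m r m1 /andP[r0 r1]; have m0 : 0 < m by exact: lt_le_trans m1.
set g := fun x => _.
have g0 x : (0 <= g x)%E by rewrite lee_fin; case: ifP => // _; rewrite expR_ge0.
have mg : coord_measurable g by exact: measurable_cone_peak.
rewrite (perm_slices g0 mg (perm_to_rem kL)) /= -/s.
have B0 : 0 <= (th^-1 * 16 / m) ^+ size s.
  by rewrite exprn_ge0// !mulr_ge0 ?invr_ge0 ?(ltW th0) ?(ltW m0).
apply: (@le_trans _ _ (((th^-1 * 16 / m) ^+ size s)%:E * (2 * 16 / 1)%:E)%E); last first.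
  rewrite -EFinM lee_fin /C -szs le_eqVlt; apply/orP; left; apply/eqP.
  by rewrite [in LHS]exprMn; ring.
apply: (@le_trans _ _ (((th^-1 * 16 / m) ^+ size s)%:E *
   \int[lebesgue_measure]_t (2 * bump 1 0 t)%:E)%E); last first.
  by rewrite lee_wpmul2l ?lee_fin// integral_bump.
have mb : measurable_fun setT (fun t : R => (2 * bump 1 0 t)%:E).
  by apply/measurable_EFinP; exact: measurable_bump.
rewrite -(@ge0_integralZl _ (measurableTypeR R) R _ setT measurableT _ mb)//; last 1 first.
  by move=> t _; rewrite lee_fin mulr_ge0// bump_ge0.
rewrite /slice !(@ge0_integralTE _ (measurableTypeR R) R)//; last 2 first.
- by move=> t; exact: slices_ge0.
- by move=> t; rewrite -EFinM lee_fin !mulr_ge0// bump_ge0.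
apply: le_ereal_sup => _ [f fg <-]; exists f => // t; apply: le_trans (fg t) _.
rewrite -EFinM mulrC.
have us : uniq (k :: s) by rewrite -(perm_uniq (perm_to_rem kL)).
apply: (@slices_ub _ _ _ _ _ (fun i u => th^-1 * bump m (t * mu i) u)) => //.
- by case/andP: us.
- by rewrite mulr_ge0// bump_ge0.
- by rewrite !mulr_ge0 ?invr_ge0 ?(ltW th0) ?(ltW m0).
- by move=> i _; exact: measurable_bump.
- by move=> i u; rewrite mulr_ge0 ?bump_ge0// invr_ge0 ltW.
- by move=> i _; apply: integral_bump; rewrite ?invr_ge0 ?(ltW th0).
move=> y oy; have yk : y k = t by rewrite (oy k) /upd ?eqxx//; case/andP: us.
have P0 : 0 <= \prod_(i <- s) (th^-1 * bump m (t * mu i) (y i)).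
  by apply: prodr_ge0 => i _; rewrite mulr_ge0 ?bump_ge0// invr_ge0 ltW.
rewrite lee_fin; case: ifPn => [S1|_]; last by rewrite !mulr_ge0// bump_ge0.
rewrite -[leLHS]mul1r ler_pM ?expR_ge0//.
  rewrite /bump subr0 mul1r ler_pdivlMr ?ltr_pwDl ?sqr_ge0// mul1r.
  by rewrite -yk; have := rdot_le_coord y kL; lra.
apply: (@le_trans _ _ (\prod_(i <- s) expR (- (th * (m * (y i - t * mu i)) ^+ 2)))); last first.
  by apply: ler_prod => i _; rewrite expR_ge0/= expR_bump.
rewrite -expR_sum ler_expR sumrN lerN2.
have -> : \sum_(i <- s) th * (m * (y i - t * mu i)) ^+ 2 =
    m ^+ 2 / 4 * (4 * th * \sum_(i <- s) (y i - t * mu i) ^+ 2).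
  by rewrite !mulr_sumr; apply: eq_bigr => i _; field.
rewrite ler_wpM2l ?divr_ge0 ?sqr_ge0//.
set rho := Num.sqrt (sq L y); have rho0 : 0 <= rho by exact: sqrtr_ge0.
have rho2 : rho ^+ 2 = sq L y by rewrite sqr_sqrtr// rdot_ge0.
have rho1 : rho <= 1 by rewrite -(ler_pXn2r (_ : (0 < 2)%N)) ?nnegrE// rho2 expr1n ltW.
(* At the apex [rho = 0] the inverse is [0] by convention; then [w = 0], and both [y = rho w] and
   [|w| <= 1] persist. *)
pose w i := rho^-1 * y i.
have yw i : i \in L -> y i = rho * w i.
  move=> iL; have [r00|rn0] := eqVneq rho 0; last by rewrite mulrA divff// mul1r.
  have := rdot_le_coord y iL; rewrite -rho2 r00 expr0n/= mul0r => y2.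
  by apply/eqP; rewrite -sqrf_eq0 eq_le y2 sqr_ge0.
have wh : rho^-1 * rdot L y h = rdot L w h by rewrite rdotZl.
have w1 : sq L w <= 1.
  rewrite rdotZl rdotZr -rho2; have [->|rn0] := eqVneq rho 0.
    by rewrite invr0 mul0r.
  by rewrite expr2 mulKf// mulVf.
have wc := rdot_cauchy L w h; rewrite h1 mulr1 in wc.
have wd := rdot_ge0 L (fun i => w i - h i).
rewrite wh; set c := rdot L w h in wc *.
have c1 : -1 <= c <= 1.
  by rewrite -ler_norml -(ler_pXn2r (_ : (0 < 2)%N)) ?nnegrE// real_normK ?num_real// expr1n (le_trans wc).
(* For [c] in [[-1, 1]] and [0 < r < 1] one has [1 - r c >= (1 - c) / 2], which removes the
   dependence on [r]. *)
apply: (@le_trans _ _ (sq L (fun i => w i - h i) / 4)); last first.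
  rewrite rdot_sqB h1 -/c; move/andP: c1 => [c1 c2].
  have : (1 - c) / 2 <= 1 - r * c by nra.
  lra.
set Q := sq L _; have Q0 : 0 <= Q by [].
have bnd i : i \in s -> (y i - t * mu i) ^+ 2 <= 2 * (1 + (h k)^-1 ^+ 2) * Q.
  move=> si; have iL : i \in L by rewrite (mem_rem si).
  rewrite -yk (yw i iL) (yw k kL).
  have -> : rho * w i - rho * w k * mu i = rho * ((w i - h i) - mu i * (w k - h k)).
    by rewrite /mu; field.
  rewrite exprMn; apply: (@le_trans _ _ (1 * (2 * (w i - h i) ^+ 2 + 2 * (mu i * (w k - h k)) ^+ 2))).
    rewrite ler_pM ?sqr_ge0 ?exprn_ile1//.
    by have := sqr_ge0 ((w i - h i) + mu i * (w k - h k)); nra.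
  have wi := rdot_le_coord (fun i => w i - h i) iL.
  have wk := rdot_le_coord (fun i => w i - h i) kL.
  rewrite -/Q /= in wi wk.
  have mu2 : (mu i) ^+ 2 <= (h k)^-1 ^+ 2.
    rewrite /mu exprMn ler_piMl ?sqr_ge0//; have := rdot_le_coord h iL; by rewrite h1.
  rewrite mul1r exprMn; have := ler_pM (sqr_ge0 _) (sqr_ge0 _) mu2 wk; nra.
apply: (@le_trans _ _ (4 * th * \sum_(i <- s) (2 * (1 + (h k)^-1 ^+ 2) * Q))).
  rewrite ler_wpM2l ?mulr_ge0 ?(ltW th0)// big_seq [leRHS]big_seq.
  by apply: ler_sum => i /bnd.
rewrite big_const_seq count_predT iter_addr_0 -[(_ * Q) *+ _]mulr_natl -thE.
set n := (size s)%:R; set z := 1 + _.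
have z1 : 1 <= z by rewrite lerDl sqr_ge0.
have n0 : 0 <= n by rewrite ler0n.
have -> : (size s).+1%:R = n + 1 :> R by rewrite -addn1 natrD.
rewrite [leLHS](_ : _ = (n / (n + 1)) * (Q / 4)); last first.
  by field; rewrite !gt_eqF//; lra.
by rewrite ler_piMl ?divr_ge0// ler_pdivrMr; clear -n0; lra.
Qed.

End peak_upper.

(** * Lower bound for the weighted measure of the test region *)

Section lower_bounds.
Context {R : realType}.
Implicit Types (x y h tau : nat -> R) (s L : seq nat) (m : R).
Local Notation sq L x := (rdot L x x).

(** Prescribing the other coordinates and the gap [rho / m^2] determines [X^2]. A bootstrap recovers
    [X]: dividing by [X + H >= H] first gives [|X - H| <= d], and feeding this back places
    [m (X - H)] within [O(d)] of [T]. *)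
Lemma radial_coord_bound (m H T d X dE qY rho n K : R) (A := 2 * n + 1) :
  0 < m -> 0 < H -> 0 < d -> d <= 1 -> 0 <= X -> 0 <= n -> `|dE| <= n * d ->
  0 <= qY <= K -> 1 <= rho -> rho <= 4 -> K + 4 <= m * d -> 2 * H * `|T| + A <= m * (H * d) ->
  m * (X ^+ 2 - H ^+ 2) = 2 * H * T + (- 2 * dE - m^-1 * (qY + rho)) ->
  `|m * (X - H) - T| <= (`|T| + A) / H * d.
Proof.
move=> m0 H0 d0 d1 X0 n0 dEb /andP[qY0 qYK] rho1 rho4 e1 e2; set e := - 2 * dE - _ => X2e.
have mi0 : 0 < m^-1 by rewrite invr_gt0.
have eb : `|e| <= A * d.
  have h1 : m^-1 * (qY + rho) <= d by rewrite mulrC ler_pdivrMr//; lra.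
  have h2 : 0 <= m^-1 * (qY + rho) by rewrite mulr_ge0 ?(ltW mi0)//; lra.
  apply: le_trans (ler_normB _ _) _; rewrite mulNr normrN normrM (ger0_norm h2) ger0_norm//.
  have -> : A * d = 2 * (n * d) + d by rewrite /A; ring.
  by rewrite lerD// ler_wpM2l.
have A0 : 0 <= A by rewrite /A; lra.
have eb' : `|e| <= A by apply: le_trans eb _; rewrite ler_piMr// ltW.
clearbody e A.
have XH0 : 0 <= X + H by lra.
have XH : `|H - X| <= d.
  have a1 : `|H - X| * H <= `|H - X| * (X + H) by rewrite ler_wpM2l//; lra.
  have a2 : `|H - X| * (X + H) = `|2 * H * T + e| / m.
    rewrite -X2e normrM (gtr0_norm m0) mulrAC divff ?gt_eqF// mul1r subr_sqr normrM.
    by rewrite distrC (ger0_norm XH0).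
  have a3 : `|2 * H * T + e| <= 2 * H * `|T| + A.
    by apply: le_trans (ler_normD _ _) _; rewrite normrM (@ger0_norm _ (2 * H)) ?mulr_ge0 ?(ltW H0)// lerD2l.
  rewrite -(ler_pM2r H0); apply: le_trans a1 _; rewrite a2 ler_pdivrMr//.
  apply: le_trans a3 _; apply: le_trans e2 _.
  by rewrite le_eqVlt; apply/orP; left; apply/eqP; ring.
have key : (m * (X - H) - T) * (X + H) = T * (H - X) + e.
  have -> : (m * (X - H) - T) * (X + H) = m * (X ^+ 2 - H ^+ 2) - T * (X + H) by ring.
  by rewrite X2e; ring.
rewrite mulrAC ler_pdivlMr//.
apply: (@le_trans _ _ (`|m * (X - H) - T| * (X + H))); first by rewrite ler_wpM2l//; lra.
rewrite -(ger0_norm XH0) -normrM key; apply: le_trans (ler_normD _ _) _.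
by rewrite normrM mulrDl lerD// ler_wpM2l.
Qed.

(* The admissible points form a set of width of order [m ^- 2] in a direction [k]
   with [h k != 0] and of width of order [m^-1] in the other directions. *)
Lemma slices_lb_ball L h tau (eps : R) x0 : uniq L -> sq L h = 1 -> rdot L tau h = 0 -> 0 < eps ->
  exists c m0 : R, [/\ 0 < c, 1 <= m0 & forall m (w : R) (g : (nat -> R) -> \bar R),
    m0 <= m -> 0 <= w -> (forall x, 0 <= g x)%E -> coord_measurable g ->
    (forall x, sq L x < 1 ->
       sq L (fun i => m * (x i - h i) - tau i) <= eps ^+ 2 ->
       1 <= m ^+ 2 * (1 - sq L x) <= 4 -> (w%:E <= g x)%E) ->
    ((w * c * m^-1 ^+ (size L).-1 / m ^+ 2)%:E <= slices L g x0)%E].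
Proof.
move=> uL h1 th0 eps0; have [k kL hk] := rdot1_coord h1.
have [sg [sg1]] := sgn_abs hk; move HE : (sg * h k) => H H0.
pose s := rem k L; have szs : size s = (size L).-1 by exact: size_rem.
have us : uniq (k :: s) by rewrite -(perm_uniq (perm_to_rem kL)).
have ks : k \notin s by case/andP: us.
move nE : ((size s)%:R : R) => n; have n0 : 0 <= n by rewrite -nE ler0n.
move TE : (sg * tau k) => T.
pose A := 2 * n + 1; pose B := n + ((`|T| + A) / H) ^+ 2 + 1.
have A0 : 0 < A by rewrite /A; lra.
have B1 : 1 <= B by rewrite /B lerDr addr_ge0// sqr_ge0.
(* [d] is the half-width of the box in rescaled coordinates. [B] collects the squared errors of all
   coordinates in units of [d^2], so the rescaled point ends within [eps] of [tau]. *)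
have [d [d0 d1 dB]] : exists d : R, [/\ 0 < d, d <= 1 & d ^+ 2 * B <= eps ^+ 2].
  exists (Num.min 1 (eps / B)); have B0 : 0 < B by lra.
  have e0 : 0 < eps / B by rewrite divr_gt0.
  split; [by rewrite lt_min ltr01| by rewrite ge_min lexx|].
  apply: (@le_trans _ _ ((eps / B) ^+ 2 * B)).
    rewrite ler_wpM2r ?(ltW B0)// lerXn2r ?nnegrE ?(ltW e0)// ?le_min ?ler01 ?(ltW e0)//.
    by rewrite ge_min lexx orbT.
  rewrite expr2 -mulrA divfK ?gt_eqF// mulrAC -expr2 ler_piMr ?sqr_ge0//.
  by rewrite invf_le1.
pose K := 2 * sq s tau + 2 * n.
have K0 : 0 <= K by rewrite /K addr_ge0// mulr_ge0// rdot_ge0.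
pose q1 := (K + 4) / d; pose q2 := (2 * H * `|T| + A) / (H * d).
pose q3 := (2 * H * `|T| + 2 * n + K + 4) / H ^+ 2.
have HT0 : 0 <= 2 * H * `|T| by rewrite !mulr_ge0// ltW.
have q10 : 0 <= q1 by rewrite divr_ge0 ?(ltW d0)//; lra.
have q20 : 0 <= q2 by rewrite divr_ge0 ?mulr_ge0 ?(ltW d0) ?(ltW H0)//; lra.
have q30 : 0 <= q3 by rewrite divr_ge0 ?sqr_ge0//; lra.
exists (3 / 2 * (2 * d) ^+ size s), (1 + q1 + q2 + q3); split.
- by rewrite !mulr_gt0// exprn_gt0// mulr_gt0.
- by lra.
move=> m w g mm w0 g0 mg gw; have m1 : 1 <= m by lra.
have m0 : 0 < m by lra.
have m20 : 0 < m ^+ 2 by rewrite exprn_gt0.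
have e1 : K + 4 <= m * d by rewrite -ler_pdivrMr// -/q1; clear -mm q10 q20 q30; lra.
have e2 : 2 * H * `|T| + A <= m * (H * d).
  by rewrite -ler_pdivrMr ?mulr_gt0// -/q2; clear -mm q10 q20 q30; lra.
have e3 : 2 * H * `|T| + 2 * n + K + 4 <= m * H ^+ 2.
  by rewrite -ler_pdivrMr ?exprn_gt0// -/q3; clear -mm q10 q20 q30; lra.
have -> : slices L g = slices s (slice k g).
  rewrite -slices_rcons; apply: perm_slices => //.
  by rewrite perm_sym perm_rcons perm_sym; exact: perm_to_rem.
rewrite -szs (_ : w * _ * _ / _ = (w * (3 / 2 / m ^+ 2)) * (2 * d / m) ^+ size s); last first.
  by rewrite [in RHS]exprMn; ring.
have w320 : 0 <= 3 / 2 / m ^+ 2 by rewrite !mulr_ge0 ?invr_ge0// ltW.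
apply: (@slices_lb _ _ _ _ _ _ (fun i => h i + (tau i - d) / m)) => //.
- by case/andP: us.
- by rewrite mulr_ge0.
- by rewrite !mulr_ge0 ?invr_ge0 ?(ltW m0) ?(ltW d0).
- exact: slice_ge0.
move=> y _ yl.
pose E i := m * (y i - h i) - tau i.
have Ed i : i \in s -> `|E i| <= d.
  move=> /yl/andP[y1 y2]; rewrite /E ler_norml.
  set z := y i - h i.
  have z1 : (tau i - d) / m <= z by rewrite /z; clear -y1; lra.
  have z2 : z <= (tau i + d) / m.
    by rewrite /z; move: y2; rewrite -addrA -mulrDl (_ : tau i - d + 2 * d = tau i + d); [clear; lra|ring].
  rewrite ler_pdivrMr// mulrC in z1; rewrite ler_pdivlMr// mulrC in z2.
  by clear -z1 z2; apply/andP; split; lra.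
have dE : `|rdot s h E| <= n * d.
  rewrite -nE; apply: rdot_le_sum => //; first exact: ltW.
  by have := h1; rewrite (perm_sq h kL) rdot_cons -/s => <-; rewrite lerDr -expr2 sqr_ge0.
have qE : sq s E <= n * d ^+ 2 by rewrite -nE; exact: rdot_sq_le.
have qE' : sq s E <= n by apply: le_trans qE _; rewrite ler_piMr// exprn_ile1// ltW.
have yE i : y i = h i + m^-1 * (tau i + E i).
  by rewrite /E; field; rewrite gt_eqF.
pose Y i := tau i + E i.
have qY : sq s Y <= K by have := rdot_sqD_le s tau E; rewrite /K -/Y; clear -qE'; lra.
have qY0 : 0 <= sq s Y by exact: rdot_ge0.
have ht : rdot s h tau = - (H * T).
  have := th0; rewrite rdotC (perm_rdot h tau (perm_to_rem kL)) rdot_cons -/s.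
  rewrite -HE -TE => th0'.
  have -> : sg * h k * (sg * tau k) = h k * tau k by case: sg1 => ->; ring.
  by clear -th0'; lra.
have hh : sq s h = 1 - H ^+ 2.
  have := h1; rewrite (perm_sq h kL) rdot_cons -/s -HE => h1'.
  have -> : (sg * h k) ^+ 2 = h k * h k by case: sg1 => ->; ring.
  by clear -h1'; lra.
have qy : sq s y = 1 - H ^+ 2 + m^-1 * (2 * (rdot s h E - H * T) + m^-1 * sq s Y).
  rewrite (_ : y = fun i => h i + m^-1 * Y i); last by apply/funext => i; rewrite yE.
  by rewrite rdot_sqD !(rdotZr, rdotZl) /Y rdotDr ht hh; ring.
have TN := ler_norm T; have TN' := ler_norm (- T); rewrite normrN in TN'.
have [dE1 dE2] : - (n * d) <= rdot s h E /\ rdot s h E <= n * d by apply/andP; rewrite -ler_norml.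
have nd : n * d <= n by rewrite ler_piMr.
have HTb : - (H * `|T|) <= H * T <= H * `|T|.
  by rewrite -mulrN; apply/andP; split; rewrite ler_pM2l//; clear -TN TN'; lra.
case/andP: HTb => HT1 HT2.
have mi0 : 0 < m^-1 by rewrite invr_gt0.
have mi1 : m^-1 <= 1 by rewrite invf_le1.
have miY : m^-1 * sq s Y <= K.
  by apply: le_trans qY; rewrite ler_piMl.
have miY0 : 0 <= m^-1 * sq s Y by rewrite mulr_ge0// ltW.
have g2 : 4 / m ^+ 2 <= 1 - sq s y.
  have : m^-1 * (2 * (rdot s h E - H * T) + m^-1 * sq s Y + 4) <= H ^+ 2.
    rewrite mulrC ler_pdivrMr// [leRHS]mulrC; clear -e3 dE2 nd HT1 miY; lra.
  have : 4 / m ^+ 2 <= m^-1 * 4.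
    by rewrite mulrC ler_wpM2r// lef_pV2 ?posrE// expr2 ler_peMr// ltW.
  by rewrite qy; clear; lra.
(* For fixed other coordinates the window [1 <= m^2 (1 - |z|^2) <= 4] is [r1 <= sg z_k <= r2]. Since
   [r2^2 - r1^2 = 3 / m^2] and [r1 + r2 <= 2], its length is at least [3 / (2 m^2)]. *)
pose r2 := Num.sqrt (1 - sq s y - 1 / m ^+ 2); pose r1 := Num.sqrt (1 - sq s y - 4 / m ^+ 2).
have im : 0 < 1 / m ^+ 2 by rewrite divr_gt0.
have im4 : 4 / m ^+ 2 = 4 * (1 / m ^+ 2) by rewrite mul1r.
have sy0 := rdot_ge0 s y.
have r2E : r2 ^+ 2 = 1 - sq s y - 1 / m ^+ 2 by rewrite sqr_sqrtr//; clear -g2 im im4; lra.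
have r1E : r1 ^+ 2 = 1 - sq s y - 4 / m ^+ 2 by rewrite sqr_sqrtr//; clear -g2 im im4; lra.
have r10 : 0 <= r1 by exact: sqrtr_ge0.
have r20 : 0 <= r2 by exact: sqrtr_ge0.
clearbody r1 r2.
have r2le : r2 <= 1.
  rewrite -(ler_pXn2r (_ : (0 < 2)%N)) ?nnegrE// r2E expr1n; clear -sy0 im; lra.
have r12 : r1 + 3 / 2 / m ^+ 2 <= r2.
  have r1le2 : r1 <= r2 by rewrite -(ler_pXn2r (_ : (0 < 2)%N)) ?nnegrE// r1E r2E; clear -im im4; lra.
  have : (r2 - r1) * (r2 + r1) = 3 * (1 / m ^+ 2) by rewrite -subr_sqr r1E r2E; clear -im4; lra.
  have -> : 3 / 2 / m ^+ 2 = 3 / 2 * (1 / m ^+ 2) by rewrite mul1r.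
  by clear -r2le r1le2 r10 r20; move=> h; nra.
have slE : slice k g y = slices [:: k] g y by [].
rewrite slE -[X in (w * X)%:E]expr1.
(* A separate one-coordinate application, because this interval depends on [y]. For [sg = -1] it is
   mirrored and starts at [- r2]. *)
apply: (@slices_lb _ [:: k] _ _ _ _ (fun=> if sg == 1 then r2 - 3 / 2 / m ^+ 2 else - r2)) => //.
move=> z oz zl.
have {zl} : r1 <= sg * z k <= r2.
  have := zl k (mem_head _ _); case: sg1 => ->; first by rewrite eqxx => /andP[a b]; clear -a b r12; apply/andP; split; lra.
  have -> : (-1 == 1 :> R) = false by clear; apply: lt_eqF; lra.
  by move=> /andP[a b]; clear -a b r12; apply/andP; split; lra.
have zy i : i \in s -> z i = y i.
  by move=> si; apply: oz; rewrite inE; apply: contra ks => /eqP <-.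
have zs : sq s z = sq s y.
  by rewrite /rdot big_seq [RHS]big_seq; apply: eq_bigr => i si; rewrite !zy.
have zz : z k * z k = (sg * z k) ^+ 2 by case: sg1 => ->; ring.
have sqz : sq L z = (sg * z k) ^+ 2 + sq s y by rewrite (perm_sq z kL) rdot_cons zs zz.
move Xe : (sg * z k) => X /andP[X1 X2]; rewrite Xe in sqz zz.
have X0 : 0 <= X by clear -r10 X1; lra.
have X1' : r1 ^+ 2 <= X ^+ 2 by rewrite lerXn2r ?nnegrE.
have X2' : X ^+ 2 <= r2 ^+ 2 by rewrite lerXn2r ?nnegrE.
have bnd : 1 / m ^+ 2 <= 1 - sq L z <= 4 / m ^+ 2.
  by rewrite sqz; clear -X1' X2' r1E r2E; apply/andP; split; lra.
have {bnd} rho : 1 <= m ^+ 2 * (1 - sq L z) <= 4.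
  by case/andP: bnd => b1 b2; rewrite mulrC -ler_pdivrMr// b1/= -ler_pdivlMr.
apply: gw => //.
  by case/andP: rho => r11 _; have := pmulr_rgt0 (1 - sq L z) m20; rewrite subr_gt0 => <-; clear -r11; lra.
rewrite (perm_sq _ kL) rdot_cons -/s.
have -> : sq s (fun i => m * (z i - h i) - tau i) = sq s E.
  by rewrite /rdot big_seq [RHS]big_seq; apply: eq_bigr => i si; rewrite /E !zy.
have -> : (m * (z k - h k) - tau k) * (m * (z k - h k) - tau k) = (m * (X - H) - T) ^+ 2.
  by rewrite -Xe -HE -TE; case: sg1 => ->; ring.
move: rho; rewrite sqz qy; move rE : (m ^+ 2 * _) => rho /andP[rho1 rho4].
have fin : `|m * (X - H) - T| <= (`|T| + A) / H * d.
  apply: (@radial_coord_bound m H T d X (rdot s h E) (sq s Y) rho n K) => //.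
    by rewrite qY0.
  by rewrite -rE; field; rewrite gt_eqF.
clear -fin dB qE; apply: le_trans dB; rewrite -real_normK ?num_real//.
have f0 := le_trans (normr_ge0 _) fin.
have : `|m * (X - H) - T| ^+ 2 <= ((`|T| + A) / H * d) ^+ 2.
  by apply: lerXn2r => //; rewrite nnegrE.
have d20 := sqr_ge0 d; rewrite exprMn /B; move: (_ ^+ 2) qE d20 => u qE d20.
move: (_ ^+ 2) (sq s E) qE => v w1 qE; move: (_ ^+ 2) => z a1.
have -> : u * (n + z + 1) = z * u + n * u + u by ring.
by rewrite -addrA lerD// (le_trans qE)// lerDl.
Qed.

End lower_bounds.

(** * Lower bound for the measure of the cone over the test region *)

Section lower_bounds_cone.
Context {R : realType}.
Implicit Types (x y h tau : nat -> R) (s L : seq nat) (m : R).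
Local Notation sq L x := (rdot L x x).

Lemma cone_real_bound (A d m K n beta qE qY w : R) : 0 < A -> 0 < d -> 2 <= m ->
  `|beta - 1| <= A * d * m^-1 -> qE <= n * d ^+ 2 -> 0 <= qY -> qY <= K ->
  w <= 2 * qE + 2 * ((beta - 1) * ((beta - 1) * qY)) ->
  2 * w + 2 * (m * (beta - 1) * (m * (beta - 1))) <=
  d ^+ 2 * (4 * (n + A ^+ 2 * K + A ^+ 2) + 1).
Proof.
move=> A0 d0 m2 bb qEd qY0 qYK wle.
have m0 : 0 < m by lra.
have mi0 : 0 < m^-1 by rewrite invr_gt0.
have Ad0 : 0 < A * d by rewrite mulr_gt0.
have b1 : `|m * (beta - 1)| <= A * d.
  by rewrite normrM (gtr0_norm m0) mulrC -ler_pdivlMr.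
have b1' : `|beta - 1| <= A * d.
  apply: le_trans bb _; rewrite ler_piMr ?(ltW Ad0)// invf_le1//; lra.
have sqb (u : R) : `|u| <= A * d -> u ^+ 2 <= (A * d) ^+ 2.
  move=> h; rewrite -[leLHS]real_normK ?num_real//.
  by apply: lerXn2r => //; rewrite nnegrE// ltW.
have b3 := sqb _ b1; have b4 := sqb _ b1'.
have b5 : (beta - 1) ^+ 2 * qY <= (A * d) ^+ 2 * K by rewrite ler_pM ?sqr_ge0.
have Ad2 := sqr_ge0 (A * d); have d2 := sqr_ge0 d.
have -> : d ^+ 2 * (4 * (n + A ^+ 2 * K + A ^+ 2) + 1) =
  4 * (n * d ^+ 2) + 4 * ((A * d) ^+ 2 * K) + 4 * (A * d) ^+ 2 + d ^+ 2 by ring.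
have E1 : (beta - 1) * ((beta - 1) * qY) = (beta - 1) ^+ 2 * qY by ring.
rewrite E1 in wle; rewrite -expr2.
move: ((A * d) ^+ 2 * K) b5 => w1 b5; move: ((A * d) ^+ 2) Ad2 b3 => w2 Ad2 b3.
move: ((beta - 1) ^+ 2 * qY) wle b5 => w4 wle b5; move: ((m * (beta - 1)) ^+ 2) b3 => w5 b3.
move: (n * d ^+ 2) qEd => w6 qEd; move: (d ^+ 2) d2 => w8 d2.
clear -b3 b5 wle qEd d2 Ad2; lra.
Qed.

(** Since [tau] is orthogonal to [h], [|v|^2] differs from [1] by [O(d / m)], so projecting [v] to
    the sphere moves it by only [O(d)] at scale [1/m]. The radius [Num.sqrt (1 - 2 / m^2)] makes
    [m^2 (1 - |z|^2)] equal to [2], inside the window from [1] to [4]. *)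
Lemma cone_point_bound L h tau (E : nat -> R) (d m : R) (n := (size L)%:R : R)
  (A := 4 * n + 1) (K := 2 * sq L tau + 2 * n) (v := fun i => h i + m^-1 * (tau i + E i)) :
  sq L h = 1 -> rdot L tau h = 0 -> 0 < d -> d <= 1 -> 2 <= m ->
  m^-1 * (4 + 2 * K) <= d -> m^-1 * (2 * n + K) <= 2^-1 ->
  (forall i, i \in L -> `|E i| <= d) ->
  [/\ 2^-1 <= sq L v, sq L v <= 3 / 2 &
   sq L (fun i => m * (Num.sqrt (1 - 2 / m ^+ 2) * ((Num.sqrt (sq L v))^-1 * v i) - h i) - tau i)
     <= d ^+ 2 * (4 * (n + A ^+ 2 * K + A ^+ 2) + 1)].
Proof.
move=> h1 th0 d0 d1 m2 e1 e2 Ed.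
have m0 : 0 < m by lra.
have m20 : 0 < m ^+ 2 by rewrite exprn_gt0.
have mi0 : 0 < m^-1 by rewrite invr_gt0.
have mi1 : m^-1 <= 2^-1 by rewrite lef_pV2 ?posrE.
have n0 : 0 <= n by rewrite ler0n.
have A0 : 0 < A by rewrite /A; lra.
have K0 : 0 <= K by rewrite /K addr_ge0// mulr_ge0// rdot_ge0.
have dE : `|rdot L h E| <= n * d by apply: rdot_le_sum; rewrite ?h1 ?(ltW d0).
have qE : sq L E <= n * d ^+ 2 by exact: rdot_sq_le.
have qE' : sq L E <= n by apply: le_trans qE _; rewrite ler_piMr// exprn_ile1// ltW.
pose Y i := tau i + E i.
have qY : sq L Y <= K by have := rdot_sqD_le L tau E; rewrite /K -/Y; lra.
have qY0 : 0 <= sq L Y by exact: rdot_ge0.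
have sv : sq L v = 1 + m^-1 * (2 * rdot L h E + m^-1 * sq L Y).
  by rewrite /v -/Y rdot_sqD !(rdotZr, rdotZl) /Y rdotDr h1 (rdotC _ h tau) th0; ring.
have miY : 0 <= m^-1 * sq L Y by rewrite mulr_ge0// ltW.
have miY' : m^-1 * sq L Y <= m^-1 * K by rewrite ler_wpM2l// ltW.
have nd : n * d <= n by rewrite ler_piMr.
have [dE1 dE2] : - (n * d) <= rdot L h E /\ rdot L h E <= n * d by apply/andP; rewrite -ler_norml.
have svd : `|sq L v - 1| <= m^-1 * (2 * n * d + m^-1 * K).
  rewrite sv addrAC subrr add0r normrM (gtr0_norm mi0) ler_wpM2l ?(ltW mi0)//.
  by rewrite ler_norml; apply/andP; split; lra.
have svd' : `|sq L v - 1| <= 2^-1.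
  apply: le_trans svd _; apply: le_trans _ e2; rewrite ler_wpM2l ?(ltW mi0)//.
  have : m^-1 * K <= K by rewrite ler_piMl//; lra.
  lra.
have [sv1 sv2] : 2^-1 <= sq L v /\ sq L v <= 3 / 2.
  by move: svd'; rewrite ler_norml => /andP[a b]; clear -a b; split; lra.
split=> //.
move: sv dE1 dE2 miY miY' svd svd' => _ dE1 dE2 miY miY' svd svd'.
pose rr := 1 - 2 / m ^+ 2.
have rr0 : 2^-1 <= rr.
  rewrite /rr; suff : 2 / m ^+ 2 <= 2^-1 by clear; lra.
  by rewrite ler_pdivrMr// mulrC ler_pdivlMr//; nra.
have rr1 : rr <= 1 by rewrite /rr gerBl divr_ge0// ltW.
pose beta := Num.sqrt rr * (Num.sqrt (sq L v))^-1.
have svp : 0 < sq L v by clear -sv1; lra.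
have ssv : 0 < Num.sqrt (sq L v) by rewrite sqrtr_gt0.
have beta0 : 0 <= beta by rewrite mulr_ge0 ?invr_ge0 ?sqrtr_ge0.
have beta2 : beta ^+ 2 = rr / sq L v.
  by rewrite exprMn exprVn !sqr_sqrtr//; clear -rr0 svp; lra.
have bb : `|beta - 1| <= A * d * m^-1.
  have s1 : `|beta - 1| <= `|beta ^+ 2 - 1|.
    rewrite -[in leRHS](expr1n _ 2) subr_sqr normrM ler_peMr// ger0_norm; clear -beta0; lra.
  apply: le_trans s1 _; rewrite beta2.
  have -> : rr / sq L v - 1 = (rr - sq L v) / sq L v by field; rewrite gt_eqF.
  rewrite normrM normfV (gtr0_norm svp) ler_pdivrMr//.
  apply: (@le_trans _ _ (A * d * m^-1 * 2^-1)); last first.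
    by rewrite ler_wpM2l// !mulr_ge0 ?(ltW d0) ?(ltW A0) ?(ltW mi0).
  have -> : rr - sq L v = - (m^-1 * (m^-1 * 2)) - (sq L v - 1).
    by rewrite /rr; field; rewrite gt_eqF.
  have u0 : 0 <= m^-1 * (m^-1 * 2) by rewrite !mulr_ge0// ltW.
  apply: le_trans (ler_normB _ _) _; rewrite normrN (ger0_norm u0).
  have -> : A * d * m^-1 * 2^-1 = m^-1 * (2 * n * d + d / 2) by rewrite /A; field; rewrite gt_eqF.
  apply: (@le_trans _ _ (m^-1 * (m^-1 * 2) + m^-1 * (2 * n * d + m^-1 * K))).
    by rewrite lerD2l.
  rewrite -mulrDr ler_wpM2l ?(ltW mi0)//; lra.
have fE i : m * (Num.sqrt rr * ((Num.sqrt (sq L v))^-1 * v i) - h i) - tau i =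
   (E i + (beta - 1) * Y i) + m * (beta - 1) * h i.
  rewrite /beta; move: (Num.sqrt rr) ((Num.sqrt (sq L v))^-1) => r1 r2.
  by rewrite /v /Y; field; rewrite gt_eqF.
clearbody beta.
rewrite -/rr (_ : (fun i => _) = fun i => (E i + (beta - 1) * Y i) + m * (beta - 1) * h i); last first.
  by apply/funext => i; rewrite fE.
apply: le_trans (rdot_sqD_le _ _ _) _; rewrite !(rdotZl, rdotZr) h1 mulr1.
apply: (@cone_real_bound A d m K n beta (sq L E) (sq L Y)) => //.
by have := rdot_sqD_le L E (fun i => (beta - 1) * Y i); rewrite !(rdotZl, rdotZr).
Qed.

Lemma cone_slab (sg hk tk H mi yk : R) : (sg = 1 \/ sg = -1) -> sg * hk = H -> 0 < H ->
  0 < mi -> mi * `|tk| <= H / 4 -> H / 4 <= sg * yk -> sg * yk <= H / 2 ->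
  exists lam, [/\ 0 < lam, 5^-1 <= lam, lam <= 3 / 4 & yk = lam * (hk + mi * tk)].
Proof.
move=> sg1 HE H0 mi0 e3 y1 y2; move ZE : (sg * (hk + mi * tk)) => Z.
have [Z1 Z2] : H * 3 / 4 <= Z /\ Z <= H * 5 / 4.
  have : `|sg * (mi * tk)| <= H / 4.
    apply: le_trans e3; rewrite !normrM (gtr0_norm mi0).
    by case: sg1 => ->; rewrite ?normrN normr1 mul1r.
  have -> : Z = H + sg * (mi * tk) by rewrite -ZE -HE; ring.
  by rewrite ler_norml => /andP[? ?]; split; lra.
have Z0 : 0 < Z by lra.
exists (sg * yk / Z); split.
- by rewrite divr_gt0//; lra.
- by rewrite ler_pdivlMr//; lra.
- by rewrite ler_pdivrMr//; lra.
have sg0 : sg != 0 by case: sg1 => ->; rewrite ?oppr_eq0 oner_eq0.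
by apply: (mulfI sg0); rewrite mulrCA ZE divfK ?gt_eqF.
Qed.

Lemma cone_box_coord (d mi lam z h t E : R) : 0 < d -> 0 < mi -> 5^-1 <= lam ->
  z = lam * (h + mi * (t + E)) -> lam * (h + mi * t) - d / 8 * mi <= z ->
  z <= lam * (h + mi * t) - d / 8 * mi + d / 4 * mi -> `|E| <= d.
Proof.
move=> d0 mi0 lam1 -> a1 a2; have lam0 : 0 < lam by lra.
have b1 : - (d / 8) * mi <= lam * E * mi by lra.
have b2 : lam * E * mi <= d / 8 * mi by lra.
rewrite ler_pM2r// in b1; rewrite ler_pM2r// in b2.
have {b1 b2} : `|lam * E| <= d / 8 by rewrite ler_norml; apply/andP; split; lra.
rewrite normrM (gtr0_norm lam0) => b1.
have : 5^-1 * `|E| <= lam * `|E| by rewrite ler_wpM2r.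
by lra.
Qed.

(** The region contains all multiples [lam v] of points [v] near [h + tau / m]. The scale [lam]
    ranges over an interval of fixed length, carried by the coordinate [k], so only the other
    coordinates contribute factors [1/m]. *)
Lemma slices_lb_cone L h tau (eps : R) x0 : uniq L -> sq L h = 1 -> rdot L tau h = 0 -> 0 < eps ->
  exists c m0 : R, [/\ 0 < c, 2 <= m0 & forall m (w : R) (g : (nat -> R) -> \bar R),
    m0 <= m -> 0 <= w -> (forall x, 0 <= g x)%E -> coord_measurable g ->
    (forall x, sq L x < 1 -> 0 < sq L x ->
       sq L (fun i => m * (Num.sqrt (1 - 2 / m ^+ 2) * ((Num.sqrt (sq L x))^-1 * x i) - h i)
          - tau i) <= eps ^+ 2 -> (w%:E <= g x)%E) ->
    ((w * c * m^-1 ^+ (size L).-1)%:E <= slices L g x0)%E].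
Proof.
move=> uL h1 th0 eps0; have [k kL hk] := rdot1_coord h1.
have [sg [sg1]] := sgn_abs hk; move HE : (sg * h k) => H H0.
pose s := rem k L; have szs : size s = (size L).-1 by exact: size_rem.
have us : uniq (k :: s) by rewrite -(perm_uniq (perm_to_rem kL)).
have ks : k \notin s by case/andP: us.
have szL : size L = (size s).+1 by rewrite (perm_size (perm_to_rem kL)).
move nE : ((size L)%:R : R) => n; have n0 : 0 <= n by rewrite -nE ler0n.
move qTE : (sq L tau) => qT; have qT0 : 0 <= qT by rewrite -qTE rdot_ge0.
pose K := 2 * qT + 2 * n; have K0 : 0 <= K by rewrite /K; lra.
pose A := 4 * n + 1; pose B := 4 * (n + A ^+ 2 * K + A ^+ 2) + 1.
have A0 : 0 < A by rewrite /A; lra.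
have A20 := sqr_ge0 A; have AK0 : 0 <= A ^+ 2 * K by rewrite mulr_ge0.
have B1 : 1 <= B by rewrite /B; lra.
have [d [d0 d1 dB]] : exists d : R, [/\ 0 < d, d <= 1 & d ^+ 2 * B <= eps ^+ 2].
  exists (Num.min 1 (eps / B)); have B0 : 0 < B by lra.
  have e0 : 0 < eps / B by rewrite divr_gt0.
  split; [by rewrite lt_min ltr01| by rewrite ge_min lexx|].
  apply: (@le_trans _ _ ((eps / B) ^+ 2 * B)).
    rewrite ler_wpM2r ?(ltW B0)// lerXn2r ?nnegrE ?(ltW e0)// ?le_min ?ler01 ?(ltW e0)//.
    by rewrite ge_min lexx orbT.
  rewrite expr2 -mulrA divfK ?gt_eqF// mulrAC -expr2 ler_piMr ?sqr_ge0//.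
  by rewrite invf_le1.
pose q1 := (4 + 2 * K) / d; pose q2 := 4 * n + 2 * K; pose q3 := 4 * `|tau k| / H.
have q10 : 0 <= q1 by rewrite divr_ge0 ?(ltW d0)//; lra.
have q20 : 0 <= q2 by rewrite /q2; lra.
have q30 : 0 <= q3 by rewrite divr_ge0 ?(ltW H0)// mulr_ge0.
exists (H / 4 * (d / 4) ^+ size s), (2 + q1 + q2 + q3); split.
- by rewrite !mulr_gt0// exprn_gt0// divr_gt0.
- by lra.
move=> m w g mm w0 g0 mg gw; have m2 : 2 <= m by lra.
have m0 : 0 < m by lra.
have m20 : 0 < m ^+ 2 by rewrite exprn_gt0.
have mi0 : 0 < m^-1 by rewrite invr_gt0.
have mi1 : m^-1 <= 2^-1 by rewrite lef_pV2 ?posrE.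
have e1 : m^-1 * (4 + 2 * K) <= d by rewrite mulrC ler_pdivrMr// [leRHS]mulrC -ler_pdivrMr// -/q1; lra.
have e2 : m^-1 * (2 * n + K) <= 2^-1.
  by rewrite mulrC ler_pdivrMr// -(ler_pM2l (_ : 0 < 2 :> R))// mulrA divff ?pnatr_eq0// mul1r; rewrite /q2 in mm; lra.
have e3 : m^-1 * `|tau k| <= H / 4.
  have e3' : 4 * `|tau k| <= m * H by rewrite -ler_pdivrMr// -/q3; lra.
  by rewrite mulrC ler_pdivrMr//; lra.
rewrite (perm_slices g0 mg (perm_to_rem kL)) /= -/s -szs.
have -> : slice k (slices s g) x0 = slices [:: k] (slices s g) x0 by [].
rewrite (_ : w * _ * _ = w * ((d / 4) * m^-1) ^+ size s * (H / 4) ^+ 1); last first.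
  by rewrite expr1 [in RHS]exprMn; ring.
have dm0 : 0 <= d / 4 * m^-1 by rewrite !mulr_ge0 ?(ltW d0) ?(ltW mi0) ?invr_ge0.
(* The slab where [sg y_k] lies between [H / 4] and [H / 2]; it is mirrored when [sg = -1]. *)
apply: (@slices_lb _ [:: k] _ _ _ _ (fun=> if sg == 1 then H / 4 else - (H / 2))) => //.
- by rewrite mulr_ge0// exprn_ge0.
- by rewrite divr_ge0// ltW.
- exact: slices_ge0.
move=> y oy yl.
have {yl} : H / 4 <= sg * y k <= H / 2.
  have := yl k (mem_head _ _); case: sg1 => ->; first by rewrite eqxx => /andP[a b]; clear -a b; apply/andP; split; lra.
  have -> : (-1 == 1 :> R) = false by clear; apply: lt_eqF; lra.
  by move=> /andP[a b]; clear -a b; apply/andP; split; lra.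
move=> /andP[y1 y2].
(* [y_k] encodes the scale. The bound [lam <= 3/4] keeps the point in the ball, as
   [(3/4)^2 * 3/2 < 1], and [lam >= 1/5] keeps the box, once divided by [lam], within the tolerance
   [d]. *)
have [lam [lam0 lam1 lam2 yk]] := cone_slab sg1 HE H0 mi0 e3 y1 y2.
apply: (@slices_lb _ s _ _ _ _ (fun i => lam * (h i + m^-1 * tau i) - d / 8 * m^-1)) => //.
  by case/andP: us.
move=> z oz zl.
have zk : z k = lam * (h k + m^-1 * tau k) by rewrite -yk; apply: oz.
pose E i := (z i / lam - h i) * m - tau i.
have zE i : z i = lam * (h i + m^-1 * (tau i + E i)).
  by rewrite /E; field; rewrite !gt_eqF.
have Ed i : i \in L -> `|E i| <= d.
  rewrite (perm_mem (perm_to_rem kL)) inE => /predU1P[->|/zl].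
    by rewrite /E zk (_ : _ - _ = 0) ?normr0 ?(ltW d0)//; field; rewrite !gt_eqF.
  move=> /andP[a1 a2]; apply: (cone_box_coord d0 mi0 lam1 (zE i) a1 a2).
have [] := @cone_point_bound L h tau E d m h1 th0 d0 d1 m2 _ _ Ed; rewrite ?nE ?qTE//.
pose v i := h i + m^-1 * (tau i + E i).
rewrite -/v -/A -/K => sv1 sv2 svB.
have zv : z = fun i => lam * v i by apply/funext => i; rewrite zE.
have szv : sq L z = lam ^+ 2 * sq L v by rewrite zv rdotZl rdotZr mulrA -expr2.
have l20 := sqr_ge0 lam.
have l21 : lam ^+ 2 <= (3 / 4) ^+ 2 by rewrite lerXn2r ?nnegrE ?(ltW lam0).
apply: gw.
- rewrite szv; apply: (@le_lt_trans _ _ ((3 / 4) ^+ 2 * (3 / 2))); last by clear; lra.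
  by rewrite ler_pM//; clear -sv1; lra.
- by rewrite szv mulr_gt0 ?exprn_gt0//; clear -sv1; lra.
apply: le_trans dB; apply: le_trans svB.
rewrite szv sqrtrM ?sqr_ge0// sqrtr_sqr (gtr0_norm lam0) le_eqVlt; apply/orP; left; apply/eqP.
set f1 := fun i => _; set f2 := fun i => _; suff -> : f1 = f2 by [].
apply/funext => i; rewrite /f1 /f2 zE -/(v i).
have -> : (lam * Num.sqrt (sq L v))^-1 * (lam * v i) = (Num.sqrt (sq L v))^-1 * v i.
  by rewrite invfM mulrACA mulVf ?gt_eqF// mul1r.
by [].
Qed.

End lower_bounds_cone.

(** * Complex coordinates and measurability *)

Section differentiable_epsilon_delta.
Context {K : numFieldType} (N : nat).
Implicit Types (f g : 'rV[K]_N -> K^o) (z : 'rV[K]_N).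

Lemma differentiable_eps_delta f z : differentiable f z ->
  forall e : K, 0 < e -> exists2 d : K, 0 < d &
  forall y : 'rV_N, (forall j, `|z ord0 j - y ord0 j| < d) -> `|f z - f y| < e.
Proof.
move=> /differentiable_continuous/cvgrPdist_lt cf e e0.
have /nbhs_ballP[d /= d0 db] := cf e e0.
exists d => // y zy; apply: db; split=> // i j; rewrite (ord1 i); exact: zy.
Qed.

Lemma differentiable_linear_form (a : 'rV[K]_N) z :
  differentiable ((fun z => \sum_(j < N) z ord0 j * a ord0 j) : 'rV[K]_N -> K^o) z.
Proof.
have -> : ((fun z => \sum_(j < N) z ord0 j * a ord0 j) : 'rV[K]_N -> K^o) =
    \sum_(j < N) (fun z => z ord0 j * a ord0 j : K^o).
  by apply/funext => y; rewrite fct_sumE.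
apply: differentiable_sum => j; apply: differentiableM; first exact: differentiable_coord.
exact: differentiable_cst.
Qed.

Lemma differentiable_exp f z n : differentiable f z ->
  differentiable ((fun y => f y ^+ n) : 'rV[K]_N -> K^o) z.
Proof.
move=> df; elim: n => [|n IH].
  by under eq_fun do rewrite expr0; exact: differentiable_cst.
under eq_fun do rewrite exprS; exact: differentiableM.
Qed.

Lemma differentiable_affine (a : 'rV[K]_N) (b : K) z :
  differentiable ((fun z => \sum_(j < N) z ord0 j * a ord0 j + b) : 'rV[K]_N -> K^o) z.
Proof.
apply: (@differentiableD _ _ _ _ (fun=> b : K^o)); first exact: differentiable_linear_form.
exact: differentiable_cst.
Qed.

Lemma differentiable_affine_exp (a e : 'rV[K]_N) (b b' : K) n z :
  differentiable ((fun z => (\sum_(j < N) z ord0 j * e ord0 j + b') *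
    (\sum_(j < N) z ord0 j * a ord0 j + b) ^+ n) : 'rV[K]_N -> K^o) z.
Proof.
apply: differentiableM; first exact: differentiable_affine.
by apply: differentiable_exp; exact: differentiable_affine.
Qed.

End differentiable_epsilon_delta.

Section complex_basics.
Context {R : realType}.
Local Open Scope complex_scope.
Implicit Types (w z : R[i]).

Lemma cabs2_ge0 w : 0 <= cabs2 w.
Proof. by rewrite addr_ge0// sqr_ge0. Qed.

Lemma cabs2M w z : cabs2 (w * z) = cabs2 w * cabs2 z.
Proof. by case: w z => [a b] [c d]; rewrite /cabs2/=; ring. Qed.

Lemma cabs2_eq0 w : (cabs2 w == 0) = (w == 0).
Proof.
case: w => a b; rewrite /cabs2 eq_complex/= paddr_eq0 ?sqr_ge0//.
by rewrite !sqrf_eq0.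
Qed.

Lemma cabs2V w : cabs2 w^-1 = (cabs2 w)^-1.
Proof.
have [->|w0] := eqVneq w 0.
  by rewrite invr0 (_ : cabs2 0 = 0) ?invr0// /cabs2/= expr0n/= addr0.
have c0 : cabs2 w != 0 by rewrite cabs2_eq0.
apply: (mulfI c0); rewrite -cabs2M !divff//.
by rewrite /cabs2/= expr1n expr0n/= addr0.
Qed.

Lemma cabs2X w n : cabs2 (w ^+ n) = cabs2 w ^+ n.
Proof.
elim: n => [|n IH]; last by rewrite !exprS cabs2M IH.
by rewrite !expr0 /cabs2/= expr1n expr0n/= addr0.
Qed.

Lemma cabs2D_le w z : cabs2 (w + z) <= 2 * cabs2 w + 2 * cabs2 z.
Proof.
case: w z => [a b] [c d]; rewrite /cabs2/=.
have := sqr_ge0 (a - c); have := sqr_ge0 (b - d); lra.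
Qed.

Lemma cabs2N w : cabs2 (- w) = cabs2 w.
Proof. by case: w => a b; rewrite /cabs2/= !sqrrN. Qed.

Lemma cabs2B_le w z : cabs2 (w - z) <= 2 * cabs2 w + 2 * cabs2 z.
Proof. by apply: le_trans (cabs2D_le _ _) _; rewrite cabs2N. Qed.

Lemma cabs2_real (r : R) : cabs2 r%:C = r ^+ 2.
Proof. by rewrite /cabs2/= expr0n/= addr0. Qed.

Lemma ltc_cabs2 w (r : R) : 0 <= r -> (`|w| < r%:C) = (cabs2 w < r ^+ 2).
Proof.
move=> r0; rewrite normc_def ltcR -(ltr_pXn2r (_ : (0 < 2)%N)) ?nnegrE ?sqrtr_ge0//.
by rewrite sqr_sqrtr// cabs2_ge0.
Qed.

(* Continuity at [z], with moduli in [R] rather than in the ordered ring [R[i]]. *)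
Definition ceps_delta N (f : 'rV[R[i]]_N -> R[i]) (z : 'rV[R[i]]_N) :=
  forall e : R, 0 < e -> exists2 d : R, 0 < d &
  forall y : 'rV_N, (forall j, cabs2 (z ord0 j - y ord0 j) < d) -> cabs2 (f z - f y) < e.

Lemma holomorphic_eps_delta N (f : 'rV[R[i]]_N -> R[i]) (z : 'rV[R[i]]_N) :
  holomorphic_on_ball f -> ballN N z -> ceps_delta f z.
Proof.
move=> hf /hf df e e0.
have se0 : 0 < (Num.sqrt e)%:C by rewrite ltcR sqrtr_gt0.
have [[d d'] d0 H] := @differentiable_eps_delta R[i] N f z df _ se0.
move: d0; rewrite ltcE/= => /andP[/eqP d'0 d0].
exists (d ^+ 2); first by rewrite exprn_gt0.
move=> y zy; rewrite -[ltRHS]sqr_sqrtr ?(ltW e0)// -ltc_cabs2 ?sqrtr_ge0//.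
apply: H => j; have := zy j; rewrite -ltc_cabs2 ?(ltW d0)//.
by rewrite d'0.
Qed.

Lemma sum_even_odd N (F : nat -> R) :
  \sum_(j < N) (F (2 * j)%N + F (2 * j + 1)%N) = \sum_(k <- iota 0 (2 * N)) F k.
Proof.
elim: N => [|N IH]; first by rewrite big_ord0 big_nil.
have -> : iota 0 (2 * N.+1) = iota 0 (2 * N) ++ [:: (2 * N)%N; (2 * N + 1)%N].
  by rewrite mulnS addnC iotaD add0n addn1.
by rewrite big_ord_recr IH big_cat big_cons big_seq1.
Qed.

Lemma Re_of_coords N (x : nat -> R) (j : 'I_N) : Re (of_coords N x ord0 j) = x (2 * j)%N.
Proof. by rewrite mxE. Qed.

Lemma Im_of_coords N (x : nat -> R) (j : 'I_N) : Im (of_coords N x ord0 j) = x (2 * j + 1)%N.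
Proof. by rewrite mxE. Qed.

Lemma vnorm2_of_coords N (x : nat -> R) :
  vnorm2 (of_coords N x) = rdot (iota 0 (2 * N)) x x.
Proof.
rewrite /vnorm2 /rdot -sum_even_odd; apply: eq_bigr => j _.
by rewrite /cabs2 Re_of_coords Im_of_coords !expr2.
Qed.

Definition grid (k : nat) (t : R) : R := (Num.floor (k.+1%:R * t))%:~R / k.+1%:R.

Lemma grid_near k t : 0 <= t - grid k t <= k.+1%:R^-1.
Proof.
have k0 : 0 < k.+1%:R :> R by rewrite ltr0n.
rewrite /grid; have := real_floor_le (num_real (k.+1%:R * t)).
have := real_floorD1_gt (num_real (k.+1%:R * t)); rewrite intrD.
set z := _%:~R => h1 h2.
have -> : t - z / k.+1%:R = (k.+1%:R * t - z) / k.+1%:R by field; rewrite gt_eqF.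
rewrite divr_ge0 ?(ltW k0) ?subr_ge0//= -[leRHS]mul1r ler_pM2r ?invr_gt0//; lra.
Qed.

(* [G] is arbitrary: after rounding to the grid only countably many arguments
   occur.  Continuous functions are then measurable as pointwise limits. *)
Lemma measurable_grid_fun d (T : measurableType d) (u : nat -> T -> R) n k
    (G : ('I_n -> R) -> R) : (forall i, measurable_fun setT (u i)) ->
  measurable_fun setT (fun t => G (fun i => grid k (u i t))).
Proof.
move=> mu0 _ Y mY; rewrite setTI.
pose Gm (m : {ffun 'I_n -> int}) := G (fun i => (m i)%:~R / k.+1%:R).
pose cell (m : {ffun 'I_n -> int}) : set T :=
  if `[< Y (Gm m) >] then \bigcap_(i : 'I_n)
    (u i @^-1` [set` `[(m i)%:~R / k.+1%:R, (m i + 1)%:~R / k.+1%:R[]) else set0.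
have k0 : 0 < k.+1%:R :> R by rewrite ltr0n.
rewrite (_ : _ @^-1` Y = \bigcup_m cell m); last first.
  apply/seteqP; split => [t /= Yt|t [m _]].
    exists [ffun i : 'I_n => Num.floor (k.+1%:R * u i t)] => //; rewrite /cell.
    have -> : Gm [ffun i : 'I_n => Num.floor (k.+1%:R * u i t)] = G (fun i => grid k (u i t)).
      by congr G; apply/funext => i; rewrite ffunE.
    rewrite ifT; last exact/asboolP.
    move=> i _ /=; rewrite in_itv/= ffunE ler_pdivrMr// ltr_pdivlMr// !(mulrC (u i t)).
    by rewrite real_floor_le ?num_real// real_floorD1_gt ?num_real.
  rewrite /cell; case: asboolP => // Ym um.
  rewrite /= (_ : (fun i : 'I_n => grid k (u i t)) = fun i => (m i)%:~R / k.+1%:R)//.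
  apply/funext => i; have := um i I; rewrite /= in_itv/= ler_pdivrMr// ltr_pdivlMr// !(mulrC (u i t)) => h.
  by rewrite /grid (@floor_def _ _ (m i)).
apply: countable_bigcupT_measurable => [|m]; first exact: countableP.
rewrite /cell; case: asboolP => // _; apply: fin_bigcap_measurable => // i _.
rewrite -[X in measurable X]setTI; apply: mu0 => //; exact: measurable_itv.
Qed.

(** [p] stands for [Re] or [Im]. The cutoff is evaluated at the exact point and only [f] at the
    rounded one; a rounded point outside the ball is harmless, since only the limit of fine grids
    matters. *)
Lemma measurable_ceps_delta_part N (f : 'rV[R[i]]_N -> R[i]) (p : R[i] -> R)
    d (T : measurableType d) (u : nat -> T -> R) :
  (forall a b, p a - p b = p (a - b)) -> (forall w, p w ^+ 2 <= cabs2 w) ->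
  (forall z : 'rV[R[i]]_N, ballN N z -> ceps_delta f z) ->
  (forall k, measurable_fun setT (u k)) ->
  measurable_fun setT (fun t => if vnorm2 (of_coords N (u ^~ t)) < 1
    then p (f (of_coords N (u ^~ t))) else 0).
Proof.
move=> pB p2 cf mu0.
pose h k t := if vnorm2 (of_coords N (u ^~ t)) < 1
    then p (f (of_coords N (fun i => grid k (u i t)))) else 0.
apply: (@measurable_fun_cvg _ _ _ _ h) => [k|t _].
  apply: measurable_fun_ifT; [|rewrite /=|exact: measurable_cst].
    apply: measurable_fun_ltr; last exact: measurable_cst.
    by under eq_fun do rewrite vnorm2_of_coords; exact: measurable_rdot.
  pose ext (y : 'I_(2 * N) -> R) i := if insub i is Some j then y j else 0.
  have := @measurable_grid_fun _ T u (2 * N) k (fun y => p (f (of_coords N (ext y)))) mu0.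
  apply: eq_measurable_fun => t _; congr (p (f _)); apply/rowP => j; rewrite !mxE /ext.
  have j1 : (2 * j < 2 * N)%N by rewrite ltn_pmul2l.
  have j2 : (2 * j + 1 < 2 * N)%N by have := ltn_ord j; lia.
  by rewrite !insubT.
rewrite /h; case: ifPn => [zb|_]; last exact: cvg_cst.
apply/cvgrPdist_lt => e e0.
have e20 : 0 < e ^+ 2 by rewrite exprn_gt0.
have [dl dl0 H] := cf _ zb _ e20.
near=> k.
have kd : 3 * k.+1%:R^-1 <= dl.
  rewrite -ler_pdivlMl// -[leRHS]invrK lef_pV2 ?posrE ?invr_gt0 ?mulr_gt0//; near: k.
  exists (Num.bound (3^-1 * dl)^-1) => // k /= bk.
  apply: ltW; apply: lt_le_trans (archi_boundP _) _; first by rewrite invr_ge0 mulr_ge0// ltW.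
  by rewrite ler_nat (leq_trans bk).
rewrite pB -(ltr_pXn2r (_ : (0 < 2)%N)) ?nnegrE ?(ltW e0)// real_normK ?num_real//.
apply: le_lt_trans (p2 _) _; apply: H => j; rewrite !mxE /cabs2/=.
have g1 := grid_near k (u (2 * j)%N t); have g2 := grid_near k (u (2 * j + 1)%N t).
have ki : k.+1%:R^-1 <= 1 :> R by rewrite invf_le1 ?ltr0n// ler1n.
have ki0 : 0 < k.+1%:R^-1 :> R by rewrite invr_gt0 ltr0n.
move: g1 g2 kd ki ki0; set a := u _ t - _; set b := u (2 * j + 1)%N t - _; set c := _^-1.
move=> /andP[a0 ac] /andP[b0 bc] cd c1 c0.
nra.
Unshelve. all: by end_near. Qed.

Lemma measurable_ceps_delta N (f : 'rV[R[i]]_N -> R[i]) d (T : measurableType d)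
    (u : nat -> T -> R) :
  (forall z : 'rV[R[i]]_N, ballN N z -> ceps_delta f z) ->
  (forall k, measurable_fun setT (u k)) ->
  measurable_fun setT (fun t => if vnorm2 (of_coords N (u ^~ t)) < 1
    then cabs2 (f (of_coords N (u ^~ t))) else 0).
Proof.
move=> cf mu0.
have mRe := @measurable_ceps_delta_part N f (@Re R) d T u _ _ cf mu0.
have mIm := @measurable_ceps_delta_part N f (@Im R) d T u _ _ cf mu0.
have -> : (fun t => if vnorm2 (of_coords N (u ^~ t)) < 1
    then cabs2 (f (of_coords N (u ^~ t))) else 0) =
  (fun t => (if vnorm2 (of_coords N (u ^~ t)) < 1
    then Re (f (of_coords N (u ^~ t))) else 0) ^+ 2 + (if vnorm2 (of_coords N (u ^~ t)) < 1
    then Im (f (of_coords N (u ^~ t))) else 0) ^+ 2).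
  by apply/funext => t; case: ifP => _ //; rewrite expr0n addr0.
apply: measurable_funD; apply: measurable_funX; [apply: mRe|apply: mIm].
- by move=> [a b] [c e].
- by move=> [a b]; rewrite /cabs2/= lerDl sqr_ge0.
- by move=> [a b] [c e].
- by move=> [a b]; rewrite /cabs2/= lerDr sqr_ge0.
Qed.

End complex_basics.

(** * The Hermitian inner product and its real coordinates *)

Section hermitian.
Context {R : realType} {N : nat}.
Local Open Scope complex_scope.
Implicit Types (u v w z c : 'rV[R[i]]_N) (a b : R[i]).

Lemma cinnerE z c : cinner z c = \sum_(j < N) z ord0 j * conjc (c ord0 j).
Proof. by apply: eq_bigr => j _; case: (c ord0 j). Qed.

Lemma cinnerDl u v c : cinner (u + v) c = cinner u c + cinner v c.
Proof. by rewrite !cinnerE -big_split; apply: eq_bigr => j _; rewrite mxE mulrDl. Qed.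

Lemma cinnerZl a u c : cinner (a *: u) c = a * cinner u c.
Proof. by rewrite !cinnerE mulr_sumr; apply: eq_bigr => j _; rewrite mxE mulrA. Qed.

Lemma cinnerNl u c : cinner (- u) c = - cinner u c.
Proof. by rewrite -scaleN1r cinnerZl mulN1r. Qed.

Lemma cinnerBl u v c : cinner (u - v) c = cinner u c - cinner v c.
Proof. by rewrite cinnerDl cinnerNl. Qed.

Lemma cinner0l c : cinner 0 c = 0.
Proof. by rewrite -(scale0r 0) cinnerZl mul0r. Qed.

Lemma cinnerC u v : cinner v u = conjc (cinner u v).
Proof.
rewrite !cinnerE rmorph_sum; apply: eq_bigr => j _.
by rewrite rmorphM/= conjcK mulrC.
Qed.

Lemma cinnerDr u v c : cinner c (u + v) = cinner c u + cinner c v.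
Proof. by rewrite cinnerC cinnerDl rmorphD/= -!cinnerC. Qed.

Lemma cinnerZr a u c : cinner c (a *: u) = conjc a * cinner c u.
Proof. by rewrite cinnerC cinnerZl rmorphM/= -cinnerC. Qed.

Lemma cinnerNr u c : cinner c (- u) = - cinner c u.
Proof. by rewrite cinnerC cinnerNl rmorphN/= -cinnerC. Qed.

Lemma cinnerBr u v c : cinner c (u - v) = cinner c u - cinner c v.
Proof. by rewrite cinnerDr cinnerNr. Qed.

Lemma ReD a b : Re (a + b) = Re a + Re b. Proof. by case: a b => [? ?] [? ?]. Qed.
Lemma ImD a b : Im (a + b) = Im a + Im b. Proof. by case: a b => [? ?] [? ?]. Qed.
Lemma ReN a : Re (- a) = - Re a. Proof. by case: a. Qed.
Lemma ReB a b : Re (a - b) = Re a - Re b. Proof. by case: a b => [? ?] [? ?]. Qed.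
Lemma ReM a b : Re (a * b) = Re a * Re b - Im a * Im b.
Proof. by case: a b => [? ?] [? ?]. Qed.
Lemma ImM a b : Im (a * b) = Re a * Im b + Im a * Re b.
Proof. by case: a b => [? ?] [? ?]. Qed.
Lemma Re_conjc a : Re (conjc a) = Re a. Proof. by case: a. Qed.
Lemma Im_conjc a : Im (conjc a) = - Im a. Proof. by case: a. Qed.
Lemma cabs2_conjc a : cabs2 (conjc a) = cabs2 a.
Proof. by rewrite /cabs2 Re_conjc Im_conjc sqrrN. Qed.

Lemma vnorm2_cinner u : cinner u u = (vnorm2 u)%:C.
Proof.
rewrite cinnerE /vnorm2 rmorph_sum; apply: eq_bigr => j _.
by case: (u ord0 j) => x y; rewrite /cabs2/=; simpc; congr (_ +i* _); ring.
Qed.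

Lemma Re_cinner_self u : Re (cinner u u) = vnorm2 u.
Proof. by rewrite vnorm2_cinner. Qed.

Lemma vnorm2_ge0 u : 0 <= vnorm2 u.
Proof. by apply: sumr_ge0 => j _; exact: cabs2_ge0. Qed.

Lemma vnorm2Z a u : vnorm2 (a *: u) = cabs2 a * vnorm2 u.
Proof. by rewrite /vnorm2 mulr_sumr; apply: eq_bigr => j _; rewrite mxE cabs2M. Qed.

Lemma vnorm2N u : vnorm2 (- u) = vnorm2 u.
Proof. by apply: eq_bigr => j _; rewrite mxE cabs2N. Qed.

Lemma vnorm20 : vnorm2 (0 : 'rV[R[i]]_N) = 0.
Proof. by apply: big1 => j _; rewrite mxE /cabs2/= expr0n addr0. Qed.

Lemma vnorm2D u v : vnorm2 (u + v) = vnorm2 u + vnorm2 v + 2 * Re (cinner u v).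
Proof.
rewrite -!Re_cinner_self cinnerDl !cinnerDr !ReD (cinnerC u v) Re_conjc; ring.
Qed.

Lemma vnorm2B u v : vnorm2 (u - v) = vnorm2 u + vnorm2 v - 2 * Re (cinner u v).
Proof. by rewrite vnorm2D vnorm2N cinnerNr ReN mulrN. Qed.

Lemma vnorm2D_le u v : vnorm2 (u + v) <= 2 * vnorm2 u + 2 * vnorm2 v.
Proof. by have := vnorm2_ge0 (u - v); rewrite vnorm2B vnorm2D; lra. Qed.

Lemma vnorm2_eq0 u : (vnorm2 u == 0) = (u == 0).
Proof.
apply/eqP/eqP => [u0|->]; last exact: vnorm20.
apply/rowP => j; rewrite mxE; apply/eqP; rewrite -cabs2_eq0.
have /psumr_eq0P : forall j : 'I_N, true -> 0 <= cabs2 (u ord0 j) by move=> *; exact: cabs2_ge0.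
by move=> /(_ u0 j isT) ->.
Qed.

Lemma vnorm2_gt0 u : (0 < vnorm2 u) = (u != 0).
Proof. by rewrite lt0r vnorm2_ge0 andbT vnorm2_eq0. Qed.

Lemma cinner_cauchy u v : cabs2 (cinner u v) <= vnorm2 u * vnorm2 v.
Proof.
have [->|v0] := eqVneq v 0.
  by rewrite vnorm20 mulr0 -(scale0r 0) cinnerZr rmorph0 mul0r /cabs2/= expr0n addr0.
have vp : 0 < vnorm2 v by rewrite vnorm2_gt0.
have := vnorm2_ge0 ((vnorm2 v)%:C *: u - cinner u v *: v).
rewrite vnorm2B !vnorm2Z cabs2_real cinnerZl cinnerZr.
have -> : Re ((vnorm2 v)%:C * (conjc (cinner u v) * cinner u v)) = vnorm2 v * cabs2 (cinner u v).
  by case: (cinner u v) => x y; rewrite /cabs2/=; ring.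
move: (cabs2 (cinner u v)) (vnorm2 u) (vnorm2 v) vp => k p q q0 H.
have : 0 <= q * (p * q - k) by apply: le_trans H _; rewrite le_eqVlt; apply/orP; left; apply/eqP; ring.
by rewrite pmulr_rge0// subr_ge0.
Qed.

Lemma Re_sq_le a : Re a ^+ 2 <= cabs2 a. Proof. by rewrite lerDl sqr_ge0. Qed.

Lemma Re_cinner_le u v : vnorm2 u <= 1 -> vnorm2 v <= 1 -> Re (cinner u v) <= 1.
Proof. by move=> u1 v1; have := vnorm2_ge0 (u - v); rewrite vnorm2B; lra. Qed.

Lemma vnorm2_mulmx (M : 'M[R[i]]_N) : exists2 K : R, 0 <= K & forall w, vnorm2 (w *m M) <= K * vnorm2 w.
Proof.
exists (\sum_(j < N) vnorm2 (\row_k conjc (M k j))).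
  by apply: sumr_ge0 => j _; exact: vnorm2_ge0.
move=> w; rewrite mulr_suml; apply: ler_sum => j _.
rewrite mulrC; apply: le_trans (cinner_cauchy _ _); rewrite cinnerE mxE le_eqVlt.
apply/orP; left; apply/eqP; congr cabs2; apply: eq_bigr => k _.
by rewrite mxE conjcK.
Qed.

Definition coords z (k : nat) : R :=
  if insub k./2 is Some j then (if odd k then Im (z ord0 j) else Re (z ord0 j)) else 0.

Lemma coordsK z : of_coords N (coords z) = z.
Proof.
apply/rowP => j; rewrite mxE /coords.
have -> : (2 * j)./2 = j :> nat by rewrite mul2n doubleK.
have -> : (2 * j + 1)./2 = j :> nat by rewrite addn1 mul2n /= uphalf_double.
by rewrite valK oddD !mul2n odd_double/=; case: (z ord0 j).
Qed.

Lemma Re_cinner_of_coords (x y : nat -> R) :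
  Re (cinner (of_coords N x) (of_coords N y)) = rdot (iota 0 (2 * N)) x y.
Proof.
rewrite cinnerE /rdot -sum_even_odd (big_morph (@Re R) ReD (erefl _)).
by apply: eq_bigr => j _; rewrite !mxE/=; ring.
Qed.

Lemma of_coordsB (x y : nat -> R) :
  of_coords N (fun k => x k - y k) = of_coords N x - of_coords N y.
Proof. by apply/rowP => j; rewrite !mxE. Qed.

Lemma of_coordsZ (r : R) (x : nat -> R) :
  of_coords N (fun k => r * x k) = r%:C *: of_coords N x.
Proof. by apply/rowP => j; rewrite !mxE; simpc. Qed.

End hermitian.

(** * Linear fractional maps at a boundary point *)

Section linear_fractional.
Context {R : realType} {N : nat}.
Local Open Scope complex_scope.
Implicit Types (u v w z zeta : 'rV[R[i]]_N) (phi : 'rV[R[i]]_N -> 'rV[R[i]]_N).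

(** Normalizing the denominator to [1] at [zeta] removes the common scalar of numerator and
    denominator, so the data of two maps can be compared term by term. *)
Definition local_form phi zeta v0 (M : 'M[R[i]]_N) C :=
  forall z, ballN N z -> 1 + cinner (z - zeta) C != 0 /\
    phi z = (1 + cinner (z - zeta) C)^-1 *: (v0 + (z - zeta) *m M).

Lemma le0_of_small (x K : R) : (forall s, 0 < s < 1 -> x <= s * K) -> x <= 0.
Proof.
move=> H; rewrite leNgt; apply/negP => x0.
have K0 : 0 < K.
  have /H : (0 < 2^-1 :> R) && (2^-1 < 1 :> R) by rewrite invr_gt0 ltr0n invf_lt1 ?ltr0n ?ltr1n.
  by lra.
have s0 : 0 < x / (2 * (K + x)) by rewrite divr_gt0// mulr_gt0// addr_gt0.
have : x <= x / (2 * (K + x)) * K.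
  apply: H; rewrite s0/= ltr_pdivrMr ?mulr_gt0 ?addr_gt0//; lra.
rewrite mulrAC ler_pdivlMr ?mulr_gt0 ?addr_gt0//; nra.
Qed.

Lemma vnorm2_line zeta w (s : R) (x : R[i]) : vnorm2 zeta = 1 -> cinner w zeta = 0 ->
  vnorm2 ((1 - s)%:C *: zeta + x *: w) = (1 - s) ^+ 2 + cabs2 x * vnorm2 w.
Proof.
move=> z1 wz; rewrite vnorm2D !vnorm2Z cabs2_real z1 mulr1.
rewrite cinnerZl cinnerZr (cinnerC w zeta) wz.
have -> : Re ((1 - s)%:C * (conjc x * conjc 0)) = 0 by case: x => a b /=; ring.
by rewrite mulr0 addr0.
Qed.

Section data.
Variables (A : 'M[R[i]]_N) (B Cv : 'rV[R[i]]_N) (d : R[i]) (phi : 'rV[R[i]]_N -> 'rV[R[i]]_N).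
Let q z := cinner z Cv + d.
Let n z := z *m A^T + B.
Hypothesis q_neq0 : forall z, ballN N z -> q z != 0.
Hypothesis phiE : forall z, ballN N z -> phi z = (q z)^-1 *: n z.
Hypothesis phi_ball : forall z, ballN N z -> ballN N (phi z).

Lemma num_lt_den z : ballN N z -> vnorm2 (n z) < cabs2 (q z).
Proof.
move=> zb; have := phi_ball zb; rewrite /ballN/= phiE// vnorm2Z cabs2V.
by rewrite mulrC ltr_pdivrMr ?mul1r// lt0r cabs2_eq0 q_neq0//= cabs2_ge0.
Qed.

Lemma ball0 : ballN N (0 : 'rV[R[i]]_N).
Proof. by rewrite /ballN/= vnorm20. Qed.

(** [|n| < |q|] inside the ball forces [n] to vanish wherever [q] vanishes on the sphere. Complex
    tangent directions at [zeta] must be killed by the linear parts of both [q] and [n], so both are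
    constant multiples of [1 - <z, zeta>] and the quotient is constant. *)
Lemma constant_of_pole zeta : vnorm2 zeta = 1 -> q zeta = 0 ->
  forall z, ballN N z -> phi z = phi 0.
Proof.
move=> z1 q0.
have d0 : d != 0 by have := q_neq0 ball0; rewrite /q cinner0l add0r.
have zC : cinner zeta Cv = - d by apply/eqP; rewrite -addr_eq0; apply/eqP.
pose K := cabs2 d + vnorm2 B.
have K0 : 0 <= K by rewrite addr_ge0 ?cabs2_ge0 ?vnorm2_ge0.
have nz0 : n zeta = 0.
  apply/eqP; rewrite -vnorm2_eq0 eq_le vnorm2_ge0 andbT.
  apply: (@le0_of_small _ (2 * K)) => s /andP[s0 s1].
  pose z := (1 - s / 2)%:C *: zeta.
  have zb : ballN N z by rewrite /ballN/= vnorm2Z cabs2_real z1; nra.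
  have := num_lt_den zb.
  have -> : q z = (s / 2)%:C * d.
    by rewrite /q cinnerZl zC rmorphB rmorph1; ring.
  have nzE : (1 - s / 2)%:C *: n zeta = n z + (- (s / 2))%:C *: B.
    rewrite /n scalerDr -scalemxAl -addrA; congr (_ + _).
    by rewrite -{2}(scale1r B) -scalerDl rmorphB rmorphN rmorph1.
  have := congr1 (@vnorm2 R N) nzE; rewrite vnorm2Z cabs2_real => E.
  have := vnorm2D_le (n z) ((- (s / 2))%:C *: B).
  rewrite -E vnorm2Z !cabs2M !cabs2_real /K => h1 h2.
  have b0 := vnorm2_ge0 B; have c0 := cabs2_ge0 d; have n0 := vnorm2_ge0 (n zeta).
  have : (1 - s / 2) ^+ 2 >= 4^-1 by nra.
  have : s ^+ 2 <= s by nra.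
  nra.
have zA : zeta *m A^T = - B by apply/eqP; rewrite -addr_eq0; apply/eqP.
have wC w : cinner w zeta = 0 -> cinner w Cv = 0.
  move=> wz; apply/eqP/negPn/negP => k0.
  (* A nonzero tangential part of [q] would put a zero of [q] inside the ball: [z] goes inwards by
     [s] and sideways by the multiple of [w] that cancels [q]. *)
  pose k := cinner w Cv; pose L := cabs2 (d / k) * vnorm2 w.
  have L0 : 0 <= L by rewrite mulr_ge0 ?cabs2_ge0 ?vnorm2_ge0.
  pose s := (L + 1)^-1; have s0 : 0 < s by rewrite invr_gt0; lra.
  have sL : s * (L + 1) = 1 by rewrite mulVf// gt_eqF//; lra.
  pose z := (1 - s)%:C *: zeta + (- (d / k) * s%:C) *: w.
  have zb : ballN N z.
    rewrite /ballN/= vnorm2_line// cabs2M cabs2N cabs2_real mulrAC -/L; nra.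
  have /eqP := q_neq0 zb; apply.
  rewrite /q cinnerDl !cinnerZl zC -/k rmorphB rmorph1.
  by field.
have wA w : cinner w zeta = 0 -> vnorm2 w <= 1 -> w *m A^T = 0.
  move=> wz w1; apply/eqP; rewrite -vnorm2_eq0 eq_le vnorm2_ge0 andbT.
  apply: (@le0_of_small _ (2 * K)) => x /andP[x0 x1].
  (* Moving [x] sideways costs only [x^2] inwards. Then [q] is of order [x^2], while the tangential
     part of [n] enters with the factor [x] and must vanish. *)
  pose z := (1 - x ^+ 2)%:C *: zeta + x%:C *: w.
  have zb : ballN N z.
    rewrite /ballN/= vnorm2_line// cabs2_real.
    have y0 : 0 < x ^+ 2 by rewrite exprn_gt0.
    have y1 : x ^+ 2 < 1 by rewrite expr_lt1// ltW.
    have : x ^+ 2 * vnorm2 w <= x ^+ 2 by rewrite ler_piMr// ltW.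
    by move: (x ^+ 2) y0 y1 => y y0 y1; nra.
  have := num_lt_den zb.
  have -> : q z = (x ^+ 2)%:C * d.
    by rewrite /q cinnerDl !cinnerZl zC wC// rmorphB rmorph1; ring.
  have nzE : x%:C *: (w *m A^T) = n z + (- (x ^+ 2))%:C *: B.
    rewrite /n mulmxDl -!scalemxAl zA; apply/rowP => j.
    by rewrite !mxE rmorphB rmorph1 rmorphN; ring.
  have := congr1 (@vnorm2 R N) nzE; rewrite vnorm2Z cabs2_real => E.
  have := vnorm2D_le (n z) ((- (x ^+ 2))%:C *: B).
  rewrite -E vnorm2Z !cabs2M !cabs2_real /K sqrrN => h1 h2.
  have b0 := vnorm2_ge0 B; have c0 := cabs2_ge0 d; have n0 := vnorm2_ge0 (w *m A^T).
  have x20 : 0 < x ^+ 2 by rewrite exprn_gt0.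
  have : x ^+ 2 * vnorm2 (w *m A^T) <= x ^+ 2 * (x ^+ 2 * (2 * (cabs2 d + vnorm2 B))) by lra.
  rewrite ler_pM2l// => h3; apply: le_trans h3 _.
  by rewrite ler_wpM2r//; [lra|nra].
move=> z zb.
have [t [w [wz w1 zE]]] : exists t w,
    [/\ cinner w zeta = 0, vnorm2 w <= 1 & z = t *: zeta + w].
  pose t := cinner z zeta; exists t, (z - t *: zeta).
  have wz : cinner (z - t *: zeta) zeta = 0.
    by rewrite cinnerBl cinnerZl vnorm2_cinner z1 mulr1 subrr.
  have zE : z = t *: zeta + (z - t *: zeta) by rewrite addrC subrK.
  split=> //; move: wz zE; set w := z - _ => wz zE; clearbody w.
  move: zb; rewrite /ballN/= zE vnorm2D vnorm2Z z1 mulr1 cinnerZl (cinnerC w) wz.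
  have -> : Re (t * conjc 0) = 0 by case: (t) => a b /=; ring.
  by rewrite mulr0 addr0 => h; have := cabs2_ge0 t; lra.
have qz : q z = d * (1 - t) by rewrite zE /q cinnerDl cinnerZl zC wC//; ring.
have t1 : 1 - t != 0 by have := q_neq0 zb; rewrite qz mulf_eq0 negb_or => /andP[].
have nz : n z = (1 - t) *: B.
  rewrite /n zE mulmxDl (wA w)// addr0 -scalemxAl zA.
  by rewrite scalerBl scale1r scalerN addrC.
rewrite !phiE//; last exact: ball0.
rewrite qz nz /q cinner0l add0r /n mul0mx add0r scalerA; congr (_ *: _).
by field; rewrite d0 t1.
Qed.

End data.

(** A pole on the sphere would make [phi] constant, with supremum norm [|phi 0| < 1]. *)
Lemma pole_free (A : 'M[R[i]]_N) B Cv d phi zeta :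
  (forall z, ballN N z -> cinner z Cv + d != 0) ->
  (forall z, ballN N z -> phi z = (cinner z Cv + d)^-1 *: (z *m A^T + B)) ->
  (forall z, ballN N z -> ballN N (phi z)) -> supnorm phi = 1 -> vnorm2 zeta = 1 ->
  cinner zeta Cv + d != 0.
Proof.
move=> h1 h2 h3 sup1 z1; apply/eqP => q0.
have cst := constant_of_pole h1 h2 h3 z1 q0.
have : supnorm phi = vnorm (phi 0).
  rewrite /supnorm; have -> : [set vnorm (phi z) | z in ballN N] = [set vnorm (phi 0)].
    apply/seteqP; split => [_ [z zb <-]|_ ->] /=; first by rewrite cst.
    by exists 0 => //; exact: ball0.
  by rewrite reals.sup1.
have := h3 _ ball0; rewrite /ballN/= sup1 => lt1 e1.
by move: lt1; rewrite -(sqr_sqrtr (vnorm2_ge0 (phi 0))) -/(vnorm _) -e1 expr1n ltxx.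
Qed.

Lemma local_form_data (A : 'M[R[i]]_N) B Cv d phi zeta (q := cinner zeta Cv + d) :
  (forall z, ballN N z -> cinner z Cv + d != 0) ->
  (forall z, ballN N z -> phi z = (cinner z Cv + d)^-1 *: (z *m A^T + B)) ->
  q != 0 ->
  local_form phi zeta (q^-1 *: (zeta *m A^T + B)) (q^-1 *: A^T) (conjc q^-1 *: Cv).
Proof.
move=> h1 h2 q0 z zb.
have E : 1 + cinner (z - zeta) (conjc q^-1 *: Cv) = q^-1 * (cinner z Cv + d).
  rewrite cinnerZr conjcK cinnerBl.
  have -> : cinner zeta Cv = q - d by rewrite /q addrK.
  by field.
rewrite E; split; first by rewrite mulf_neq0 ?invr_neq0//; exact: h1.
rewrite h2// -scalemxAr -scalerDr scalerA invfM invrK mulrAC divff// mul1r.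
by congr (_ *: _); rewrite mulmxBl; apply/rowP => j; rewrite !mxE; ring.
Qed.

Lemma local_form_of_lfs phi zeta : linear_fractional_selfmap phi -> supnorm phi = 1 ->
  vnorm2 zeta = 1 -> exists v0 M C, local_form phi zeta v0 M C.
Proof.
move=> [A [B [Cv [d [h1 [h2 h3]]]]]] sup1 z1; do 3 eexists.
exact: (local_form_data h1 h2 (pole_free h1 h2 h3 sup1 z1)).
Qed.

Lemma local_form_le1 phi zeta v0 M C : (forall z, ballN N z -> ballN N (phi z)) ->
  vnorm2 zeta = 1 -> local_form phi zeta v0 M C -> vnorm2 v0 <= 1.
Proof.
move=> phib z1 lf; rewrite -subr_le0.
pose u := zeta *m M; pose c := cinner zeta C.
apply: (@le0_of_small _ (2 * `|Re (cinner v0 u)| + 2 * `|Re c| + cabs2 c)) => s /andP[s0 s1].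
pose z := (1 - s)%:C *: zeta.
have zb : ballN N z by rewrite /ballN/= vnorm2Z cabs2_real z1; nra.
have zz : z - zeta = (- s)%:C *: zeta.
  by rewrite /z -{2}(scale1r zeta) -scalerBl; congr (_ *: _); rewrite rmorphB rmorph1 rmorphN; ring.
have [den0 phiz] := lf z zb; have := phib _ zb.
rewrite /ballN/= phiz vnorm2Z cabs2V mulrC ltr_pdivrMr; last first.
  by rewrite lt0r cabs2_eq0 den0 cabs2_ge0.
rewrite mul1r zz -scalemxAl -/u cinnerZl -/c vnorm2D vnorm2Z cabs2_real cinnerZr.
have := vnorm2_ge0 u; have := ler_norm (Re (cinner v0 u)); have := ler_norm (- Re c).
rewrite normrN; case: c => c1 c2; case: (cinner v0 u) => g1 g2; rewrite /cabs2/=; simpc.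
rewrite /=; move: `|c1| `|g1| (vnorm2 u) (vnorm2 v0) => a1 a2 a3 a4 ? ? ? ?.
have c12 : 0 <= c1 ^+ 2 + c2 ^+ 2 by rewrite addr_ge0 ?sqr_ge0.
have : s ^+ 2 * (c1 ^+ 2 + c2 ^+ 2) <= s * (c1 ^+ 2 + c2 ^+ 2) by rewrite ler_wpM2r//; nra.
have : 0 <= s ^+ 2 * a3 by rewrite mulr_ge0// sqr_ge0.
have : s * c1 >= - (s * a1) by nra.
have : s * g1 <= s * a2 by nra.
nra.
Qed.

(* First-order part of the Julia-Caratheodory theorem: [Re (L w) > 0] on the
   ball forces the linear form [L] to be a nonpositive multiple of <., zeta>. *)
Lemma julia phi zeta v0 M C : (forall z, ballN N z -> ballN N (phi z)) ->
  vnorm2 zeta = 1 -> local_form phi zeta v0 M C -> vnorm2 v0 = 1 ->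
  exists2 lam : R, 0 < lam &
    forall w, cinner (w *m M) v0 = cinner w C + lam%:C * cinner w zeta.
Proof.
move=> phib z1 lf v1.
pose L w := cinner w C - cinner (w *m M) v0.
have LD u w : L (u + w) = L u + L w by rewrite /L mulmxDl !cinnerDl; ring.
have LZ a w : L (a *: w) = a * L w by rewrite /L -scalemxAl !cinnerZl; ring.
(* [Re <phi z, v0> < 1] says that [L / q] has positive real part; multiplying by [|q|^2] gives the
   division-free form. *)
have pos z : ballN N z -> 0 < Re (L (z - zeta) * conjc (1 + cinner (z - zeta) C)).
  move=> zb; have [den0 phiz] := lf z zb.
  set q := 1 + _ in den0 phiz *.
  have vp : vnorm2 (phi z) < 1 by exact: phib.
  have Lq : L (z - zeta) = q * (1 - cinner (phi z) v0).
    have -> : cinner (phi z) v0 = q^-1 * (1 + cinner ((z - zeta) *m M) v0).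
      by rewrite phiz cinnerZl cinnerDl vnorm2_cinner v1.
    by rewrite /L mulrBr mulr1 mulrA divff// mul1r /q; ring.
  rewrite Lq mulrAC; have -> : q * conjc q = (cabs2 q)%:C.
    by case: (q) => x y; rewrite /cabs2/=; simpc; congr (_ +i* _); ring.
  have : Re (cinner (phi z) v0) < 1.
    by have := vnorm2_ge0 (phi z - v0); rewrite vnorm2B; lra.
  rewrite ReM/= mul0r subr0 ReB/= => h; rewrite mulr_gt0 ?subr_gt0//.
  by rewrite lt0r cabs2_eq0 den0 cabs2_ge0.
have half v : Re (cinner v zeta) < 0 -> 0 <= Re (L v).
  move=> vz; rewrite -oppr_le0.
  pose k := Re (cinner v zeta); pose K := vnorm2 v.
  have K0 : 0 <= K by exact: vnorm2_ge0.
  (* Chosen so that [t K <= - k], which keeps [zeta + s t v] in the ball for all [0 < s < 1];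
     letting [s] shrink isolates the linear term. *)
  pose t := (- k) / (K + 1 - k).
  have k0 : k < 0 by [].
  have t0 : 0 < t by rewrite divr_gt0//; lra.
  have tK : t * (K + 1 - k) = - k by rewrite divfK// gt_eqF//; lra.
  clearbody t.
  apply: (@le0_of_small _ (t * `|Re (L v * conjc (cinner v C))|)) => s /andP[s0 s1].
  pose z := zeta + (s * t)%:C *: v.
  have zb : ballN N z.
    rewrite /ballN/= vnorm2D vnorm2Z cabs2_real z1 cinnerZr (cinnerC v) ReM/= Re_conjc.
    rewrite oppr0 mul0r subr0 -/k -/K.
    have : s * t * K <= t * K by rewrite -mulrA ler_piMl// ?mulr_ge0 ?(ltW t0)// ltW.
    have st0 : 0 < s * t by rewrite mulr_gt0.
    have tk : t * k < 0 by rewrite pmulr_rlt0.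
    move=> stK; have : s * t * K + 2 * k < 0 by lra.
    rewrite -(pmulr_rlt0 _ st0); lra.
  have zz : z - zeta = (s * t)%:C *: v by rewrite /z addrC addKr.
  have := pos z zb; rewrite zz LZ cinnerZl.
  have := ler_norm (Re (L v * conjc (cinner v C))).
  case: (L v) => l1 l2; case: (cinner v C) => c1 c2 /=; simpc => /=.
  move: `|_| => a ha.
  have -> : s * t * l1 * (1 + s * t * c1) + s * t * l2 * (s * t * c2) =
    s * t * (l1 + s * t * (l1 * c1 + l2 * c2)) by ring.
  rewrite pmulr_rgt0 ?mulr_gt0// => h.
  have : s * t * (l1 * c1 + l2 * c2) <= s * t * a by rewrite ler_wpM2l// mulr_ge0// ltW.
  by lra.
have tang v : Re (cinner v zeta) = 0 -> Re (L v) = 0.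
  have ge v' : Re (cinner v' zeta) = 0 -> 0 <= Re (L v').
    move=> vz; rewrite -oppr_le0; apply: (@le0_of_small _ `|Re (L zeta)|) => s /andP[s0 s1].
    have := @half (v' - s%:C *: zeta).
    rewrite cinnerBl cinnerZl vnorm2_cinner z1 mulr1 ReB vz/= sub0r oppr_lt0 => /(_ s0).
    rewrite LD -scaleNr LZ ReD ReM/= -/(- s)%R.
    have := ler_norm (- Re (L zeta)); rewrite normrN; nra.
  move=> vz; apply/eqP; rewrite eq_le ge// andbT -oppr_ge0.
  have := ge (- v); rewrite cinnerNl ReN vz oppr0 -scaleN1r LZ mulN1r ReN; exact.
have ReIm (a : R[i]) : Re ('i%C * a) = - Im a by case: a => x y; simpc.
(* Real tangency applies to both [w] and [i w], which kills the real and the imaginary part of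
   [L w]. *)
have tangC w : cinner w zeta = 0 -> L w = 0.
  move=> wz; have h1 := tang w; rewrite wz in h1.
  have h2 := tang ('i%C *: w); rewrite cinnerZl wz mulr0 LZ ReIm in h2.
  have {}h1 := h1 (erefl _); have {}h2 := h2 (erefl _).
  have h3 : Im (L w) = 0 by apply/eqP; rewrite -oppr_eq0 h2.
  by rewrite [LHS]complexE h1 h3 mulr0 addr0.
have Lz : Im (L zeta) = 0.
  have := tang ('i%C *: zeta); rewrite cinnerZl vnorm2_cinner z1 LZ !ReIm/= oppr0.
  by move=> /(_ (erefl _)) /eqP; rewrite oppr_eq0 => /eqP.
pose lam := - Re (L zeta).
have LE w : L w = - (lam%:C * cinner w zeta).
  have -> : w = cinner w zeta *: zeta + (w - cinner w zeta *: zeta) by rewrite addrC subrK.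
  rewrite LD LZ [X in _ + X]tangC ?addr0; last first.
    by rewrite cinnerBl cinnerZl vnorm2_cinner z1 mulr1 subrr.
  rewrite cinnerDl cinnerBl !cinnerZl vnorm2_cinner z1 !mulr1 subrr addr0 mulrC -mulNr.
  congr (_ * _); rewrite /lam rmorphN opprK.
  by rewrite [LHS]complexE Lz mulr0 addr0.
exists lam; last by move=> w; have := LE w; rewrite /L => /eqP; rewrite subr_eq => /eqP ->; ring.
rewrite lt0r; apply/andP; split.
  (* If [lam] vanished, [L] would be zero, against strict positivity at the centre of the ball. *)
  apply/eqP => lam0; have := pos 0 ball0; rewrite LE lam0 mul0r oppr0 mul0r/=.
  by rewrite ltxx.
rewrite /lam oppr_ge0 -oppr_ge0; have := @half (- zeta).
by rewrite cinnerNl vnorm2_cinner z1 ReN/= oppr_lt0 ltr01 -scaleN1r LZ mulN1r ReN; exact.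
Qed.

End linear_fractional.

(** * Existence of a boundary contact point *)

Section contact.
Context {R : realType} {N : nat}.
Local Open Scope complex_scope.
Implicit Types (z zeta : 'rV[R[i]]_N) (phi : 'rV[R[i]]_N -> 'rV[R[i]]_N).
Let n := (2 * N)%N.

Definition point_of (x : 'rV[R]_n) : 'rV[R[i]]_N :=
  of_coords N (fun k => if insub k is Some j then x ord0 j else 0).

Definition ccontinuous (g : 'rV[R]_n -> R[i]) :=
  continuous (fun x => Re (g x)) /\ continuous (fun x => Im (g x)).

Lemma ccontinuous_cst (a : R[i]) : ccontinuous (fun=> a).
Proof. by split=> x; exact: cst_continuous. Qed.

Lemma ccontinuousD g h : ccontinuous g -> ccontinuous h -> ccontinuous (fun x => g x + h x).
Proof.
move=> [g1 g2] [h1 h2]; split.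
  have -> : (fun x => Re (g x + h x)) = (fun x => Re (g x) + Re (h x)).
    by apply/funext => x; rewrite ReD.
  by move=> x; exact: (cvgD (g1 x) (h1 x)).
have -> : (fun x => Im (g x + h x)) = (fun x => Im (g x) + Im (h x)).
  by apply/funext => x; rewrite ImD.
by move=> x; exact: (cvgD (g2 x) (h2 x)).
Qed.

Lemma ccontinuousM g h : ccontinuous g -> ccontinuous h -> ccontinuous (fun x => g x * h x).
Proof.
move=> [g1 g2] [h1 h2]; split.
  have -> : (fun x => Re (g x * h x)) = (fun x => Re (g x) * Re (h x) - Im (g x) * Im (h x)).
    by apply/funext => x; rewrite ReM.
  move=> x; exact: (cvgB (cvgM (g1 x) (h1 x)) (cvgM (g2 x) (h2 x))).
have -> : (fun x => Im (g x * h x)) = (fun x => Re (g x) * Im (h x) + Im (g x) * Re (h x)).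
  by apply/funext => x; rewrite ImM.
by move=> x; exact: (cvgD (cvgM (g1 x) (h2 x)) (cvgM (g2 x) (h1 x))).
Qed.

Lemma ccontinuous_sum (I : Type) (r : seq I) (g : I -> 'rV[R]_n -> R[i]) :
  (forall i, ccontinuous (g i)) -> ccontinuous (fun x => \sum_(i <- r) g i x).
Proof.
move=> gc; elim: r => [|i r IH].
  have -> : (fun x => \sum_(i <- [::]) g i x) = (fun=> 0) by apply/funext => x; rewrite big_nil.
  exact: ccontinuous_cst.
have -> : (fun x => \sum_(j <- i :: r) g j x) = (fun x => g i x + \sum_(j <- r) g j x).
  by apply/funext => x; rewrite big_cons.
exact: ccontinuousD.
Qed.

Lemma ccontinuous_cabs2 g : ccontinuous g -> continuous (fun x => cabs2 (g x)).
Proof.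
move=> [g1 g2].
have -> : (fun x => cabs2 (g x)) = (fun x => Re (g x) * Re (g x) + Im (g x) * Im (g x)).
  by apply/funext => x; rewrite /cabs2 !expr2.
by move=> x; exact: (cvgD (cvgM (g1 x) (g1 x)) (cvgM (g2 x) (g2 x))).
Qed.

Lemma ccontinuous_coord (j : 'I_N) : ccontinuous (fun x => point_of x ord0 j).
Proof.
have cc k : continuous (fun x : 'rV[R]_n => (if insub k is Some j then x ord0 j else 0) : R).
  case: insubP => [i _ _|_]; last by move=> x; exact: cst_continuous.
  exact: coord_continuous.
split.
  have -> : (fun x => Re (point_of x ord0 j)) = (fun x : 'rV[R]_n => if insub (2 * j)%N is Some j then x ord0 j else 0).
    by apply/funext => x; rewrite mxE.
  exact: cc.
have -> : (fun x => Im (point_of x ord0 j)) = (fun x : 'rV[R]_n => if insub (2 * j + 1)%N is Some j then x ord0 j else 0).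
  by apply/funext => x; rewrite mxE.
exact: cc.
Qed.

Lemma continuous_sumr (I : Type) (r : seq I) (g : I -> 'rV[R]_n -> R) :
  (forall i, continuous (g i)) -> continuous (fun x => \sum_(i <- r) g i x).
Proof.
move=> gc; elim: r => [|i r IH].
  have -> : (fun x => \sum_(i <- [::]) g i x) = (fun=> 0) by apply/funext => x; rewrite big_nil.
  by move=> x; exact: cst_continuous.
have -> : (fun x => \sum_(j <- i :: r) g j x) = (fun x => g i x + \sum_(j <- r) g j x).
  by apply/funext => x; rewrite big_cons.
by move=> x; exact: (cvgD (gc i x) (IH x)).
Qed.

Lemma point_of_surj z : exists x, point_of x = z /\ forall j, x ord0 j ^+ 2 <= vnorm2 z.
Proof.
exists (\row_j coords z j).
have E : point_of (\row_j coords z j) = z.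
  rewrite -[RHS]coordsK; apply/rowP => j; rewrite !mxE.
  have j1 : (2 * j < n)%N by have := ltn_ord j; rewrite /n; lia.
  have j2 : (2 * j + 1 < n)%N by have := ltn_ord j; rewrite /n; lia.
  by rewrite !insubT/= !mxE.
split=> // j; rewrite mxE -{2}(coordsK z) vnorm2_of_coords.
have := @rdot_le_coord R (iota 0 (2 * N)) (coords z) j; rewrite mem_iota/= add0n.
by apply; exact: ltn_ord.
Qed.

(* The polynomial |q|^2 - |n|^2 is positive on the open ball; if it were
   bounded away from 0 on the closed ball, then |phi| would be bounded away
   from 1. *)
Lemma contact_point phi : linear_fractional_selfmap phi -> supnorm phi = 1 ->
  exists zeta v0 M C, [/\ vnorm2 zeta = 1, local_form phi zeta v0 M C & vnorm2 v0 = 1].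
Proof.
move=> [A [B [Cv [d [h1 [h2 h3]]]]]] sup1.
pose q z := cinner z Cv + d; pose m z := z *m A^T + B.
pose h x := cabs2 (q (point_of x)) - vnorm2 (m (point_of x)).
have ch : continuous h.
  have cq : continuous (fun x => cabs2 (q (point_of x))).
    apply: ccontinuous_cabs2; apply: ccontinuousD; last exact: ccontinuous_cst.
    apply: (@ccontinuous_sum _ _ (fun j x => point_of x ord0 j * _)) => j.
    by apply: ccontinuousM; [exact: ccontinuous_coord|exact: ccontinuous_cst].
  have cm : continuous (fun x => vnorm2 (m (point_of x))).
    apply: (@continuous_sumr _ _ (fun j x => cabs2 (m (point_of x) ord0 j))) => j.
    apply: ccontinuous_cabs2.
    have -> : (fun x => m (point_of x) ord0 j) =
      (fun x => \sum_k point_of x ord0 k * A^T k j + B ord0 j).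
      by apply/funext => x; rewrite /m mxE [X in X + _]mxE.
    apply: ccontinuousD; last exact: ccontinuous_cst.
    apply: (@ccontinuous_sum _ _ (fun k x => point_of x ord0 k * _)) => k.
    by apply: ccontinuousM; [exact: ccontinuous_coord|exact: ccontinuous_cst].
  by move=> x; exact: (cvgB (cq x) (cm x)).
have cn : continuous (fun x => vnorm2 (point_of x)).
  apply: (@continuous_sumr _ _ (fun j x => cabs2 (point_of x ord0 j))) => j.
  by apply: ccontinuous_cabs2; exact: ccontinuous_coord.
(* The closed unit ball in real coordinates, cut out of a cube so that compactness of a product of
   segments applies. *)
pose S := [set x : 'rV[R]_n | forall j, `[-1, 1]%classic (x ord0 j)] `&`
   [set x | vnorm2 (point_of x) <= 1].
have cS : compact S.
  apply: compact_closedI; first exact: (@rV_compact R n (fun=> `[-1, 1]%classic) (fun=> @segment_compact R (-1) 1)).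
  have -> : [set x | vnorm2 (point_of x) <= 1] = (fun x => vnorm2 (point_of x)) @^-1` [set y | y <= 1] by [].
  by apply: closed_comp => [x _|]; [exact: cn|exact: closed_le].
have S0 : S !=set0.
  have [x [xz xj]] := point_of_surj 0; exists x; split=> /=; last by rewrite xz vnorm20.
  move=> j; have := xj j; rewrite vnorm20 in_itv/= => x2.
  have -> : x ord0 j = 0 by apply/eqP; rewrite -sqrf_eq0 eq_le x2 sqr_ge0.
  by rewrite oppr_le0 ler01.
have [x0 /set_mem [_ x01] hmin] := compact_EVT_min S0 cS (continuous_subspaceT ch).
pose zeta := point_of x0.
have hmin' z : vnorm2 z <= 1 -> h x0 <= cabs2 (q z) - vnorm2 (m z).
  move=> z1; have [x [xz xj]] := point_of_surj z; rewrite -xz.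
  apply: hmin; apply/mem_set; split=> /=; last by rewrite xz.
  move=> j; rewrite in_itv/= -ler_norml -(ler_pXn2r (_ : (0 < 2)%N)) ?nnegrE//.
  by rewrite real_normK ?num_real// expr1n (le_trans (xj j)).
have nd := num_lt_den h1 h2 h3.
have h0 : h x0 <= 0.
  rewrite leNgt; apply/negP => hp.
  pose Q := 2 * vnorm2 Cv + 2 * cabs2 d.
  have qQ z : vnorm2 z <= 1 -> cabs2 (q z) <= Q.
    move=> z1; apply: le_trans (cabs2D_le _ _) _; rewrite /Q lerD2r ler_pM2l//.
    by apply: le_trans (cinner_cauchy _ _) _; rewrite -[leRHS]mul1r ler_wpM2r// vnorm2_ge0.
  have Q0 : 0 < Q.
    by apply: lt_le_trans (qQ 0 _); rewrite ?vnorm20// lt0r cabs2_eq0 cabs2_ge0 andbT; apply: h1; exact: ball0.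
  have hQ : h x0 <= Q.
    have := hmin' 0; rewrite vnorm20 => /(_ ler01).
    by have := qQ 0; rewrite vnorm20 => /(_ ler01); have := vnorm2_ge0 (m 0); lra.
  have : supnorm phi <= Num.sqrt (1 - h x0 / Q).
    apply: ge_sup; first by exists (vnorm (phi 0)); exists 0 => //; exact: ball0.
    move=> _ [z zb <-]; apply: ler_wsqrtr.
    have zb1 : vnorm2 z <= 1 by exact: ltW.
    rewrite h2// vnorm2Z cabs2V mulrC ler_pdivrMr; last by rewrite lt0r cabs2_eq0 cabs2_ge0 andbT; exact: h1.
    have := hmin' z zb1; have := qQ z zb1; rewrite -/(q z) -/(m z) => b1 b2.
    have : h x0 / Q * cabs2 (q z) <= h x0.
      by rewrite mulrAC ler_pdivrMr// ler_pM2l.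
    lra.
  rewrite sup1; apply/negP; rewrite -ltNge -[ltRHS]sqrtr1 ltr_sqrt// ltrBlDr ltrDl.
  by rewrite divr_gt0.
have z1 : vnorm2 zeta = 1.
  apply/eqP; rewrite eq_le x01 leNgt; apply/negP => zb.
  by have := nd _ zb; rewrite -subr_gt0 -/(h x0) ltNge h0.
have q0 := pole_free h1 h2 h3 sup1 z1.
have lf := local_form_data h1 h2 q0.
exists zeta, ((q zeta)^-1 *: m zeta), ((q zeta)^-1 *: A^T), (conjc (q zeta)^-1 *: Cv); split=> //.
apply/eqP; rewrite eq_le (local_form_le1 h3 z1 lf)/= vnorm2Z cabs2V mulrC.
rewrite ler_pdivlMr ?mul1r; last by rewrite lt0r cabs2_eq0 q0 cabs2_ge0.
by rewrite -subr_le0.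
Qed.

End contact.

(** * Test functions *)

Section scalars.
Context {R : realType}.
Local Open Scope complex_scope.
Implicit Types (a b u v : R[i]) (P D x y : R).

Lemma cabs2D u v : cabs2 (u + v) = cabs2 u + cabs2 v + 2 * Re (u * conjc v).
Proof. by case: u v => [a b] [c d]; rewrite /cabs2/=; ring. Qed.

Lemma Re_sq_mul_conjc u v : Re (u * conjc v) ^+ 2 <= cabs2 u * cabs2 v.
Proof. by apply: le_trans (Re_sq_le _) _; rewrite cabs2M cabs2_conjc. Qed.

Lemma le_of_sq_le x y : 0 <= y -> x ^+ 2 <= y ^+ 2 -> x <= y.
Proof. by move=> y0 xy; rewrite leNgt; apply/negP => yx; nra. Qed.

Lemma cabs2D_sq u v x y : 0 <= x -> 0 <= y -> cabs2 u <= x ^+ 2 -> cabs2 v <= y ^+ 2 ->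
  cabs2 (u + v) <= (x + y) ^+ 2.
Proof.
move=> x0 y0 ux vy; rewrite cabs2D.
have : Re (u * conjc v) <= x * y.
  apply: le_of_sq_le; first exact: mulr_ge0.
  by apply: le_trans (Re_sq_mul_conjc _ _) _; rewrite exprMn ler_pM ?cabs2_ge0.
by rewrite sqrrD; lra.
Qed.

(** [|v| <= (1 + D)^(-1/2) |u|], and [k = (2 + D) / (2 (1 + D))] is a rational upper bound for that
    root; [1 - k] is the constant of the statement. *)
Lemma cabs2_sub_ge u v D : 0 < D -> cabs2 v * (1 + D) <= cabs2 u ->
  (D / (2 * (1 + D))) ^+ 2 * cabs2 u <= cabs2 (u - v).
Proof.
move=> D0 vu; rewrite cabs2D cabs2N rmorphN/= mulrN ReN mulrN.
have u0 := cabs2_ge0 u; have v0 := cabs2_ge0 v.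
have := Re_sq_mul_conjc u v; move: (Re _) (cabs2 u) (cabs2 v) u0 v0 vu => r x y x0 y0 xy rxy.
have D1 : 1 + D != 0 by lra.
pose k := (2 + D) / (2 * (1 + D)).
have rk : r <= k * x.
  apply: le_of_sq_le; first by rewrite /k mulr_ge0// divr_ge0//; lra.
  apply: le_trans rxy _.
  have : x * y <= x ^+ 2 / (1 + D) by rewrite ler_pdivlMr; [nra|lra].
  move/le_trans; apply; rewrite exprMn mulrC ler_wpM2r ?sqr_ge0//.
  rewrite -subr_ge0; have -> : k ^+ 2 - (1 + D)^-1 = (D / (2 * (1 + D))) ^+ 2 by rewrite /k; field.
  exact: sqr_ge0.
have [xr|xr] := leP r 0.
  suff : (D / (2 * (1 + D))) ^+ 2 * x <= x by lra.
  rewrite ler_piMl// expr_le1// ?divr_ge0 ?ler_pdivrMr; lra.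
have r2 : r ^+ 2 <= x * y by [].
have [x00|xp] := eqVneq x 0; first by move: r2; rewrite x00 mul0r; nra.
have {}xp : 0 < x by rewrite lt0r xp.
rewrite -subr_ge0 -(pmulr_rge0 _ xp).
have -> : x * (x + y + - (2 * r) - (D / (2 * (1 + D))) ^+ 2 * x) =
  (x * y - r ^+ 2) + ((x - r) ^+ 2 - ((1 - k) * x) ^+ 2).
  by rewrite /k; field.
rewrite addr_ge0 ?subr_ge0// ler_pXn2r ?nnegrE//; last 2 first.
- rewrite mulr_ge0// subr_ge0 /k ler_pdivrMr; lra.
- suff : k * x <= x by lra.
  by rewrite ler_piMl// /k ler_pdivrMr; lra.
- lra.
Qed.

Lemma expr_lower n P : 0 <= P -> 2 * P <= n%:R -> expR (- (2 * P)) <= (1 - P / n%:R) ^+ n.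
Proof.
move=> P0 Pn; case: n Pn => [|n] Pn; first by rewrite expr0 -[leRHS]expR0 ler_expR; lra.
have n0 : 0 < n.+1%:R :> R by rewrite ltr0n.
have E : expR (- (2 * P)) = expR (- (2 * (P / n.+1%:R))) ^+ n.+1.
  by rewrite -expRM_natl; congr expR; field; rewrite gt_eqF.
have p0 : 0 <= P / n.+1%:R by rewrite divr_ge0// ltW.
have p1 : 2 * (P / n.+1%:R) <= 1 by rewrite mulrA ler_pdivrMr// mul1r.
rewrite E; move: (P / _) p0 p1 => p p0 p1.
apply: lerXn2r; rewrite ?nnegrE ?expR_ge0//; first lra.
rewrite expRN.
have := expR_ge1Dx (2 * p) => h.
by rewrite -div1r ler_pdivrMr ?expR_gt0//; nra.
Qed.

Lemma bernoulli_inv n D : 0 <= D -> D <= n%:R -> (1 - D / n%:R) ^+ n * (1 + D) <= 1.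
Proof.
move=> D0 Dn; case: n Dn => [|n] Dn; first by rewrite expr0; lra.
have n0 : 0 < n.+1%:R :> R by rewrite ltr0n.
have d1 : 0 <= 1 - D / n.+1%:R by rewrite subr_ge0 ler_pdivrMr// mul1r.
have h : (1 - D / n.+1%:R) ^+ n.+1 <= expR (- D).
  have -> : expR (- D) = expR (- (D / n.+1%:R)) ^+ n.+1.
    by rewrite -expRM_natl; congr expR; field; rewrite gt_eqF.
  by apply: lerXn2r; rewrite ?nnegrE ?expR_ge0//; exact: expR_ge1Dx.
have h2 := expR_ge1Dx D.
apply: (@le_trans _ _ (expR (- D) * expR D)); last by rewrite -expRD addNr expR0.
by apply: ler_pM => //; [rewrite exprn_ge0|lra].
Qed.

(** A gap [D / n] between squared moduli becomes a factor [1 + D] after [n]-th powers, while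
    [1 - P / n <= |a|^2] prevents [a^n] from tending to [0]. *)
Lemma cabs2_pow_gap n a b P D : 0 < D -> D <= n%:R -> 0 <= P -> 2 * P <= n%:R ->
  cabs2 b <= cabs2 a - D / n%:R -> cabs2 a <= 1 -> 1 - P / n%:R <= cabs2 a ->
  (D / (2 * (1 + D))) ^+ 2 * expR (- (2 * P)) <= cabs2 (a ^+ n - b ^+ n).
Proof.
move=> D0 Dn P0 Pn ba a1 aP.
have n0 : 0 < n%:R :> R by lra.
have d1 : 0 <= 1 - D / n%:R by rewrite subr_ge0 ler_pdivrMr// mul1r.
have d0 : 0 <= D / n%:R by rewrite divr_ge0// ltW.
have a0 := cabs2_ge0 a; have b0 := cabs2_ge0 b.
have p1 : 0 <= 1 - P / n%:R by rewrite subr_ge0 ler_pdivrMr// mul1r; lra.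
apply: le_trans (@cabs2_sub_ge (a ^+ n) (b ^+ n) D D0 _).
  rewrite ler_wpM2l ?sqr_ge0// cabs2X; apply: le_trans (expr_lower P0 Pn) _.
  by apply: lerXn2r; rewrite ?nnegrE.
rewrite !cabs2X.
have : cabs2 b ^+ n <= (cabs2 a * (1 - D / n%:R)) ^+ n.
  by apply: lerXn2r; rewrite ?nnegrE ?mulr_ge0//; nra.
rewrite exprMn => h.
apply: (@le_trans _ _ (cabs2 a ^+ n * (1 - D / n%:R) ^+ n * (1 + D))).
  by rewrite ler_wpM2r//; lra.
by rewrite -mulrA ler_piMr ?exprn_ge0// bernoulli_inv// ltW.
Qed.

(* (1 + d)^n - 1 = d * sum_i (1 + d)^i, and every term of the sum is close to 1. *)
Lemma cabs2_pow_near1 n d x : 0 <= x -> 8 * (n%:R * x) <= 1 -> cabs2 d <= x ^+ 2 ->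
  n%:R ^+ 2 * cabs2 d / 4 <= cabs2 ((1 + d) ^+ n - 1).
Proof.
move=> x0 nx dx.
have near1 i : (i <= n)%N -> cabs2 ((1 + d) ^+ i - 1) <= (2 * i%:R * x) ^+ 2.
  elim: i => [|i IH] ni; first by rewrite expr0 subrr (_ : cabs2 0 = 0) ?sqr_ge0// /cabs2/= expr0n addr0.
  have -> : (1 + d) ^+ i.+1 - 1 = ((1 + d) ^+ i - 1) + d * (((1 + d) ^+ i - 1) + 1).
    by rewrite exprS; ring.
  have i0 : 0 <= i%:R :> R by rewrite ler0n.
  have ix : 8 * (i%:R * x) <= 1.
    apply: le_trans nx; rewrite ler_pM2l// ler_wpM2r// ler_nat; exact: ltnW.
  have h1 := IH (ltnW ni).
  have h2 : cabs2 (((1 + d) ^+ i - 1) + 1) <= 2 ^+ 2.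
    apply: le_trans (@cabs2D_sq _ _ (2 * i%:R * x) 1 _ _ h1 _) _ => //.
    - by rewrite !mulr_ge0.
    - by rewrite cabs2_real.
    - by apply: lerXn2r; rewrite ?nnegrE ?addr_ge0 ?mulr_ge0//; lra.
  have h3 : cabs2 (d * (((1 + d) ^+ i - 1) + 1)) <= (x * 2) ^+ 2.
    by rewrite cabs2M exprMn ler_pM ?cabs2_ge0.
  apply: le_trans (@cabs2D_sq _ _ (2 * i%:R * x) (x * 2) _ _ h1 h3) _; rewrite ?mulr_ge0//.
  have -> : 2 * i.+1%:R * x = 2 * i%:R * x + x * 2 by rewrite (_ : i.+1%:R = i%:R + 1 :> R) ?natr1//; ring.
  exact: lexx.
have half i : (i <= n)%N -> 2^-1 <= Re ((1 + d) ^+ i).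
  move=> ni; have := near1 i ni.
  have ix : 8 * (i%:R * x) <= 1.
    by apply: le_trans nx; rewrite ler_pM2l// ler_wpM2r// ler_nat.
  have ix0 : 0 <= i%:R * x by rewrite mulr_ge0.
  have := Re_sq_le ((1 + d) ^+ i - 1); rewrite ReB/= => h1 h2.
  have : (2 * i%:R * x) ^+ 2 <= 4^-1 ^+ 2 by apply: lerXn2r; rewrite ?nnegrE -?mulrA ?mulr_ge0//; lra.
  move=> h3; have : (1 - Re ((1 + d) ^+ i)) ^+ 2 <= 4^-1 ^+ 2 by move: h1 h2 h3; rewrite -sqrrN opprB; lra.
  move=> h; have : 1 - Re ((1 + d) ^+ i) <= 4^-1 by apply: le_of_sq_le h.
  lra.
rewrite subrX1 cabs2M addrAC subrr add0r mulrAC mulrC.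
rewrite ler_wpM2l ?cabs2_ge0//.
apply: le_trans (Re_sq_le _).
have : n%:R / 2 <= Re (\sum_(i < n) (1 + d) ^+ i).
  rewrite (big_morph (@Re R) ReD (erefl _)).
  have -> : n%:R / 2 = \sum_(i < n) 2^-1 :> R by rewrite sumr_const card_ord mulr_natl.
  by apply: ler_sum => i _; apply: half; rewrite ltnW.
have : 0 <= n%:R :> R by [].
nra.
Qed.

End scalars.

Section peak.
Context {R : realType} {N : nat}.
Local Open Scope complex_scope.
Implicit Types (e eta z : 'rV[R[i]]_N).

Definition peak eta z : R[i] := (1 + cinner z eta) / 2.

(** The last term measures the component orthogonal to [eta]; its decay will pay for the growing
    factor [m <z, e>]. *)
Lemma cabs2_peak_le eta z : vnorm2 eta = 1 -> vnorm2 z <= 1 ->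
  cabs2 (peak eta z) <=
  1 - (1 - Re (cinner z eta)) / 2 - vnorm2 (z - cinner z eta *: eta) / 4.
Proof.
move=> e1 z1; rewrite /peak cabs2M cabs2V.
have -> : cabs2 (2 : R[i]) = 4 by rewrite /cabs2/=; ring.
rewrite vnorm2B vnorm2Z e1 cinnerZr.
move: z1; case: (cinner z eta) => x y; rewrite /cabs2/=; simpc => /=; lra.
Qed.

Lemma expr_le_expR n (x y : R) : 0 <= x -> x <= 1 - y -> x ^+ n <= expR (- (n%:R * y)).
Proof.
move=> x0 xy.
have -> : expR (- (n%:R * y)) = expR (- y) ^+ n by rewrite -expRM_natl mulrN.
apply: lerXn2r; rewrite ?nnegrE ?expR_ge0//.
by apply: le_trans xy _; exact: expR_ge1Dx.
Qed.

Definition test_fun eta (o : option 'rV[R[i]]_N) (m : nat) z : R[i] :=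
  (if o is Some e then (m%:R : R)%:C * cinner z e else 1) * peak eta z ^+ (m ^ 2).

(** [e] sees only the component [z'] orthogonal to [eta], so [|m <z, e>|^2 <= m^2 |z'|^2 |e|^2], and
    [x exp(-x/4) <= 4] absorbs it. *)
Lemma test_fun_le eta o : vnorm2 eta = 1 -> (if o is Some e then cinner e eta = 0 else True) ->
  exists2 C : R, 0 <= C & forall m z, vnorm2 z <= 1 ->
    cabs2 (test_fun eta o m z) <= C * expR (- ((m%:R : R) ^+ 2 / 4 * (1 - Re (cinner z eta)))).
Proof.
move=> e1 oe; exists (1 + 4 * (if o is Some e then vnorm2 e else 0)).
  by rewrite addr_ge0// mulr_ge0//; case: o oe => // e _; exact: vnorm2_ge0.
move=> m z z1; rewrite /test_fun cabs2M cabs2X.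
have h := cabs2_peak_le e1 z1.
have u0 : 0 <= 1 - Re (cinner z eta) by rewrite subr_ge0 Re_cinner_le// e1.
set u := 1 - Re _ in h u0 *; set z' := z - _ in h.
have hn : cabs2 (peak eta z) ^+ (m ^ 2) <=
  expR (- (m%:R ^+ 2 / 4 * u)) * expR (- (m%:R ^+ 2 * vnorm2 z' / 4)).
  have h' : cabs2 (peak eta z) <= 1 - (u / 4 + vnorm2 z' / 4) by lra.
  apply: le_trans (expr_le_expR (m ^ 2) (cabs2_ge0 _) h') _.
  by rewrite -expRD ler_expR natrX le_eqVlt; apply/orP; left; apply/eqP; ring.
have m0 : 0 <= (m%:R : R) ^+ 2 * vnorm2 z' by rewrite mulr_ge0 ?sqr_ge0 ?vnorm2_ge0.
case: o oe => [e ee|_]; last first.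
  rewrite (_ : cabs2 1 = 1) ?mul1r; last by rewrite /cabs2/=; ring.
  rewrite mulr0 addr0 mul1r; apply: le_trans hn _.
  rewrite ler_piMr ?expR_ge0// -[leRHS]expR0 ler_expR; lra.
have ze : cinner z e = cinner z' e.
  by rewrite /z' cinnerBl cinnerZl (cinnerC e eta) ee (_ : conjc 0 = 0) ?mulr0 ?subr0// rmorph0.
rewrite cabs2M cabs2_real ze.
have c1 := cinner_cauchy z' e; have e0 := vnorm2_ge0 e.
apply: (@le_trans _ _ (m%:R ^+ 2 * (vnorm2 z' * vnorm2 e) *
   (expR (- (m%:R ^+ 2 / 4 * u)) * expR (- (m%:R ^+ 2 * vnorm2 z' / 4))))).
  apply: ler_pM => //; rewrite ?mulr_ge0 ?sqr_ge0 ?cabs2_ge0 ?exprn_ge0 ?cabs2_ge0//.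
  by rewrite ler_wpM2l ?sqr_ge0.
move: m0; move: (expR (- (m%:R ^+ 2 / 4 * u))) (expR_ge0 (- (m%:R ^+ 2 / 4 * u))) => E E0.
rewrite [m%:R ^+ 2 * (_ * _)]mulrA; move: (m%:R ^+ 2 * vnorm2 z') => x x0.
have hx : x * expR (- (x / 4)) <= 4.
  rewrite expRN -/(x / _) ler_pdivrMr ?expR_gt0//.
  by have := expR_ge1Dx (x / 4); lra.
have -> : x * vnorm2 e * (E * expR (- (x / 4))) = E * vnorm2 e * (x * expR (- (x / 4))) by ring.
apply: (@le_trans _ _ (E * vnorm2 e * 4)); first by rewrite ler_wpM2l// mulr_ge0.
have : 0 <= E * vnorm2 e by rewrite mulr_ge0.
lra.
Qed.

End peak.

(** * Separation near a contact point *)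

Section local.
Context {R : realType} {N : nat}.
Local Open Scope complex_scope.
Implicit Types (z zeta tau eta C v : 'rV[R[i]]_N) (phi psi : 'rV[R[i]]_N -> 'rV[R[i]]_N) (m eps lam : R).

Lemma near_le_sq (K k : R) : 0 < k -> \forall m \near \oo, K <= k * (m%:R : R) ^+ 2.
Proof.
move=> k0; near=> m.
have m1 : 1 <= m%:R :> R by rewrite ler1n; near: m; exact: nbhs_infty_gt.
have : K / k <= m%:R by near: m; exact: nbhs_infty_ger.
by rewrite ler_pdivrMr// => /le_trans; apply; rewrite mulrC ler_pM2l// expr2 ler_peMr//; lra.
Unshelve. all: by end_near. Qed.

Definition near_pt zeta tau eps m z := [/\ ballN N z,
  vnorm2 (m%:C *: (z - zeta) - tau) <= eps ^+ 2 & 1 <= m ^+ 2 * (1 - vnorm2 z) <= 4].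

Definition separated phi psi := exists zeta eta o tau eps (c0 : R),
  [/\ vnorm2 zeta = 1, vnorm2 eta = 1, (if o is Some e then cinner e eta = 0 else True),
      Re (cinner tau zeta) = 0 & [/\ 0 < eps, 0 < c0 &
  \forall m \near \oo, forall z, near_pt zeta tau eps m%:R z ->
    c0 <= cabs2 (test_fun eta o m (phi z) - test_fun eta o m (psi z))]].

Lemma separatedC phi psi : separated phi psi -> separated psi phi.
Proof.
move=> [zeta [eta [ob [tau [eps [c0 [h1 h2 h3 h4 [h5 h6 h7]]]]]]]].
exists zeta, eta, ob, tau, eps, c0.
split; [exact: h1|exact: h2|exact: h3|exact: h4|split; [exact: h5|exact: h6|]].
by apply: filterS h7 => m h z /h; rewrite -cabs2N opprB.
Qed.

Lemma near_pt_scaled zeta tau eps m z : near_pt zeta tau eps m z ->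
  m ^+ 2 * vnorm2 (z - zeta) <= 2 * eps ^+ 2 + 2 * vnorm2 tau.
Proof.
move=> [_ h _]; rewrite -cabs2_real -vnorm2Z -(subrK tau (m%:C *: _)).
by apply: le_trans (vnorm2D_le _ _) _; rewrite lerD2r ler_pM2l.
Qed.

(** On the test region both terms on the right are [O(1/m^2)], although [z - zeta] is only
    [O(1/m)]. *)
Lemma Re_cinner_sub zeta z : vnorm2 zeta = 1 ->
  Re (cinner (z - zeta) zeta) = - ((1 - vnorm2 z) + vnorm2 (z - zeta)) / 2.
Proof.
by move=> z1; rewrite vnorm2B z1 cinnerBl ReB Re_cinner_self z1; field.
Qed.

Lemma den_near1 C v (k : R) : 0 < k -> k <= 1 -> 9 * (vnorm2 v * vnorm2 C) <= k ^+ 2 ->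
  1 - k <= cabs2 (1 + cinner v C) <= 1 + k.
Proof.
move=> k0 k1 h; have := cinner_cauchy v C; have := Re_sq_le (cinner v C).
have := cabs2_ge0 (cinner v C).
rewrite cabs2D (_ : cabs2 1 = 1); last by rewrite /cabs2/=; ring.
rewrite mul1r Re_conjc; move: (Re _) (cabs2 _) (vnorm2 v * _) h => r c x h c0 rc cx.
have r1 : r <= k / 3 by apply: le_of_sq_le; nra.
have r2 : - r <= k / 3 by apply: le_of_sq_le; rewrite ?sqrrN; nra.
by apply/andP; split; nra.
Qed.

Lemma peak_local phi zeta v0 M C lam z : local_form phi zeta v0 M C -> vnorm2 v0 = 1 ->
  (forall w, cinner (w *m M) v0 = cinner w C + lam%:C * cinner w zeta) -> ballN N z ->
  peak v0 (phi z) = 1 + (lam / 2)%:C * cinner (z - zeta) zeta / (1 + cinner (z - zeta) C).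
Proof.
move=> lf v1 jl zb; have [d0 ->] := lf z zb.
rewrite /peak cinnerZl (cinnerDl v0) vnorm2_cinner v1 jl rmorphM/= fmorphV/=.
rewrite (_ : 2%:C = 2); last by rewrite rmorphMn.
by rewrite rmorph1; field.
Qed.

(** Expanding [|D|^2 - |D + lam s / 2|^2] and inserting the exact value of [Re s], the only term not
    quadratic in [z - zeta] is [lam (1 - |z|^2) / 2]. This is how [lam] is read off from moduli. *)
Lemma peak_expand zeta C lam z (s := cinner (z - zeta) zeta) (D := 1 + cinner (z - zeta) C) :
  0 < lam -> vnorm2 zeta = 1 -> D != 0 ->
  `|(1 - cabs2 (1 + (lam / 2)%:C * s / D)) * cabs2 D - lam * (1 - vnorm2 z) / 2| <=
  (lam / 2 + lam * (1 + vnorm2 C) / 2 + lam ^+ 2 / 4) * vnorm2 (z - zeta).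
Proof.
move=> lam0 z1 D0.
have -> : (1 - cabs2 (1 + (lam / 2)%:C * s / D)) * cabs2 D =
    cabs2 D - cabs2 (D + (lam / 2)%:C * s).
  rewrite mulrBl mul1r -cabs2M mulrDl mul1r divfK//.
rewrite [cabs2 (D + _)]cabs2D cabs2M cabs2_real.
have -> : Re (D * conjc ((lam / 2)%:C * s)) = lam / 2 * (Re s + Re (s * conjc (cinner (z - zeta) C))).
  by rewrite /D; case: (s) => a b; case: (cinner _ C) => c d /=; simpc => /=; ring.
rewrite [Re s]Re_cinner_sub//.
have := Re_sq_mul_conjc s (cinner (z - zeta) C).
have c1 : cabs2 s <= vnorm2 (z - zeta).
  by apply: le_trans (cinner_cauchy _ _) _; rewrite z1 mulr1.
have c2 := cinner_cauchy (z - zeta) C.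
have s0 := cabs2_ge0 s; have c0 := cabs2_ge0 (cinner (z - zeta) C).
move: c1 c2 s0 c0; move: (cabs2 s) (cabs2 (cinner _ C)) (vnorm2 (z - zeta)) (vnorm2 C) (Re (s * _)) (cabs2 D).
move=> S c w cc r d Sw cw S0 c0 rSc.
have sc := sqr_ge0 (S - c).
have h1 : r <= (S + c) / 2 by apply: le_of_sq_le; [lra|nra].
have h2 : - r <= (S + c) / 2 by apply: le_of_sq_le; rewrite ?sqrrN; [lra|nra].
have h3 : lam ^+ 2 * S <= lam ^+ 2 * w by rewrite ler_wpM2l// sqr_ge0.
have h4 : 0 <= lam ^+ 2 * S by rewrite mulr_ge0// sqr_ge0.
have w0 : 0 <= w by lra.
have h5 : lam * r <= lam * ((w + w * cc) / 2) by rewrite ler_pM2l//; lra.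
have h6 : - (lam * r) <= lam * ((w + w * cc) / 2) by rewrite -mulrN ler_pM2l//; lra.
have h7 : 0 <= lam * w by rewrite mulr_ge0// ltW.
rewrite ler_norml exprMn; apply/andP; split; lra.
Qed.

Lemma den_near zeta tau eps C (k : R) : 0 < k -> k <= 1 -> 
  \forall m \near \oo, forall z, near_pt zeta tau eps m%:R z ->
    1 - k <= cabs2 (1 + cinner (z - zeta) C) <= 1 + k.
Proof.
move=> k0 k1; near=> m => z zn; apply: den_near1 => //.
have m0 : 0 < (m%:R : R) ^+ 2.
  by rewrite exprn_gt0// ltr0n; near: m; exact: nbhs_infty_gt.
rewrite -(ler_pM2r m0); apply: (@le_trans _ _ (9 * ((2 * eps ^+ 2 + 2 * vnorm2 tau) * vnorm2 C))).
  have := near_pt_scaled zn; have := vnorm2_ge0 C => h1 h2.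
  by have := ler_wpM2r h1 h2; lra.
by near: m; apply: near_le_sq; exact: exprn_gt0.
Unshelve. all: by end_near. Qed.

Lemma peak_bounds phi zeta v0 M C lam tau eps : local_form phi zeta v0 M C ->
  vnorm2 zeta = 1 -> vnorm2 v0 = 1 -> 0 < lam ->
  (forall w, cinner (w *m M) v0 = cinner w C + lam%:C * cinner w zeta) ->
  exists2 P : R, 0 <= P & \forall m \near \oo, forall z, near_pt zeta tau eps m%:R z ->
    1 - P / m%:R ^+ 2 <= cabs2 (peak v0 (phi z)).
Proof.
move=> lf z1 v1 lam0 jl.
pose K := lam / 2 + lam * (1 + vnorm2 C) / 2 + lam ^+ 2 / 4.
have C0 := vnorm2_ge0 C; have t0 := vnorm2_ge0 tau.
have K0 : 0 <= K by rewrite /K !addr_ge0// ?divr_ge0 ?mulr_ge0 ?sqr_ge0 ?addr_ge0// ltW.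
pose om := 2 * eps ^+ 2 + 2 * vnorm2 tau.
have om0 : 0 <= om by rewrite /om addr_ge0// mulr_ge0// sqr_ge0.
exists (2 * (2 * lam + K * om)); first by have := mulr_ge0 K0 om0; lra.
near=> m => z zn; have [zb _ /andP[p1 p2]] := zn.
have m0 : 0 < (m%:R : R) ^+ 2.
  by rewrite exprn_gt0// ltr0n; near: m; exact: nbhs_infty_gt.
have [D0 _] := lf z zb.
have := peak_expand lam0 z1 D0; rewrite -(peak_local lf v1 jl zb) -/K.
have hD : 1 - 2^-1 <= cabs2 (1 + cinner (z - zeta) C) <= 1 + 2^-1.
  by move: z zn {zb p1 p2 D0}; near: m; apply: den_near; lra.
have /andP[D1 D2] := hD.
have := near_pt_scaled zn; rewrite -/om.
move: D1 D2 p1 p2; move: (cabs2 (1 + _)) => D; move: (cabs2 _) => a; move: (vnorm2 (z - _)) => w.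
move: (vnorm2 z) => x D1 D2 p1 p2 wom.
rewrite ler_norml => /andP[_ h].
rewrite lerBlDl -lerBlDr ler_pdivlMr//.
have := ler_wpM2l (ltW m0) h; have := ler_wpM2l K0 wom; have := ler_wpM2l (ltW lam0) p2.
clearbody K om; move: (m%:R ^+ 2) m0 p1 p2 wom => n n0 p1 p2 wom h1 h2 h3.
have h4 : n * (1 - a) * D <= 2 * lam + K * om by clear -h1 h2 h3; lra.
have k1 : 0 <= K * om by rewrite mulr_ge0.
have [h5|h5] := leP (n * (1 - a)) 0; first by clear -h5 k1 lam0; lra.
have : n * (1 - a) * 2^-1 <= n * (1 - a) * D by rewrite ler_pM2l//; clear -D1; lra.
clear -h4; lra.
Unshelve. all: by end_near. Qed.

Lemma peak_le1 eta z : vnorm2 eta = 1 -> ballN N z -> cabs2 (peak eta z) <= 1.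
Proof.
move=> e1 zb; have z1 : vnorm2 z <= 1 by exact: ltW.
have := cabs2_peak_le e1 z1; have := vnorm2_ge0 (z - cinner z eta *: eta).
have := @Re_cinner_le _ _ z eta z1; rewrite e1 lexx => /(_ isT); lra.
Qed.

Lemma separated_of_gap phi psi zeta eta eps (P D : R) :
  (forall z, ballN N z -> ballN N (phi z)) -> vnorm2 zeta = 1 -> vnorm2 eta = 1 ->
  0 < eps -> 0 <= P -> 0 < D ->
  (\forall m \near \oo, forall z, near_pt zeta 0 eps m%:R z ->
     1 - P / m%:R ^+ 2 <= cabs2 (peak eta (phi z)) /\
     cabs2 (peak eta (psi z)) <= cabs2 (peak eta (phi z)) - D / m%:R ^+ 2) ->
  separated phi psi.
Proof.
move=> phib z1 e1 eps0 P0 D0 H.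
exists zeta, eta, None, 0, eps, ((D / (2 * (1 + D))) ^+ 2 * expR (- (2 * P))).
split=> //; first by rewrite cinner0l.
split=> //; first by rewrite mulr_gt0 ?expR_gt0// exprn_gt0// divr_gt0//; lra.
near=> m => z zn.
have [h1 h2] : 1 - P / m%:R ^+ 2 <= cabs2 (peak eta (phi z)) /\
     cabs2 (peak eta (psi z)) <= cabs2 (peak eta (phi z)) - D / m%:R ^+ 2.
  by move: z zn; near: m.
rewrite /test_fun !mul1r; apply: cabs2_pow_gap => //; rewrite ?natrX//.
- by rewrite -[leRHS]mul1r; near: m; exact: near_le_sq.
- by rewrite -[leRHS]mul1r; near: m; exact: near_le_sq.
- by apply: peak_le1 => //; apply: phib; case: zn.
Unshelve. all: by end_near. Qed.

End local.

Section cases.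
Context {R : realType} {N : nat}.
Local Open Scope complex_scope.
Implicit Types (z zeta tau eta C v : 'rV[R[i]]_N) (phi psi : 'rV[R[i]]_N -> 'rV[R[i]]_N) (m eps lam : R).

(* The other map sends [zeta] to a point where the peak function is smaller than 1. *)
Lemma separated_values phi psi zeta v0 M C v0' M' C' lam :
  (forall z, ballN N z -> ballN N (phi z)) -> (forall z, ballN N z -> ballN N (psi z)) ->
  vnorm2 zeta = 1 -> local_form phi zeta v0 M C -> local_form psi zeta v0' M' C' ->
  vnorm2 v0 = 1 -> 0 < lam ->
  (forall w, cinner (w *m M) v0 = cinner w C + lam%:C * cinner w zeta) ->
  v0' != v0 -> separated phi psi.
Proof.
move=> phib psib z1 lf lf' v1 lam0 jl v0v.
have v1' := local_form_le1 psib z1 lf'.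
have [P P0 HP] := peak_bounds 0 1 lf z1 v1 lam0 jl.
pose u := 1 - Re (cinner v0' v0).
have u0 : 0 < u.
  have : 0 < vnorm2 (v0' - v0) by rewrite vnorm2_gt0 subr_eq0.
  by rewrite vnorm2B v1 /u; lra.
have [K K0 HK] := vnorm2_mulmx M'.
apply: (separated_of_gap (zeta := zeta) (eta := v0) (eps := 1) (P := P) (D := 1)) => //.
near=> m => z zn; have [zb _ _] := zn.
have m0 : 0 < (m%:R : R) ^+ 2.
  by rewrite exprn_gt0// ltr0n; near: m; exact: nbhs_infty_gt.
have a1 : 1 - P / m%:R ^+ 2 <= cabs2 (peak v0 (phi z)).
  by move: z zn {zb}; near: m.
split=> //; apply: (@le_trans _ _ (1 - u / 4)); last first.
  have : 4 * (P + 1) <= u * m%:R ^+ 2 by near: m; exact: near_le_sq.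
  move=> h; suff : P / m%:R ^+ 2 + 1 / m%:R ^+ 2 <= u / 4 by lra.
  by rewrite -mulrDl ler_pdivrMr//; lra.
have qb := psib z zb; have q1 : vnorm2 (psi z) <= 1 by exact: ltW.
apply: le_trans (cabs2_peak_le v1 q1) _.
have := vnorm2_ge0 (psi z - cinner (psi z) v0 *: v0).
suff : Re (cinner (psi z - v0') v0) <= u / 2 by rewrite cinnerBl ReB /u; lra.
apply: le_of_sq_le; first lra.
apply: le_trans (Re_sq_le _) _; apply: le_trans (cinner_cauchy _ _) _; rewrite v1 mulr1.
have [D0 pz] := lf' z zb.
set D := 1 + _ in D0 pz.
have hD : 1 - 2^-1 <= cabs2 D <= 1 + 2^-1.
  by rewrite /D; move: z zn {zb a1 qb q1 D0 pz D}; near: m; apply: den_near; clear; lra.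
have -> : psi z - v0' = D^-1 *: ((z - zeta) *m M' - cinner (z - zeta) C' *: v0').
  rewrite pz; have {2}-> : v0' = D^-1 *: (D *: v0') by rewrite scalerA mulVf// scale1r.
  by rewrite -scalerBr /D scalerDl scale1r opprD addrACA subrr add0r.
rewrite vnorm2Z cabs2V.
have h1 : vnorm2 ((z - zeta) *m M' - cinner (z - zeta) C' *: v0') <=
    (2 * K + 2 * vnorm2 C') * vnorm2 (z - zeta).
  apply: le_trans (vnorm2D_le _ _) _; rewrite vnorm2N vnorm2Z.
  have := cinner_cauchy (z - zeta) C'; have := HK (z - zeta).
  have := cabs2_ge0 (cinner (z - zeta) C'); have := vnorm2_ge0 v0'.
  clear -v1'; nra.
have h2 := near_pt_scaled zn; rewrite vnorm20 in h2.
have h3 : 16 * (2 * K + 2 * vnorm2 C') <= u ^+ 2 * m%:R ^+ 2.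
  by near: m; apply: near_le_sq; exact: exprn_gt0.
case/andP: hD => D1 D2.
have Dp : 0 < cabs2 D by clear -D1; lra.
rewrite mulrC ler_pdivrMr//; apply: le_trans h1 _.
have C0 := vnorm2_ge0 C'; have w0 := vnorm2_ge0 (z - zeta).
move: h2 h3 D1 m0 C0 w0; move: (cabs2 D) (vnorm2 C') (vnorm2 (z - zeta)) (m%:R ^+ 2).
move=> d c w n h2 h3 D1 n0 c0 w0.
rewrite -(ler_pM2r n0); apply: (@le_trans _ _ ((2 * K + 2 * c) * 2)).
  by rewrite -mulrA ler_wpM2l//; clear -h2 K0 c0; lra.
have un0 : 0 <= u ^+ 2 * n by rewrite mulr_ge0 ?sqr_ge0// ltW.
have : u ^+ 2 * n * 2^-1 <= u ^+ 2 * n * d by rewrite (ler_wpM2l un0)//; clear -D1; lra.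
by rewrite expr_div_n; clear -h3 un0; lra.
Unshelve. all: by end_near. Qed.

(** [a] and [b] are the rescaled defects [n (1 - |F|^2)] of the two maps, and [p] is the rescaled
    gap. As [p >= 1], the main terms differ by at least [(lam' - lam) / 2]; the errors leave an
    eighth of [lam' - lam]. *)
Lemma gap_arith (lam lam' k A B D D' a b p : R) : 0 < lam -> lam < lam' -> 0 <= k -> k <= 2^-1 ->
  k * (6 * lam' + 6 * lam) <= (lam' - lam) / 8 -> 1 <= p <= 4 ->
  1 - k <= D -> D <= 1 + k -> 1 - k <= D' -> D' <= 1 + k -> 0 <= A <= (lam' - lam) / 16 -> 0 <= B <= (lam' - lam) / 16 ->
  `|a * D - lam * p / 2| <= A -> `|b * D' - lam' * p / 2| <= B -> a + (lam' - lam) / 8 <= b.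
Proof.
move=> l0 ll k0 k2 kl /andP[p1 p4] D1 D2 D1' D2' /andP[A0 A1] /andP[B0 B1].
rewrite !ler_norml => /andP[_ h1] /andP[h2 _].
have lp : lam' - lam <= (lam' - lam) * p by rewrite -[leLHS]mulr1 ler_pM2l//; lra.
have l4 : lam * p <= lam * 4 by rewrite ler_pM2l.
have l4' : lam' * p <= lam' * 4 by rewrite ler_pM2l//; lra.
have l1 : lam <= lam * p by rewrite -[leLHS]mulr1 ler_pM2l.
have l1' : lam' <= lam' * p by rewrite -[leLHS]mulr1 ler_pM2l//; lra.
have ha : a <= lam * p / 2 + A + k * (4 * lam + 2 * A).
  have kk : 0 <= k * (4 * lam + 2 * A) by rewrite mulr_ge0//; lra.
  have [a0|a0] := leP a 0; first lra.
  have e1 : a * (1 - k) <= a * D by rewrite ler_pM2l.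
  have e2 : a * k <= a * 2^-1 by rewrite ler_pM2l.
  have e3 : k * a <= k * (4 * lam + 2 * A) by rewrite ler_wpM2l//; lra.
  lra.
have b0 : 0 <= b.
  rewrite leNgt; apply/negP => b0.
  have : b * D' <= 0 by rewrite mulr_le0_ge0//; clear -b0 k2 D1'; lra.
  lra.
have hb : lam' * p / 2 - B - k * (2 * lam') <= b.
  have e1 : b * D' <= b * (1 + k) by rewrite ler_wpM2l.
  have [bb|bb] := leP b (2 * lam').
    have e3 : k * b <= k * (2 * lam') by rewrite ler_wpM2l.
    lra.
  have : 0 <= k * (2 * lam') by rewrite mulr_ge0//; lra.
  lra.
have : k * A <= k * lam' by rewrite ler_wpM2l//; lra.
lra.
Qed.

Lemma gap_arith_scaled (lam lam' k eps k1' k2' D D' a b x w n : R) (d := lam' - lam) :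
  0 < lam -> lam < lam' -> 0 < k -> k <= 2^-1 -> k * (64 * (lam' + lam)) = d ->
  0 < eps -> eps <= 1 -> 0 <= k1' -> 0 <= k2' -> eps * (32 * (k1' + k2' + 1 + d)) = d ->
  0 < n -> 0 <= w -> 1 - k <= D <= 1 + k -> 1 - k <= D' <= 1 + k ->
  1 <= n * (1 - x) <= 4 -> n * w <= 2 * eps ^+ 2 ->
  `|(1 - a) * D - lam * (1 - x) / 2| <= k1' * w ->
  `|(1 - b) * D' - lam' * (1 - x) / 2| <= k2' * w ->
  b <= a - d / 8 / n.
Proof.
move=> lam0 ll k0 k1 kE eps0 eps1 Kp Kp' epsE n0 w0 /andP[D1 D2] /andP[D1' D2'] pp wn h2 h1.
have d0 : 0 < d by rewrite subr_gt0.
have sc (y t l : R) : `|(1 - y) * t - l * (1 - x) / 2| * n = `|n * (1 - y) * t - l * (n * (1 - x)) / 2|.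
  by rewrite -{1}(gtr0_norm n0) -normrM; congr `|_|; ring.
have h3 := ler_wpM2r (ltW n0) h1; have h4 := ler_wpM2r (ltW n0) h2.
rewrite sc in h3; rewrite sc in h4.
have e2 : 2 * eps ^+ 2 <= 2 * eps.
  by rewrite ler_pM2l// expr2 ler_piMr// ltW.
have g1 : k1' * w * n <= k1' * (2 * eps) by rewrite -mulrA ler_wpM2l//; lra.
have g2 : k2' * w * n <= k2' * (2 * eps) by rewrite -mulrA ler_wpM2l//; lra.
have p1 : 0 <= k1' * eps by rewrite mulr_ge0// ltW.
have p2 : 0 <= k2' * eps by rewrite mulr_ge0// ltW.
have p3 : 0 <= d * eps by rewrite mulr_ge0// ltW.
have := @gap_arith lam lam' k (k1' * (2 * eps)) (k2' * (2 * eps)) D D' (n * (1 - a)) (n * (1 - b)) (n * (1 - x)) lam0 ll (ltW k0) k1.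
rewrite -/d => /(_ _ pp D1 D2 D1' D2' _ _ (le_trans h4 g1) (le_trans h3 g2)) H.
have {H} : n * (1 - a) + d / 8 <= n * (1 - b).
  clear h1 h2 h3 h4 sc wn pp D1 D2 D1' D2' w0 e2 g1 g2.
  by apply: H; [lra|apply/andP; split; lra|apply/andP; split; lra].
move=> H; rewrite -(ler_pM2l n0) mulrBr mulrCA divff ?gt_eqF//; clear -H; lra.
Qed.

(** Here [tau = 0]: the quadratic errors are [O(eps^2 / n)] and a small [eps] makes them negligible
    against the difference [(lam' - lam) / n]. The smaller [lam] has the larger peak modulus, so
    [phi] plays that role. *)
Lemma separated_dilations phi psi zeta v0 M C M' C' lam lam' :
  (forall z, ballN N z -> ballN N (phi z)) ->
  vnorm2 zeta = 1 -> local_form phi zeta v0 M C -> local_form psi zeta v0 M' C' ->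
  vnorm2 v0 = 1 -> 0 < lam ->
  (forall w, cinner (w *m M) v0 = cinner w C + lam%:C * cinner w zeta) ->
  (forall w, cinner (w *m M') v0 = cinner w C' + lam'%:C * cinner w zeta) ->
  lam < lam' -> separated phi psi.
Proof.
move=> phib z1 lf lf' v1 lam0 jl jl' ll.
pose K (c : 'rV[R[i]]_N) l : R := l / 2 + l * (1 + vnorm2 c) / 2 + l ^+ 2 / 4.
have K0 c l : 0 < l -> 0 <= K c l.
  move=> l0; have := vnorm2_ge0 c => c0.
  by rewrite /K !addr_ge0// ?divr_ge0 ?mulr_ge0 ?sqr_ge0 ?addr_ge0// ltW.
have lam'0 : 0 < lam' by exact: lt_trans ll.
have Kp := K0 C lam lam0; have Kp' := K0 C' lam' lam'0.
pose d := lam' - lam; have d0 : 0 < d by rewrite subr_gt0.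
pose eps := d / (32 * (K C lam + K C' lam' + 1 + d)).
have Kd : 0 < 32 * (K C lam + K C' lam' + 1 + d) by lra.
have eps0 : 0 < eps by rewrite divr_gt0.
have epsE : eps * (32 * (K C lam + K C' lam' + 1 + d)) = d by rewrite divfK// gt_eqF.
have eps1 : eps <= 1 by rewrite ler_pdivrMr//; lra.
pose k := d / (64 * (lam' + lam)).
have ll0 : 0 < 64 * (lam' + lam) by lra.
have k0 : 0 < k by rewrite divr_gt0.
have kE : k * (64 * (lam' + lam)) = d by rewrite divfK// gt_eqF.
have k1 : k <= 2^-1 by rewrite /k ler_pdivrMr// /d; lra.
have [P P0 HP] := peak_bounds 0 eps lf z1 v1 lam0 jl.
apply: (separated_of_gap (zeta := zeta) (eta := v0) (eps := eps) (P := P) (D := d / 8)) => //.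
  by rewrite divr_gt0.
near=> m => z zn; have [zb _ pp] := zn.
have m0 : 0 < (m%:R : R) ^+ 2.
  by rewrite exprn_gt0// ltr0n; near: m; exact: nbhs_infty_gt.
have a1 : 1 - P / m%:R ^+ 2 <= cabs2 (peak v0 (phi z)).
  by move: z zn {zb pp}; near: m.
split=> //.
have hD : 1 - k <= cabs2 (1 + cinner (z - zeta) C) <= 1 + k.
  by move: z zn {zb pp a1}; near: m; apply: den_near; clear -k0 k1; lra.
have hD' : 1 - k <= cabs2 (1 + cinner (z - zeta) C') <= 1 + k.
  by move: z zn {zb pp a1 hD}; near: m; apply: den_near; clear -k0 k1; lra.
have [D0 _] := lf z zb; have [D0' _] := lf' z zb.
have := peak_expand lam0 z1 D0; rewrite -(peak_local lf v1 jl zb) -/(K C lam).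
have := peak_expand lam'0 z1 D0'; rewrite -(peak_local lf' v1 jl' zb) -/(K C' lam').
have := near_pt_scaled zn; rewrite vnorm20 mulr0 addr0.
move=> wn h1 h2; have n0 : m%:R ^+ 2 != 0 :> R by rewrite gt_eqF.
have w0 := vnorm2_ge0 (z - zeta).
exact: (gap_arith_scaled lam0 ll k0 k1 kE eps0 eps1 Kp Kp' epsE m0 w0 hD hD' pp wn h2 h1).
Unshelve. all: by end_near. Qed.

End cases.

Section cases2.
Context {R : realType} {N : nat}.
Local Open Scope complex_scope.
Implicit Types (z zeta tau eta C v : 'rV[R[i]]_N) (phi psi : 'rV[R[i]]_N -> 'rV[R[i]]_N) (m eps lam : R).

Lemma cabs2_form_lower tau v w eps : vnorm2 (w - tau) <= eps ^+ 2 ->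
  4 * (eps ^+ 2 * vnorm2 v) <= cabs2 (cinner tau v) ->
  cabs2 (cinner tau v) / 4 <= cabs2 (cinner w v).
Proof.
move=> h1 h2; have := cabs2B_le (cinner w v) (cinner (w - tau) v).
rewrite -cinnerBl opprB addrC subrK.
have := cinner_cauchy (w - tau) v.
have : vnorm2 (w - tau) * vnorm2 v <= eps ^+ 2 * vnorm2 v by rewrite ler_wpM2r// vnorm2_ge0.
lra.
Qed.

Lemma exists_small (K A : R) : 0 <= K -> 0 < A -> exists2 eps : R, 0 < eps <= 1 & eps ^+ 2 * K <= A.
Proof.
move=> K0 A0; pose eps := A / (K + A); have KA : 0 < K + A by lra.
have e0 : 0 < eps by rewrite divr_gt0.
have e1 : eps <= 1 by rewrite ler_pdivrMr//; lra.
exists eps; first by rewrite e0.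
have eE : eps * (K + A) = A by rewrite divfK// gt_eqF.
clearbody eps; have : eps ^+ 2 * K <= eps * K by rewrite ler_wpM2r// expr2 ler_piMl// ltW.
have : 0 <= eps * A by rewrite mulr_ge0 ?(ltW e0) ?(ltW A0).
lra.
Qed.

(** The quotient is [n^2 |dl|^2] for the relative difference [dl] of two peak values. The upper
    bound keeps the [n]-th powers in the linear regime, and the lower one is the separation. *)
Lemma phase_arith (lam s K c S T d d' a A B : R) :
  0 <= lam -> 0 <= s -> s <= 1 -> 0 <= K -> 0 <= c -> 0 <= A -> 0 <= B ->
  1 - 2^-1 <= d -> d <= 1 + 2^-1 -> 1 - 2^-1 <= d' -> d' <= 1 + 2^-1 -> 2^-1 <= a -> a <= 1 ->
  s ^+ 2 * (2 * lam ^+ 2 * K ^+ 2 * c) <= 64^-1 ->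
  s ^+ 2 * A / 4 <= S -> s ^+ 2 * B / 4 <= T -> S <= s ^+ 2 * K -> T <= s ^+ 2 * K * c ->
  lam ^+ 2 / 4 * S * T / (d * d' * a) <= 64^-1 /\
  lam ^+ 2 * (s ^+ 2 * A / 4) * (s ^+ 2 * B / 4) / 16 <= lam ^+ 2 / 4 * S * T / (d * d' * a).
Proof.
move=> l0 s0 s1 K0 c0 A0 B0 d1 d2 d1' d2' a1 a2 Q S1 T1 S2 T2.
have S0 : 0 <= S by apply: le_trans S1; rewrite !mulr_ge0 ?sqr_ge0 ?invr_ge0.
have T0 : 0 <= T by apply: le_trans T1; rewrite !mulr_ge0 ?sqr_ge0 ?invr_ge0.
have dd0 : 0 < d by lra. have dd0' : 0 < d' by lra. have a0 : 0 < a by lra.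
have da : 0 < d * d' * a by rewrite !mulr_gt0.
have L0 : 0 <= lam ^+ 2 by exact: sqr_ge0.
have ST0 : 0 <= lam ^+ 2 * (S * T) by rewrite !mulr_ge0.
split.
  rewrite ler_pdivrMr//.
  have low : 8^-1 <= d * d' * a.
    have -> : 8^-1 = 2^-1 * 2^-1 * 2^-1 :> R by field.
    by rewrite !ler_pM ?invr_ge0 ?mulr_ge0 ?invr_ge0//; clear -d1 d1' a1; lra.
  apply: (@le_trans _ _ (64^-1 * 8^-1)); last by rewrite ler_pM2l ?invr_gt0.
  have : S * T <= s ^+ 2 * K * (s ^+ 2 * K * c) by exact: ler_pM.
  move=> /(ler_wpM2l L0) h.
  have s2 : s ^+ 2 <= 1 by rewrite expr_le1.
  have : s ^+ 2 * (s ^+ 2 * (2 * lam ^+ 2 * K ^+ 2 * c)) <= s ^+ 2 * (2 * lam ^+ 2 * K ^+ 2 * c).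
    by rewrite ler_piMl// !mulr_ge0 ?sqr_ge0.
  lra.
rewrite ler_pdivlMr//.
have h1 : (s ^+ 2 * A / 4) * (s ^+ 2 * B / 4) <= S * T.
  by rewrite ler_pM// !mulr_ge0 ?sqr_ge0 ?invr_ge0.
have up : d * d' * a <= 4.
  have e1 : d * d' <= 2 * 2 by clear -dd0 dd0' d2 d2'; apply: ler_pM; lra.
  have : d * d' * a <= d * d' by rewrite ler_piMr// mulr_ge0// ltW.
  lra.
have X0 : 0 <= lam ^+ 2 * ((s ^+ 2 * A / 4) * (s ^+ 2 * B / 4)).
  by rewrite !mulr_ge0 ?sqr_ge0 ?invr_ge0.
have h2 := ler_wpM2l L0 h1; have h3 := ler_wpM2l X0 up; lra.
Qed.

(* The moduli agree to first order here and the phases of the two peak values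
   differ by a quantity of exact order [m ^- 2]. *)
Lemma separated_denominators phi psi zeta v0 M C M' C' lam tau0 :
  (forall z, ballN N z -> ballN N (phi z)) ->
  vnorm2 zeta = 1 -> local_form phi zeta v0 M C -> local_form psi zeta v0 M' C' ->
  vnorm2 v0 = 1 -> 0 < lam ->
  (forall w, cinner (w *m M) v0 = cinner w C + lam%:C * cinner w zeta) ->
  (forall w, cinner (w *m M') v0 = cinner w C' + lam%:C * cinner w zeta) ->
  Re (cinner tau0 zeta) = 0 -> cinner tau0 zeta != 0 -> cinner tau0 (C - C') != 0 ->
  separated phi psi.
Proof.
move=> phib z1 lf lf' v1 lam0 jl jl' tz tz0 tc0.
pose dC := C - C'.
have t0 := vnorm2_ge0 tau0; have dC0 := vnorm2_ge0 dC.
have [K K0 KE] : exists2 K : R, 0 < K & 2 * (1 + vnorm2 tau0) = K.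
  by exists (2 * (1 + vnorm2 tau0)) => //; lra.
pose Q := 2 * lam ^+ 2 * K ^+ 2 * vnorm2 dC.
have Q0 : 0 <= Q by rewrite /Q !mulr_ge0 ?sqr_ge0// ltW.
(* Shrinking [tau0] by [s] brings [n |dl|] below [1/8], as [cabs2_pow_near1] demands. *)
have [s /andP[s0 s1] sQ] := @exists_small Q 64^-1 Q0 ltac:(by rewrite invr_gt0).
pose A := cabs2 (cinner tau0 zeta); pose B := cabs2 (cinner tau0 dC).
have A0 : 0 < A by rewrite lt0r cabs2_eq0 tz0 cabs2_ge0.
have B0 : 0 < B by rewrite lt0r cabs2_eq0 tc0 cabs2_ge0.
(* [e1] and [e2] keep [<W, zeta>] and [<W, C - C'>] comparable to their values at [tau]; the product
   [e1 e2] serves both. *)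
have [e1 /andP[e10 e11] e1A] := @exists_small 4 A ltac:(by []) A0.
have [e2 /andP[e20 e21] e2B] := @exists_small (4 * vnorm2 dC) B ltac:(by rewrite mulr_ge0) B0.
pose e0 := e1 * e2; have e00 : 0 < e0 by rewrite mulr_gt0.
pose eps := s * e0; pose tau := s%:C *: tau0.
have eps0 : 0 < eps by rewrite mulr_gt0.
have [P P0 HP] := peak_bounds tau eps lf z1 v1 lam0 jl.
exists zeta, v0, None, tau, eps, (expR (- (2 * P)) * (lam ^+ 2 * (s ^+ 2 * A / 4) * (s ^+ 2 * B / 4) / 16 / 4)).
split=> //; first by rewrite /tau cinnerZl ReM/= mul0r subr0 tz mulr0.
have s20 : 0 < s ^+ 2 by rewrite exprn_gt0.
have c00 : 0 < lam ^+ 2 * (s ^+ 2 * A / 4) * (s ^+ 2 * B / 4) / 16 / 4.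
  by rewrite !mulr_gt0 ?invr_gt0 ?exprn_gt0.
split=> //; first by rewrite mulr_gt0 ?expR_gt0.
near=> m => z zn; have [zb zt _] := zn.
have m0 : 0 < (m%:R : R) by rewrite ltr0n; near: m; exact: nbhs_infty_gt.
have n0 : 0 < (m%:R : R) ^+ 2 by rewrite exprn_gt0.
have a1 : 1 - P / m%:R ^+ 2 <= cabs2 (peak v0 (phi z)).
  by move: z zn {zb zt}; near: m.
have hD : 1 - 2^-1 <= cabs2 (1 + cinner (z - zeta) C) <= 1 + 2^-1.
  by move: z zn {zb zt a1}; near: m; apply: den_near; clear; lra.
have hD' : 1 - 2^-1 <= cabs2 (1 + cinner (z - zeta) C') <= 1 + 2^-1.
  by move: z zn {zb zt a1 hD}; near: m; apply: den_near; clear; lra.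
have [D0 _] := lf z zb; have [D0' _] := lf' z zb.
have a2 : cabs2 (peak v0 (phi z)) <= 1 by apply: peak_le1 => //; exact: phib.
have Pn : 2 * P <= m%:R ^+ 2 by rewrite -[leRHS]mul1r; near: m; exact: near_le_sq.
have a3 : 2^-1 <= cabs2 (peak v0 (phi z)).
  by apply: le_trans a1; rewrite lerBrDl -lerBrDr ler_pdivrMr//; clear -Pn; lra.
have pa := peak_local lf v1 jl zb; have pb := peak_local lf' v1 jl' zb.
rewrite /test_fun !mul1r.
move: a1 a2 a3 pa pb; move: (peak v0 (phi z)) (peak v0 (psi z)) => a b a1 a2 a3 pa pb.
have an0 : a != 0 by rewrite -cabs2_eq0 gt_eqF//; clear -a3; lra.
pose W := m%:R%:C *: (z - zeta).
pose S := cinner W zeta; pose T := cinner W dC.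
have Wt : vnorm2 (W - tau) <= eps ^+ 2 by [].
have lowS : s ^+ 2 * A / 4 <= cabs2 S.
  have := @cabs2_form_lower tau zeta W eps Wt; rewrite z1 mulr1 /tau cinnerZl cabs2M cabs2_real.
  apply; rewrite -/A /eps exprMn mulrCA ler_pM2l// (_ : e0 ^+ 2 = e1 ^+ 2 * e2 ^+ 2) ?exprMn//.
  apply: (le_trans _ e1A); rewrite mulrC -mulrA [e2 ^+ 2 * _]mulrC mulrA ler_piMr//.
    by rewrite mulr_ge0// sqr_ge0.
  by rewrite expr_le1// ltW.
have lowT : s ^+ 2 * B / 4 <= cabs2 T.
  have := @cabs2_form_lower tau dC W eps Wt; rewrite /tau cinnerZl cabs2M cabs2_real.
  apply; rewrite -/B /eps exprMn -mulrA mulrCA ler_pM2l// (_ : e0 ^+ 2 = e1 ^+ 2 * e2 ^+ 2) ?exprMn//.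
  apply: (le_trans _ e2B).
  have -> : 4 * (e1 ^+ 2 * e2 ^+ 2 * vnorm2 dC) = e1 ^+ 2 * (e2 ^+ 2 * (4 * vnorm2 dC)) by ring.
  rewrite ler_piMl ?expr_le1 ?(ltW e10)//.
  by rewrite mulr_ge0 ?sqr_ge0// mulr_ge0.
have Wu : vnorm2 W <= s ^+ 2 * K.
  rewrite -(subrK tau W); apply: le_trans (vnorm2D_le _ _) _.
  rewrite /tau vnorm2Z cabs2_real -/tau.
  have : eps ^+ 2 <= s ^+ 2.
    by rewrite /eps exprMn ler_piMr ?sqr_ge0// expr_le1 ?(ltW e00)// /e0 mulr_ile1 ?(ltW e10) ?(ltW e20).
  by rewrite -KE; clear -Wt; lra.
have upS : cabs2 S <= s ^+ 2 * K.
  by apply: le_trans (cinner_cauchy _ _) _; rewrite z1 mulr1.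
have upT : cabs2 T <= s ^+ 2 * K * vnorm2 dC.
  by apply: le_trans (cinner_cauchy _ _) _; rewrite ler_wpM2r.
pose D := 1 + cinner (z - zeta) C; pose D' := 1 + cinner (z - zeta) C'.
(* From [peak_local], [b - a = (lam / 2) <z - zeta, zeta> (D - D') / (D D')], with
   [D - D' = <z - zeta, C - C'>]; dividing by [a] gives [dl]. *)
pose dl := (lam / 2 / m%:R ^+ 2)%:C * S * T / (D * D' * a).
have mC0 : m%:R%:C != 0 :> R[i] by rewrite -cabs2_eq0 cabs2_real gt_eqF.
have ab : b = a * (1 + dl).
  have ST : S * T = (m%:R ^+ 2)%:C * (cinner (z - zeta) zeta * (D - D')).
    rewrite /S /T /W !cinnerZl /dC cinnerBr /D /D' rmorphXn/=; ring.
  have -> : dl = (lam / 2)%:C * cinner (z - zeta) zeta * (D - D') / (D * D' * a).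
    by rewrite /dl -[_ * S * T]mulrA ST mulrA -rmorphM/= divfK ?gt_eqF// mulrA.
  have -> : a * (1 + (lam / 2)%:C * cinner (z - zeta) zeta * (D - D') / (D * D' * a)) =
    a + (lam / 2)%:C * cinner (z - zeta) zeta * (D - D') / (D * D').
    by clear -an0 D0 D0'; field; rewrite an0 D0 D0'.
  by rewrite pb pa -/D -/D'; field; rewrite D0 D0'.
have cd : m%:R ^+ 2 ^+ 2 * cabs2 dl = lam ^+ 2 / 4 * cabs2 S * cabs2 T / (cabs2 D * cabs2 D' * cabs2 a).
  rewrite /dl !cabs2M cabs2V !cabs2M cabs2_real.
  by move: (cabs2 D * _ * _)^-1 => y; field; rewrite gt_eqF.
have [up low] : m%:R ^+ 2 ^+ 2 * cabs2 dl <= 64^-1 /\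
    lam ^+ 2 * (s ^+ 2 * A / 4) * (s ^+ 2 * B / 4) / 16 <= m%:R ^+ 2 ^+ 2 * cabs2 dl.
  rewrite cd; move: hD hD' => /andP[d1 d2] /andP[d1' d2'].
  exact: (phase_arith (ltW lam0) (ltW s0) s1 (ltW K0) dC0 (ltW A0) (ltW B0)
    d1 d2 d1' d2' a3 a2 sQ lowS lowT upS upT).
have -> : a ^+ (m ^ 2) - b ^+ (m ^ 2) = - (a ^+ (m ^ 2) * ((1 + dl) ^+ (m ^ 2) - 1)).
  by rewrite ab exprMn; ring.
rewrite cabs2N cabs2M cabs2X; apply: ler_pM; rewrite ?expR_ge0//.
- exact: ltW c00.
- apply: le_trans (@expr_lower _ (m ^ 2) P P0 _) _; first by rewrite natrX.
  apply: lerXn2r; rewrite ?nnegrE ?cabs2_ge0 ?natrX//.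
  by rewrite subr_ge0 ler_pdivrMr//; clear -Pn P0; lra.
apply: le_trans (@cabs2_pow_near1 _ (m ^ 2) dl (8^-1 / m%:R ^+ 2) _ _ _); rewrite ?natrX.
- by rewrite ler_pM2r ?invr_gt0.
- by rewrite divr_ge0 ?invr_ge0// ltW.
- by rewrite [_ * (_ / _)]mulrC divfK ?gt_eqF// divff ?pnatr_eq0.
- rewrite expr_div_n ler_pdivlMr ?exprn_gt0// mulrC; apply: le_trans up _.
  by rewrite exprVn -natrX.
Unshelve. all: by end_near. Qed.

(** The two peak factors coincide, so the difference is [m <phi z - psi z, e> F^n]. Taking
    [e = tau (M - M')] itself makes the inner product close to [|e|^2], and the common Julia
    relation makes [e] orthogonal to [v0]. *)
Lemma separated_linear_parts phi psi zeta v0 M C M' lam tau :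
  (forall z, ballN N z -> ballN N (phi z)) ->
  vnorm2 zeta = 1 -> local_form phi zeta v0 M C -> local_form psi zeta v0 M' C ->
  vnorm2 v0 = 1 -> 0 < lam ->
  (forall w, cinner (w *m M) v0 = cinner w C + lam%:C * cinner w zeta) ->
  (forall w, cinner (w *m M') v0 = cinner w C + lam%:C * cinner w zeta) ->
  Re (cinner tau zeta) = 0 -> tau *m (M - M') != 0 -> separated phi psi.
Proof.
move=> phib z1 lf lf' v1 lam0 jl jl' tz t0.
pose e := tau *m (M - M').
have e_perp : cinner e v0 = 0 by rewrite /e mulmxBr cinnerBl jl jl' subrr.
have [K K0 HK] := vnorm2_mulmx (M - M').
have e20 : 0 < vnorm2 e by rewrite vnorm2_gt0.
have ve0 : 0 < vnorm2 e ^+ 2 by rewrite exprn_gt0.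
have [eps /andP[eps0 _] epsE] := @exists_small (4 * K * vnorm2 e) (vnorm2 e ^+ 2) ltac:(by rewrite !mulr_ge0// ltW) ve0.
have [P P0 HP] := peak_bounds tau eps lf z1 v1 lam0 jl.
exists zeta, v0, (Some e), tau, eps, (vnorm2 e ^+ 2 / 4 / 2 * expR (- (2 * P))).
split=> //; split=> //; first by rewrite mulr_gt0 ?expR_gt0// !divr_gt0.
near=> m => z zn; have [zb zt _] := zn.
have n0 : 0 < (m%:R : R) ^+ 2 by rewrite exprn_gt0// ltr0n; near: m; exact: nbhs_infty_gt.
have a1 : 1 - P / m%:R ^+ 2 <= cabs2 (peak v0 (phi z)).
  by move: z zn {zb zt}; near: m.
have hD : 1 - 2^-1 <= cabs2 (1 + cinner (z - zeta) C) <= 1 + 2^-1.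
  by move: z zn {zb zt a1}; near: m; apply: den_near; clear; lra.
have Pn : 2 * P <= m%:R ^+ 2 by rewrite -[leRHS]mul1r; near: m; exact: near_le_sq.
have [D0 pz] := lf z zb; have [_ qz] := lf' z zb.
rewrite /test_fun (_ : peak v0 (psi z) = peak v0 (phi z)); last first.
  by rewrite (peak_local lf v1 jl zb) (peak_local lf' v1 jl' zb).
rewrite -mulrBl cabs2M cabs2X -mulrBr -cinnerBl.
have -> : phi z - psi z = (1 + cinner (z - zeta) C)^-1 *: ((z - zeta) *m (M - M')).
  by rewrite pz qz -scalerBr mulmxBr opprD addrACA subrr add0r.
rewrite cinnerZl mulrCA cabs2M cabs2V -cinnerZl scalemxAl.
apply: ler_pM; rewrite ?expR_ge0//.
- by rewrite !divr_ge0// ltW.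
- rewrite [leRHS]mulrC ler_pdivlMr; last by case/andP: hD => hD _; clear -hD; lra.
  have : vnorm2 e ^+ 2 / 4 <= cabs2 (cinner ((m%:R%:C *: (z - zeta)) *m (M - M')) e).
    have -> : vnorm2 e ^+ 2 = cabs2 (cinner e e) by rewrite vnorm2_cinner cabs2_real.
    pose d := m%:R%:C *: (z - zeta) - tau.
    have dE : vnorm2 (m%:R%:C *: (z - zeta) *m (M - M') - e) <= Num.sqrt (eps ^+ 2 * K) ^+ 2.
      rewrite -mulmxBl; apply: le_trans (HK _) _.
      rewrite sqr_sqrtr; last by rewrite mulr_ge0 ?sqr_ge0.
      by rewrite [leRHS]mulrC ler_wpM2l.
    apply: (cabs2_form_lower dE).
    rewrite sqr_sqrtr; last by rewrite mulr_ge0 ?sqr_ge0.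
    rewrite vnorm2_cinner cabs2_real.
    by have := epsE; clear; lra.
  have : 0 < vnorm2 e ^+ 2 / 4 / 2 by rewrite !divr_gt0.
  move: hD => /andP[_ hD] hp hc; apply: le_trans hc.
  by have := ler_wpM2l (ltW hp) hD; clear -hp; lra.
- apply: le_trans (@expr_lower _ (m ^ 2) P P0 _) _; first by rewrite natrX.
  apply: lerXn2r; rewrite ?nnegrE ?cabs2_ge0 ?natrX//.
  by rewrite subr_ge0 ler_pdivrMr//; clear -Pn P0; lra.
Unshelve. all: by end_near. Qed.

Lemma separated_of_neq phi psi :
  linear_fractional_selfmap phi -> linear_fractional_selfmap psi ->
  supnorm phi = 1 -> supnorm psi = 1 -> (exists2 z, ballN N z & phi z != psi z) ->
  separated phi psi.
Proof.
move=> Lphi Lpsi sphi spsi [z0 z0b z0n].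
have phib z : ballN N z -> ballN N (phi z) by case: Lphi => [A [B [Cv [d [_ [_ h]]]]]]; exact: h.
have psib z : ballN N z -> ballN N (psi z) by case: Lpsi => [A [B [Cv [d [_ [_ h]]]]]]; exact: h.
have [zeta [v0 [M [C [z1 lf v1]]]]] := contact_point Lphi sphi.
(* The contact point belongs to [phi]; [psi] is only known to have no pole there, and its value may
   lie inside the ball. *)
have [v0' [M' [C' lf']]] := local_form_of_lfs Lpsi spsi z1.
have [lam lam0 jl] := julia phib z1 lf v1.
have [vE|vN] := eqVneq v0' v0; last exact: (separated_values phib psib z1 lf lf' v1 lam0 jl vN).
rewrite vE in lf'.
have [lam' lam'0 jl'] := julia psib z1 lf' v1.
have [ll|ll|lE] := ltgtP lam lam'.
- exact: (separated_dilations phib z1 lf lf' v1 lam0 jl jl' ll).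
- by apply: separatedC; exact: (separated_dilations psib z1 lf' lf v1 lam'0 jl' jl ll).
rewrite -lE in jl'.
have iz : cinner ('i%C *: zeta) zeta = 'i%C by rewrite cinnerZl vnorm2_cinner z1 mulr1.
have i0 : 'i%C != 0 :> R[i] by rewrite eq_complex/= oner_eq0 andbF.
have [cE|cN] := eqVneq C C'; last first.
  (* The direction must have nonzero imaginary product with [zeta] and be seen by [C - C']. [i zeta]
     does both unless [C - C'] is orthogonal to [zeta], and then adding [C - C'] repairs it. *)
  have [c0|c0] := eqVneq (cinner zeta (C - C')) 0.
    apply: (separated_denominators (tau0 := 'i%C *: zeta + (C - C')) phib z1 lf lf' v1 lam0 jl jl').
    - by rewrite cinnerDl iz (cinnerC zeta) c0 rmorph0 addr0.
    - by rewrite cinnerDl iz (cinnerC zeta) c0 rmorph0 addr0.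
    - rewrite cinnerDl cinnerZl c0 mulr0 add0r vnorm2_cinner -cabs2_eq0 cabs2_real.
      by rewrite sqrf_eq0 vnorm2_eq0 subr_eq0.
  apply: (separated_denominators (tau0 := 'i%C *: zeta) phib z1 lf lf' v1 lam0 jl jl'); rewrite ?iz//.
  by rewrite cinnerZl mulf_neq0.
rewrite -cE in lf' jl'.
have [h1|h1] := eqVneq (('i%C *: zeta) *m (M - M')) 0; last first.
  by apply: (separated_linear_parts phib z1 lf lf' v1 lam0 jl jl' _ h1); rewrite iz.
have h0 : zeta *m (M - M') = 0.
  by move/eqP: h1; rewrite -scalemxAl scaler_eq0 (negbTE i0)/= => /eqP.
(* Now [M - M'] kills [zeta], so the complex tangential part of [z0 - zeta] must be detected;
   otherwise the two maps would agree at [z0]. *)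
pose w := z0 - zeta; pose t := w - cinner w zeta *: zeta.
have tz : cinner t zeta = 0 by rewrite cinnerBl cinnerZl vnorm2_cinner z1 mulr1 subrr.
apply: (separated_linear_parts (tau := t) phib z1 lf lf' v1 lam0 jl jl'); first by rewrite tz.
rewrite /t mulmxBl -scalemxAl h0 scaler0 subr0; apply/negP => /eqP.
rewrite mulmxBr => /eqP; rewrite subr_eq0 => /eqP wM.
move: z0n; have [_ ->] := lf z0 z0b; have [_ ->] := lf' z0 z0b.
by rewrite -/w wM eqxx.
Qed.

End cases2.

(** * Norm estimates and non-compactness *)

Section eps_delta.
Context {R : realType} {N : nat}.
Local Open Scope complex_scope.
Implicit Types (f g : 'rV[R[i]]_N -> R[i]) (z y v : 'rV[R[i]]_N).

Lemma ceps_delta_cst (a : R[i]) z : ceps_delta (fun=> a) z.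
Proof.
move=> e e0; exists 1 => // y _; rewrite subrr.
by rewrite (_ : cabs2 0 = 0)// /cabs2/= expr0n addr0.
Qed.

Lemma ceps_delta_coord (j : 'I_N) z : ceps_delta (fun z => z ord0 j) z.
Proof. by move=> e e0; exists e. Qed.

Lemma ceps_deltaD f g z : ceps_delta f z -> ceps_delta g z -> ceps_delta (fun z => f z + g z) z.
Proof.
move=> hf hg e e0; have e4 : 0 < e / 4 by rewrite divr_gt0.
have [d1 d10 h1] := hf _ e4; have [d2 d20 h2] := hg _ e4.
exists (Num.min d1 d2) => [|y hy]; first by rewrite lt_min d10.
have {}h1 : cabs2 (f z - f y) < e / 4 by apply: h1 => j; have := hy j; rewrite lt_min => /andP[].
have {}h2 : cabs2 (g z - g y) < e / 4 by apply: h2 => j; have := hy j; rewrite lt_min => /andP[].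
rewrite opprD addrACA; apply: le_lt_trans (cabs2D_le _ _) _; lra.
Qed.

Lemma ceps_deltaM f g z : ceps_delta f z -> ceps_delta g z -> ceps_delta (fun z => f z * g z) z.
Proof.
move=> hf hg e e0.
pose K := 2 * cabs2 (f z) + 4 * cabs2 (g z) + 4 + e.
have f0 := cabs2_ge0 (f z); have g0 := cabs2_ge0 (g z).
have K0 : 0 < K by rewrite /K; lra.
have eK : 0 < e / (2 * K) by rewrite divr_gt0// mulr_gt0.
have eE : e / (2 * K) * (2 * K) = e by rewrite divfK// gt_eqF// mulr_gt0.
have eK1 : e / (2 * K) <= 1 by rewrite ler_pdivrMr ?mulr_gt0// /K; lra.
have [d1 d10 h1] := hf _ eK; have [d2 d20 h2] := hg _ eK.
exists (Num.min d1 d2) => [|y hy]; first by rewrite lt_min d10.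
have {}h1 : cabs2 (f z - f y) < e / (2 * K) by apply: h1 => j; have := hy j; rewrite lt_min => /andP[].
have {}h2 : cabs2 (g z - g y) < e / (2 * K) by apply: h2 => j; have := hy j; rewrite lt_min => /andP[].
have -> : f z * g z - f y * g y =
  f z * (g z - g y) + (g z * (f z - f y) - (f z - f y) * (g z - g y)) by ring.
apply: le_lt_trans (cabs2D_le _ _) _.
have := cabs2B_le (g z * (f z - f y)) ((f z - f y) * (g z - g y)); rewrite !cabs2M.
have := cabs2_ge0 (f z - f y); have := cabs2_ge0 (g z - g y).
move: eK eE eK1 h1 h2; move: (cabs2 (f z - _)) (cabs2 (g z - _)) (e / _) => a b c c0 cE c1 ac bc b0 a0.
move: K0 cE; rewrite /K; move: (cabs2 (f z)) (cabs2 (g z)) f0 g0 => p q p0 q0 K0 cE h.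
have x1 : p * b <= p * c by rewrite ler_wpM2l// ltW.
have x2 : q * a <= q * c by rewrite ler_wpM2l// ltW.
have x3 : a * b <= 1 * c by apply: ler_pM => //; lra.
have : 0 < c * (4 + e) by rewrite mulr_gt0//; lra.
nra.
Qed.

Lemma ceps_deltaV f z : f z != 0 -> ceps_delta f z -> ceps_delta (fun z => (f z)^-1) z.
Proof.
move=> fz0 hf e e0.
have f0 : 0 < cabs2 (f z) by rewrite lt0r cabs2_eq0 fz0 cabs2_ge0.
pose c := Num.min (cabs2 (f z) / 4) (e * cabs2 (f z) ^+ 2 / 4).
have c0 : 0 < c by rewrite lt_min !divr_gt0 ?mulr_gt0 ?exprn_gt0.
have [d d0 h] := hf _ c0; exists d => // y /h; rewrite lt_min => /andP[h1 h2].
have := cabs2D_le (f z - f y) (f y); rewrite subrK => h3.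
have fy : cabs2 (f z) / 4 <= cabs2 (f y) by lra.
have fy0 : f y != 0 by rewrite -cabs2_eq0 gt_eqF//; apply: lt_le_trans fy; rewrite divr_gt0.
have -> : (f z)^-1 - (f y)^-1 = - (f z - f y) / (f z * f y) by field; rewrite fz0 fy0.
rewrite cabs2M cabs2N cabs2V cabs2M ltr_pdivrMr; last first.
  by rewrite mulr_gt0// lt0r cabs2_eq0 fy0 cabs2_ge0.
apply: lt_le_trans h2 _.
have -> : e * cabs2 (f z) ^+ 2 / 4 = e * (cabs2 (f z) * (cabs2 (f z) / 4)) by ring.
by rewrite ler_pM2l// ler_pM2l.
Qed.

Lemma ceps_deltaN f z : ceps_delta f z -> ceps_delta (fun z => - f z) z.
Proof.
by move=> hf e e0; have [d d0 h] := hf e e0; exists d => // y /h; rewrite -opprD cabs2N.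
Qed.

Lemma ceps_deltaB f g z : ceps_delta f z -> ceps_delta g z -> ceps_delta (fun z => f z - g z) z.
Proof. by move=> hf /ceps_deltaN hg; exact: ceps_deltaD. Qed.

Lemma ceps_deltaX f n z : ceps_delta f z -> ceps_delta (fun z => f z ^+ n) z.
Proof.
move=> hf; elim: n => [|n IH].
  have -> : (fun z => f z ^+ 0) = (fun=> 1) by apply/funext => y; rewrite expr0.
  exact: ceps_delta_cst.
have -> : (fun z => f z ^+ n.+1) = (fun z => f z * f z ^+ n) by apply/funext => y; rewrite exprS.
exact: ceps_deltaM.
Qed.

Lemma ceps_delta_cinner v z : ceps_delta (fun z => cinner z v) z.
Proof.
rewrite /cinner; elim: (index_enum _) => [|j r IH].
  have -> : (fun z : 'rV[R[i]]_N => \sum_(j <- [::]) z ord0 j * (Re (v ord0 j) -i* Im (v ord0 j))) = (fun=> 0).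
    by apply/funext => y; rewrite big_nil.
  exact: ceps_delta_cst.
have -> : (fun z : 'rV[R[i]]_N => \sum_(j <- j :: r) z ord0 j * (Re (v ord0 j) -i* Im (v ord0 j))) =
  (fun z : 'rV[R[i]]_N => z ord0 j * (Re (v ord0 j) -i* Im (v ord0 j)) +
     \sum_(j <- r) z ord0 j * (Re (v ord0 j) -i* Im (v ord0 j))).
  by apply/funext => y; rewrite big_cons.
apply: ceps_deltaD => //; apply: ceps_deltaM; first exact: ceps_delta_coord.
exact: ceps_delta_cst.
Qed.

Lemma ballN_open z : ballN N z -> exists2 d : R, 0 < d &
  forall y : 'rV_N, (forall j, cabs2 (z ord0 j - y ord0 j) < d) -> ballN N y.
Proof.
move=> zb; pose t := 1 - vnorm2 z; have t0 : 0 < t by rewrite subr_gt0.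
have t1 : t <= 1 by rewrite /t; have := vnorm2_ge0 z; lra.
have N0 : 0 < 1 + N%:R :> R by rewrite ltr_wpDr.
pose d := (t / 4) ^+ 2 / (1 + N%:R).
have d0 : 0 < d by rewrite divr_gt0 ?exprn_gt0 ?divr_gt0.
exists d => // y hy; pose w := y - z.
have wk : vnorm2 w <= (t / 4) ^+ 2.
  apply: (@le_trans _ _ (\sum_(j < N) d)).
    apply: ler_sum => j _; rewrite -cabs2N !mxE opprB; exact: ltW.
  have -> : \sum_(j < N) d = N%:R * d by rewrite sumr_const card_ord mulr_natl.
  by rewrite /d mulrCA ler_piMr ?sqr_ge0// ler_pdivrMr// mul1r lerDr.
have -> : y = w + z by rewrite subrK.
rewrite /ballN/= vnorm2D.
have : Re (cinner w z) <= t / 4.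
  apply: le_of_sq_le; first by rewrite divr_ge0// ltW.
  apply: le_trans (Re_sq_le _) _; apply: le_trans (cinner_cauchy _ _) _.
  by apply: le_trans wk; rewrite ler_piMr ?vnorm2_ge0// ltW.
have : (t / 4) ^+ 2 <= t / 16 by nra.
have tE : vnorm2 z = 1 - t by rewrite /t; ring.
move: (vnorm2 w) wk (Re _) => a wk b; rewrite tE; clearbody t; lra.
Qed.

Lemma eq_ceps_delta f g z : (forall y, ballN N y -> f y = g y) -> ballN N z ->
  ceps_delta g z -> ceps_delta f z.
Proof.
move=> fg zb hg e e0; have [d1 d10 h1] := hg e e0; have [d2 d20 h2] := ballN_open zb.
exists (Num.min d1 d2) => [|y hy]; first by rewrite lt_min d10.
rewrite !fg//; last by apply: h2 => j; have := hy j; rewrite lt_min => /andP[].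
by apply: h1 => j; have := hy j; rewrite lt_min => /andP[].
Qed.

Lemma ceps_delta_lfs phi v z : linear_fractional_selfmap phi -> ballN N z ->
  ceps_delta (fun z => cinner (phi z) v) z.
Proof.
move=> [A [B [Cv [d [h1 [h2 _]]]]]] zb.
pose u := \row_k cinner (delta_mx ord0 k *m A^T) v : 'rV[R[i]]_N.
apply: (@eq_ceps_delta _ (fun z => (cinner z Cv + d)^-1 *
    (\sum_(k < N) z ord0 k * u ord0 k + cinner B v))) => // [y yb|].
  rewrite h2// cinnerZl cinnerDl.
  have -> : y *m A^T = \sum_k y ord0 k *: (delta_mx ord0 k *m A^T).
    rewrite {1}[y]row_sum_delta mulmx_suml.
    by apply: eq_bigr => k _; rewrite scalemxAl.
  congr (_ * (_ + _)); rewrite (big_morph (fun x => cinner x v) (fun a b => cinnerDl a b v) (cinner0l v)).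
  by apply: eq_bigr => k _; rewrite cinnerZl mxE.
have cc b : ceps_delta (fun z : 'rV[R[i]]_N => cinner z Cv + b) z.
  by apply: ceps_deltaD; [exact: ceps_delta_cinner|exact: ceps_delta_cst].
apply: ceps_deltaM; first by apply: ceps_deltaV => //; exact: h1.
apply: ceps_deltaD; last exact: ceps_delta_cst.
have -> : (fun z : 'rV[R[i]]_N => \sum_(k < N) z ord0 k * u ord0 k) =
  (fun z => cinner z (\row_k conjc (u ord0 k))).
  by apply/funext => y; rewrite cinnerE; apply: eq_bigr => k _; rewrite !mxE conjcK.
exact: ceps_delta_cinner.
Qed.

Lemma ceps_delta_test phi eta o m z : linear_fractional_selfmap phi -> ballN N z ->
  ceps_delta (fun z => test_fun eta o m (phi z)) z.
Proof.
move=> Lphi zb; apply: ceps_deltaM.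
  case: o => [e|]; last exact: ceps_delta_cst.
  by apply: ceps_deltaM; [exact: ceps_delta_cst|exact: ceps_delta_lfs].
apply: ceps_deltaX; apply: ceps_deltaM; last exact: ceps_delta_cst.
by apply: ceps_deltaD; [exact: ceps_delta_cst|exact: ceps_delta_lfs].
Qed.

Lemma holomorphic_test (a : R[i]) eta o m :
  holomorphic_on_ball (fun z : 'rV[R[i]]_N => a * test_fun eta o m z).
Proof.
move=> z _; rewrite /cdifferentiable_at.
pose ce (v : 'rV[R[i]]_N) := \row_j conjc (v ord0 j) : 'rV[R[i]]_N.
have cE (v y : 'rV[R[i]]_N) (b : R[i]) : b * cinner y v = \sum_(j < N) y ord0 j * (b *: ce v) ord0 j.
  by rewrite cinnerE mulr_sumr; apply: eq_bigr => j _; rewrite !mxE mulrCA.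
pose e1 : 'rV[R[i]]_N := if o is Some e then (a * (m%:R : R)%:C) *: ce e else 0.
pose b1 := if o is Some e then 0 else a.
have -> : (fun z : 'rV[R[i]]_N => a * test_fun eta o m z) =
  (fun z => (\sum_(j < N) z ord0 j * e1 ord0 j + b1) *
    (\sum_(j < N) z ord0 j * (2^-1 *: ce eta) ord0 j + 2^-1) ^+ (m ^ 2)).
  apply/funext => y; rewrite /test_fun mulrA; congr (_ * _ ^+ _); last first.
    by rewrite -cE /peak mulrDl mul1r addrC mulrC.
  rewrite /e1 /b1; case: (o) => [e|].
    by rewrite addr0 -cE mulrA.
  by rewrite mulr1 big1 ?add0r// => j _; rewrite mxE mulr0.
exact: differentiable_affine_exp.
Qed.

End eps_delta.

(** * Weighted integrals of test functions *)

Section spaces.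
Context {R : realType} {N : nat}.
Local Open Scope complex_scope.
Implicit Types (f g : 'rV[R[i]]_N -> R[i]) (z zeta eta tau : 'rV[R[i]]_N) (x : nat -> R) (a : R).
Let L := rev (iota 0 (2 * N)).
Let uL : uniq L. Proof. by rewrite rev_uniq iota_uniq. Qed.
Let szL : size L = (2 * N)%N. Proof. by rewrite size_rev size_iota. Qed.

Lemma vnorm2_of_coords_rev x : vnorm2 (of_coords N x) = rdot L x x.
Proof. by rewrite vnorm2_of_coords; apply: perm_rdot; rewrite perm_sym perm_rev. Qed.

Lemma Re_cinner_of_coords_rev x v : Re (cinner (of_coords N x) v) = rdot L x (coords v).
Proof.
rewrite -{1}(coordsK v) Re_cinner_of_coords; apply: perm_rdot.
by rewrite perm_sym perm_rev.
Qed.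

Lemma rdot_coords_rev (u v : 'rV[R[i]]_N) : rdot L (coords u) (coords v) = Re (cinner u v).
Proof. by rewrite -Re_cinner_of_coords_rev coordsK. Qed.

Lemma vol_int_slices (G : 'rV[R[i]]_N -> \bar R) :
  vol_int G = slices L (fun x => G (of_coords N x)) (fun=> 0).
Proof. exact: iint_slices. Qed.

(** [T] moves the evaluation point: it is the identity for the Bergman norms and the projection to a
    sphere of radius [r] for the Hardy norm. *)
Definition weighted_int (T : (nat -> R) -> nat -> R) (wt : (nat -> R) -> R) f : \bar R :=
  slices L (fun x => (if vnorm2 (of_coords N x) < 1 then
    cabs2 (f (of_coords N (T x))) * wt x else 0)%:E) (fun=> 0).

Definition ball_pow a x : R := (1 - vnorm2 (of_coords N x)) `^ a.

Lemma ball_pow_ge0 a x : 0 <= ball_pow a x. Proof. exact: powR_ge0. Qed.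

Lemma weighted_int_triangle T wt f1 f2 g : (forall x, 0 <= wt x) ->
  (forall f, (forall z, ballN N z -> ceps_delta f z) ->
     coord_measurable (fun x => (if vnorm2 (of_coords N x) < 1 then
       cabs2 (f (of_coords N (T x))) * wt x else 0)%:E)) ->
  (forall z, ballN N z -> ceps_delta (fun z => f1 z - g z) z) ->
  (forall z, ballN N z -> ceps_delta (fun z => f2 z - g z) z) ->
  (weighted_int T wt (fun z => (f1 z - f2 z)%R) <=
    2%:E * weighted_int T wt (fun z => (f1 z - g z)%R) +
    2%:E * weighted_int T wt (fun z => (f2 z - g z)%R))%E.
Proof.
move=> wt0 ms c1 c2; rewrite /weighted_int.
set G1 := fun x => _ : \bar R.
set G2 := fun x => (if _ then cabs2 (f1 _ - g _) * _ else 0)%:E.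
set G3 := fun x => (if _ then cabs2 (f2 _ - g _) * _ else 0)%:E.
have g0 (F : 'rV[R[i]]_N -> R[i]) x : (0 <= (if vnorm2 (of_coords N x) < 1 then
    cabs2 (F (of_coords N (T x))) * wt x else 0)%:E)%E.
  by rewrite lee_fin; case: ifP => // _; rewrite mulr_ge0 ?cabs2_ge0.
have m2 : coord_measurable G2 by exact: (ms (fun z => f1 z - g z) c1).
have m3 : coord_measurable G3 by exact: (ms (fun z => f2 z - g z) c2).
have s0 (F : (nat -> R) -> \bar R) : (forall x, 0 <= F x)%E -> forall x, (0 <= 2%:E * F x)%E.
  by move=> F0 x; rewrite mule_ge0.
have sm (F : (nat -> R) -> \bar R) : coord_measurable F -> coord_measurable (fun x => 2%:E * F x)%E.
  by move=> mF d Y u mu0; apply: measurable_funeM; exact: mF.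
have pt (F G : (nat -> R) -> \bar R) : F = G -> F (fun=> 0) = G (fun=> 0) by move=> ->.
rewrite -(pt _ _ (slicesZl L (ler0n R 2) (g0 (fun z => f1 z - g z)) m2)).
rewrite -(pt _ _ (slicesZl L (ler0n R 2) (g0 (fun z => f2 z - g z)) m3)).
have E := @slicesD R L (fun x => 2%:E * G2 x)%E (fun x => 2%:E * G3 x)%E
  (s0 _ (g0 (fun z => f1 z - g z))) (sm _ m2) (s0 _ (g0 (fun z => f2 z - g z))) (sm _ m3).
rewrite -(pt _ _ E).
apply: le_slices; [exact: (g0 (fun z => f1 z - f2 z))| |].
  by move=> x; rewrite adde_ge0//; [apply: (s0 _ (g0 (fun z => f1 z - g z)))|apply: (s0 _ (g0 (fun z => f2 z - g z)))].
move=> y _; rewrite /G1 /G2 /G3 -!EFinM -EFinD lee_fin; case: ifP => _; last by rewrite !mulr0 addr0.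
set p := of_coords N _; have := cabs2B_le (f1 p - g p) (f2 p - g p).
have -> : f1 p - g p - (f2 p - g p) = f1 p - f2 p by ring.
by move=> h; have := ler_wpM2r (wt0 y) h; lra.
Qed.

Lemma measurable_ball_ind d (Y : measurableType d) (u : nat -> Y -> R) :
  (forall k, measurable_fun setT (u k)) ->
  measurable_fun setT (fun t => vnorm2 (of_coords N (fun k => u k t)) < 1).
Proof.
move=> mu0; have -> : (fun t => vnorm2 (of_coords N (fun k => u k t)) < 1) =
  (fun t => rdot L (fun k => u k t) (fun k => u k t) < 1).
  by apply/funext => t; rewrite vnorm2_of_coords_rev.
exact: measurable_fun_ltr (measurable_rdot L mu0 mu0) (measurable_cst _).
Qed.

Lemma coord_measurable_ball_weight f a : (forall z, ballN N z -> ceps_delta f z) ->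
  coord_measurable (fun x => (if vnorm2 (of_coords N x) < 1 then
       cabs2 (f (of_coords N x)) * ball_pow a x else 0)%:E).
Proof.
move=> cf.
have -> : (fun x => (if vnorm2 (of_coords N x) < 1 then
       cabs2 (f (of_coords N x)) * ball_pow a x else 0)%:E) =
  (fun x => (if vnorm2 (of_coords N x) < 1 then
       (if vnorm2 (of_coords N x) < 1 then cabs2 (f (of_coords N x)) else 0) *
         (1 - rdot L x x) `^ a else 0)%:E).
  by apply/funext => x; rewrite /ball_pow vnorm2_of_coords_rev; case: ifP.
apply: coord_measurable_if => d Y u mu0; split; first exact: measurable_ball_ind.
by apply: measurable_funM; [exact: measurable_ceps_delta|exact: measurable_gap_powR].
Qed.

Lemma powR_window a (m t : R) : 0 < m -> 1 <= m ^+ 2 * t <= 4 ->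
  Num.min 1 (4 `^ a) * (m ^+ 2) `^ (- a) <= t `^ a.
Proof.
move=> m0 /andP[t1 t4]; have n0 : 0 < m ^+ 2 by rewrite exprn_gt0.
have -> : t `^ a = (m ^+ 2 * t) `^ a * (m ^+ 2) `^ (- a).
  rewrite powRM; [|exact: ltW|]; last first.
    by rewrite ltW// -(pmulr_rgt0 _ n0) (lt_le_trans _ t1).
  by rewrite mulrAC powRN divff ?mul1r// gt_eqF// powR_gt0.
rewrite ler_wpM2r ?powR_ge0//; rewrite ge_min; have [a0|a0] := leP 0 a.
  by apply/orP; left; rewrite -[leLHS](congr1 (fun F => F a) (powR1 R)); apply: ge0_ler_powR; rewrite ?nnegrE//; lra.
by apply/orP; right; apply: le0_ger_powR; lra.
Qed.

Lemma near_pt_coords zeta tau eps m x : vnorm2 (of_coords N x) < 1 ->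
  rdot L (fun i => m * (x i - coords zeta i) - coords tau i)
         (fun i => m * (x i - coords zeta i) - coords tau i) <= eps ^+ 2 ->
  1 <= m ^+ 2 * (1 - vnorm2 (of_coords N x)) <= 4 ->
  near_pt zeta tau eps m (of_coords N x).
Proof.
move=> xb h1 h2; split=> //; move: h1; rewrite -vnorm2_of_coords_rev.
by rewrite of_coordsB of_coordsZ of_coordsB !coordsK.
Qed.

Lemma weighted_int_lower a zeta tau (eps : R) : vnorm2 zeta = 1 -> Re (cinner tau zeta) = 0 ->
  0 < eps -> exists2 c : R, 0 < c & \forall m \near \oo, forall f (w : R), 0 <= w ->
    (forall z, ballN N z -> ceps_delta f z) ->
    (forall z, near_pt zeta tau eps m%:R z -> w <= cabs2 (f z)) ->
    ((w * c * ((m%:R : R)^-1 ^+ (2 * N).-1 * (m%:R ^+ 2) `^ (- a) / m%:R ^+ 2))%:E <=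
      weighted_int id (ball_pow a) f)%E.
Proof.
move=> z1 tz eps0.
have h1 : rdot L (coords zeta) (coords zeta) = 1 by rewrite rdot_coords_rev Re_cinner_self.
have t0 : rdot L (coords tau) (coords zeta) = 0 by rewrite rdot_coords_rev.
have [c [m0 [c0 m01 H]]] := slices_lb_ball (fun=> 0) uL h1 t0 eps0.
pose k : R := Num.min 1 (4 `^ a).
have k0 : 0 < k by rewrite lt_min ltr01 powR_gt0.
exists (k * c); first by rewrite mulr_gt0.
near=> m => f w w0 cf fw.
have mm : m0 <= m%:R by near: m; exact: nbhs_infty_ger.
have mp : 0 < m%:R :> R by lra.
have := H m%:R (w * k * (m%:R ^+ 2) `^ (- a)) (fun x => (if vnorm2 (of_coords N x) < 1 then
    cabs2 (f (of_coords N (id x))) * ball_pow a x else 0)%:E) mm.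
rewrite szL => {}H.
have -> : w * (k * c) * (m%:R^-1 ^+ (2 * N).-1 * (m%:R ^+ 2) `^ (- a) / m%:R ^+ 2) =
  w * k * (m%:R ^+ 2) `^ (- a) * c * m%:R^-1 ^+ (2 * N).-1 / m%:R ^+ 2 by ring.
apply: H.
- by rewrite !mulr_ge0 ?powR_ge0// ltW.
- by move=> x; rewrite lee_fin; case: ifP => // _; rewrite mulr_ge0 ?cabs2_ge0 ?ball_pow_ge0.
- exact: coord_measurable_ball_weight.
- move=> x; rewrite -vnorm2_of_coords_rev => x1 xn xw; rewrite lee_fin x1 -mulrA.
  apply: ler_pM => //; first by rewrite mulr_ge0 ?powR_ge0// ltW.
    by apply: fw; exact: near_pt_coords.
  exact: powR_window.
Unshelve. all: by end_near. Qed.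

Lemma weighted_int_upper a eta : -1 < a -> vnorm2 eta = 1 ->
  exists2 C : R, 0 <= C & forall m f (B : R), (0 < m)%N -> 0 <= B ->
    (forall z, ballN N z ->
       cabs2 (f z) <= B * expR (- ((m%:R : R) ^+ 2 / 4 * (1 - Re (cinner z eta))))) ->
    (weighted_int id (ball_pow a) f <=
      (B * C * ((m%:R : R)^-1 ^+ (2 * N).-1 * (m%:R ^+ 2) `^ (- a) / m%:R ^+ 2))%:E)%E.
Proof.
move=> a1 e1.
have h1 : rdot L (coords eta) (coords eta) = 1 by rewrite rdot_coords_rev Re_cinner_self.
have [C C0 H] := slices_peak_ball (fun=> 0) uL a1 h1.
exists C => // m f B m0 B0 fB.
have m1 : 1 <= m%:R :> R by rewrite ler1n.
have P0 m' x : (0 <= (if rdot L x x < 1 then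
      expR (- (m' ^+ 2 / 4 * (1 - rdot L x (coords eta)))) * (1 - rdot L x x) `^ a else 0)%:E)%E.
  by rewrite lee_fin; case: ifP => // _; rewrite mulr_ge0 ?expR_ge0 ?powR_ge0.
have mP : coord_measurable (fun x => (if rdot L x x < 1 then
      expR (- (m%:R ^+ 2 / 4 * (1 - rdot L x (coords eta)))) * (1 - rdot L x x) `^ a else 0)%:E).
  exact: measurable_peak_weight.
have := H m%:R m1; rewrite szL.
move=> /(lee_wpmul2l (_ : (0 <= B%:E)%E)); rewrite lee_fin => /(_ B0) {}H.
have -> : B * C * (m%:R^-1 ^+ (2 * N).-1 * (m%:R ^+ 2) `^ (- a) / m%:R ^+ 2) =
  B * (C * m%:R^-1 ^+ (2 * N).-1 * (m%:R ^+ 2) `^ (- a) / m%:R ^+ 2) by ring.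
rewrite EFinM; apply: le_trans H.
have pt (F G : (nat -> R) -> \bar R) : F = G -> F (fun=> 0) = G (fun=> 0) by move=> ->.
rewrite -(pt _ _ (slicesZl L B0 (P0 m%:R) mP)).
apply: le_slices.
- by move=> x; rewrite lee_fin; case: ifP => // _; rewrite mulr_ge0 ?cabs2_ge0 ?ball_pow_ge0.
- by move=> x; rewrite mule_ge0.
move=> y _; rewrite -EFinM lee_fin /ball_pow -vnorm2_of_coords_rev; case: ifP => [yb|_]; last by rewrite mulr0.
by rewrite mulrA ler_wpM2r ?powR_ge0// -Re_cinner_of_coords_rev; exact: fB.
Qed.

End spaces.

(** * From separation to non-compactness *)

Section noncompact.
Context {R : realType} {N : nat}.
Local Open Scope complex_scope.
Implicit Types (f g : 'rV[R[i]]_N -> R[i]) (phi psi : 'rV[R[i]]_N -> 'rV[R[i]]_N) (z zeta eta tau : 'rV[R[i]]_N).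

(* [rho m] is the order of magnitude of the squared norm of the [m]-th test function. *)
Lemma not_compact_diff (inH : ('rV[R[i]]_N -> R[i]) -> Prop) (nrm2 : ('rV[R[i]]_N -> R[i]) -> \bar R)
    (rho : nat -> R) phi psi :
  (forall f, inH f <-> holomorphic_on_ball f /\ (nrm2 f < +oo)%E) ->
  (forall f1 f2 g,
     (forall z, ballN N z -> ceps_delta (fun z => f1 z - g z) z) ->
     (forall z, ballN N z -> ceps_delta (fun z => f2 z - g z) z) ->
     (nrm2 (fun z => (f1 z - f2 z)%R) <=
      2%:E * nrm2 (fun z => (f1 z - g z)%R) + 2%:E * nrm2 (fun z => (f2 z - g z)%R))%E) ->
  (forall eta, vnorm2 eta = 1 -> exists2 C : R, 0 <= C & forall m f (B : R), (0 < m)%N -> 0 <= B ->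
     (forall z, ballN N z ->
        cabs2 (f z) <= B * expR (- ((m%:R : R) ^+ 2 / 4 * (1 - Re (cinner z eta))))) ->
     (nrm2 f <= (B * C * rho m)%:E)%E) ->
  (forall zeta tau (eps : R), vnorm2 zeta = 1 -> Re (cinner tau zeta) = 0 -> 0 < eps ->
     exists2 c : R, 0 < c & \forall m \near \oo, forall f (w : R), 0 <= w ->
       (forall z, ballN N z -> ceps_delta f z) ->
       (forall z, near_pt zeta tau eps m%:R z -> w <= cabs2 (f z)) ->
       ((w * c * rho m)%:E <= nrm2 f)%E) ->
  (forall m, (0 < m)%N -> 0 < rho m) ->
  (forall K : R, \forall m \near \oo, K * rho m <= 1) ->
  linear_fractional_selfmap phi -> linear_fractional_selfmap psi ->
  separated phi psi -> ~ compact_diff inH nrm2 phi psi.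
Proof.
move=> inHE tri up lo rho0 rholim Lphi Lpsi.
move=> [zeta [eta [ob [tau [eps [c0 [z1 e1 oe tz [eps0 c00 sep]]]]]]]] cpt.
have phib z : ballN N z -> ballN N (phi z) by case: Lphi => [A [B [Cv [d [_ [_ h]]]]]]; exact: h.
have psib z : ballN N z -> ballN N (psi z) by case: Lpsi => [A [B [Cv [d [_ [_ h]]]]]]; exact: h.
have [C' C'0 HC'] := test_fun_le e1 oe.
have [C C0 HC] := up eta e1.
have [c cp Hlo] := lo zeta tau eps z1 tz eps0.
pose a m := (Num.sqrt (rho m)^-1)%:C.
have aE m : (0 < m)%N -> cabs2 (a m) = (rho m)^-1.
  by move=> m0; rewrite cabs2_real sqr_sqrtr// invr_ge0 ltW// rho0.
(* The shift to [n.+1] avoids the exponent [0], where nothing is known about [rho]. *)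
pose F n z := a n.+1 * test_fun eta ob n.+1 z.
have FE n z : ballN N z -> cabs2 (F n z) <=
    (rho n.+1)^-1 * C' * expR (- ((n.+1%:R : R) ^+ 2 / 4 * (1 - Re (cinner z eta)))).
  move=> zb; rewrite cabs2M aE// -mulrA ler_wpM2l ?invr_ge0 ?(ltW (rho0 _ _))//.
  by apply: HC'; exact: ltW.
have rC n : 0 <= (rho n.+1)^-1 * C' by rewrite mulr_ge0// invr_ge0 ltW// rho0.
have nF n : (nrm2 (F n) <= (C' * C)%:E)%E.
  have -> : C' * C = (rho n.+1)^-1 * C' * C * rho n.+1 by field; rewrite gt_eqF// rho0.
  by apply: HC => // z; exact: FE.
have inF n : inH (F n).
  apply/inHE; split; first exact: holomorphic_test.
  by apply: le_lt_trans (nF n) _; rewrite ltry.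
have [s [g [s_incr [/inHE [gh _] Hs]]]] := cpt F (C' * C) inF nF.
have s_ge n : (n <= s n)%N by elim: n => // n IH; apply: leq_ltn_trans IH (s_incr n).
pose G n z := F (s n) (phi z) - F (s n) (psi z).
have cFg n z : ballN N z -> ceps_delta (fun z => F (s n) (phi z) - F (s n) (psi z)) z.
  by move=> zb; apply: ceps_deltaB;
    (apply: ceps_deltaM; [exact: ceps_delta_cst|exact: ceps_delta_test]).
have cG n z : ballN N z -> ceps_delta (fun z => G n z - g z) z.
  by move=> zb; apply: ceps_deltaB; [exact: cFg|exact: holomorphic_eps_delta].
(* Closeness to [g] will give at most [4 e = c0 c / 8], against a lower bound [c0 c / 4]. *)
pose e := c0 * c / 32; have e0 : 0 < e by rewrite divr_gt0// mulr_gt0.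
have [k _ Hk] := Hs e e0.
pose B := 4 * ((rho (s k).+1)^-1 * C').
have GB z : ballN N z -> cabs2 (G k z) <= B.
  have Fle y : ballN N y -> cabs2 (F (s k) y) <= (rho (s k).+1)^-1 * C'.
    move=> yb; apply: le_trans (FE _ _ yb) _; rewrite ler_piMr// -[leRHS]expR0 ler_expR.
    rewrite oppr_le0 mulr_ge0 ?divr_ge0 ?sqr_ge0// subr_ge0.
    by apply: Re_cinner_le; rewrite ?e1//; exact: ltW.
  move=> zb; apply: le_trans (cabs2B_le _ _) _.
  have := Fle _ (phib _ zb); have := Fle _ (psib _ zb); rewrite /B; clear; lra.
have B0 : 0 <= B by rewrite /B mulr_ge0.
have [m1 _ Hm1] : \forall m \near \oo,
    (forall z, near_pt zeta tau eps m%:R z ->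
      c0 <= cabs2 (test_fun eta ob m (phi z) - test_fun eta ob m (psi z))) /\
    (forall f (w : R), 0 <= w -> (forall z, ballN N z -> ceps_delta f z) ->
       (forall z, near_pt zeta tau eps m%:R z -> w <= cabs2 (f z)) ->
       ((w * c * rho m)%:E <= nrm2 f)%E) /\ 4 * B / c0 * rho m <= 1.
  near=> m; split; first by near: m.
  by split; near: m; [exact: Hlo|exact: rholim].
(* Beyond [k] for closeness to [g], and beyond [m1] so that [|G k|^2 <= B] is at most a quarter of
   [c0 / rho m]; [n <= s n] passes this to the subsequence. *)
pose n := maxn k m1; pose m := (s n).+1.
have mm1 : (m1 <= m)%N.
  by apply: leq_trans (leq_maxr k m1) _; apply: leq_trans (s_ge n) _; exact: leqnSn.
have [h1 [h2 h3]] := Hm1 m mm1.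
have r0 : 0 < rho m by exact: rho0.
have low z : near_pt zeta tau eps m%:R z -> c0 / 4 / rho m <= cabs2 (G n z - G k z).
  move=> zn; have zb : ballN N z by case: zn.
  have := cabs2D_le (G n z - G k z) (G k z); rewrite subrK => hG.
  have : c0 / rho m <= cabs2 (G n z).
    rewrite /G /F -mulrBr cabs2M aE// mulrC ler_wpM2l ?invr_ge0 ?(ltW r0)//.
    exact: h1.
  have := GB z zb => hB hn.
  have : B <= c0 / 4 / rho m.
    rewrite ler_pdivlMr// ler_pdivlMr// -[leRHS]mul1r.
    move: h3; rewrite mulrAC ler_pdivrMr//; clear; lra.
  have E : c0 / rho m = 4 * (c0 / 4 / rho m) by field; rewrite gt_eqF.
  rewrite E in hn; move: (c0 / 4 / rho m) hn => y hn hy; clear -hG hB hn hy; lra.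
have cGG z : ballN N z -> ceps_delta (fun z => G n z - G k z) z.
  by move=> zb; apply: ceps_deltaB; exact: cFg.
have w0 : 0 <= c0 / 4 / rho m by rewrite !divr_ge0// ltW.
have L := h2 _ _ w0 cGG low.
have U := tri (G n) (G k) g (cG n) (cG k).
have := le_trans L U.
have kn : (k <= n)%N by exact: leq_maxl.
have g1 : (nrm2 (fun z => (G n z - g z)%R) < e%:E)%E by exact: Hk.
have g2 : (nrm2 (fun z => (G k z - g z)%R) < e%:E)%E by exact: (Hk k (leqnn k)).
have : (2%:E * nrm2 (fun z => (G n z - g z)%R) + 2%:E * nrm2 (fun z => (G k z - g z)%R) <=
   2%:E * e%:E + 2%:E * e%:E)%E.
  have two0 : (0 <= 2%:E :> \bar R)%E by rewrite lee_fin.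
  exact: (leeD (lee_wpmul2l two0 (ltW g1)) (lee_wpmul2l two0 (ltW g2))).
move=> h /le_trans/(_ h); rewrite -!EFinM -EFinD lee_fin.
have -> : c0 / 4 / rho m * c * rho m = c0 * c / 4 by field; rewrite gt_eqF.
rewrite /e; have := mulr_gt0 c00 cp; clear; lra.
Unshelve. all: by end_near. Qed.

End noncompact.

(** * The Bergman and Hardy norms *)

Section norms.
Context {R : realType} {N : nat}.
Local Open Scope complex_scope.
Implicit Types (f g : 'rV[R[i]]_N -> R[i]) (z zeta eta tau : 'rV[R[i]]_N) (x : nat -> R) (a r : R).
Let L := rev (iota 0 (2 * N)).
Let uL : uniq L. Proof. by rewrite rev_uniq iota_uniq. Qed.
Let szL : size L = (2 * N)%N. Proof. by rewrite size_rev size_iota. Qed.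

(** Finiteness is the covering by caps. Positivity is the lower bound over the test region applied
    to the constant function [1], which is why a unit vector is required. *)
Lemma ball_pow_integral a zeta : -1 < a -> vnorm2 zeta = 1 ->
  exists2 V : R, 0 < V & slices L (fun x => (if vnorm2 (of_coords N x) < 1 then
    @ball_pow R N a x else 0)%:E) (fun=> 0) = V%:E.
Proof.
move=> a1 z1; set I := slices _ _ _.
have [W [_ HW]] := ball_weight_finite (fun=> 0) uL a1.
have IW : (I <= W%:E)%E.
  apply: le_trans HW; rewrite le_eqVlt; apply/orP; left; apply/eqP.
  by congr (slices L _ _); apply/funext => x; rewrite /ball_pow vnorm2_of_coords_rev.
have [c c0 [m0 _ H]] := @weighted_int_lower R N a zeta 0 1 z1 (congr1 (@Re R) (cinner0l zeta)) ltr01.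
have := H m0.+1 (leqnSn m0) (fun=> 1) 1 ler01.
have -> : @weighted_int R N id (@ball_pow R N a) (fun=> 1) = I.
  by congr (slices L _ _); apply/funext => x; rewrite /cabs2/= expr1n expr0n addr0 mul1r.
move=> /(_ (fun z _ => ceps_delta_cst 1 z)) h.
have {}h : (0%:E < I)%E.
  apply: lt_le_trans (h _); last by move=> z _; rewrite /cabs2/= expr1n expr0n addr0.
  by rewrite lte_fin mul1r !mulr_gt0 ?invr_gt0 ?exprn_gt0 ?powR_gt0 ?invr_gt0 ?exprn_gt0 ?ltr0n.
have If : I \is a fin_num.
  by rewrite ge0_fin_numE ?(ltW h)//; apply: le_lt_trans IW _; rewrite ltry.
by exists (fine I); rewrite ?fineK// fine_gt0// h/= -ge0_fin_numE// ltW.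
Qed.

(** The volume of the ball is the case of exponent [0]. As it is finite and positive, neither [fine]
    nor the inverse in the normalization takes a default value. *)
Lemma nu_intE zeta : vnorm2 zeta = 1 -> exists2 k : R, 0 < k &
  forall G : 'rV[R[i]]_N -> R, (forall z, 0 <= G z) -> nu_int (fun z => (G z)%:E) =
    (k%:E * slices L (fun x => (if vnorm2 (of_coords N x) < 1 then G (of_coords N x) else 0)%:E) (fun=> 0%R))%E.
Proof.
move=> z1; have [V V0 HV] := @ball_pow_integral 0 zeta (ltrN10 R) z1.
have volE : vol_int (fun z : 'rV[R[i]]_N => (ball_ind z)%:E) = V%:E.
  rewrite vol_int_slices -HV; congr (slices L _ _); apply/funext => x.
  by rewrite /ball_ind /ball_pow powRr0.
exists V^-1; rewrite ?invr_gt0// => G G0.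
rewrite /nu_int volE /= vol_int_slices muleC; congr (_ * slices L _ _)%E.
by apply/funext => x; rewrite -EFinM /ball_ind; case: ifP; rewrite ?mul1r ?mul0r.
Qed.

Lemma A2norm2E a zeta : -1 < a -> vnorm2 zeta = 1 -> exists2 k : R, 0 < k &
  forall f, A2norm2 a f = (k%:E * weighted_int id (@ball_pow R N a) f)%E.
Proof.
move=> a1 z1; have [k k0 Hk] := nu_intE z1.
have [W W0 HW] := @ball_pow_integral a zeta a1 z1.
exists (k * (k * W)^-1); first by rewrite mulr_gt0 ?invr_gt0 ?mulr_gt0.
move=> f; rewrite /A2norm2 (Hk (fun z => cabs2 (f z) * bweight a z)); last first.
  by move=> z; rewrite mulr_ge0 ?cabs2_ge0 ?powR_ge0.
rewrite (Hk (bweight a)); last by move=> z; exact: powR_ge0.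
rewrite -[X in (fine (_ * X))]/(slices L (fun x => (if vnorm2 (of_coords N x) < 1 then
    @ball_pow R N a x else 0)%:E) (fun=> 0)) HW /=.
by rewrite -muleA [X in (k%:E * X)%E]muleC muleA -EFinM.
Qed.

Theorem A2_not_compact a phi psi : (0 < N)%N -> -1 < a ->
  linear_fractional_selfmap phi -> linear_fractional_selfmap psi -> separated phi psi ->
  ~ compact_diff (@in_A2 R N a) (@A2norm2 R N a) phi psi.
Proof.
move=> N0 a1 Lphi Lpsi sep; have [zeta [_ [_ [_ [_ [_ [z1 _ _ _ _]]]]]]] := sep.
have [k k0 Hk] := A2norm2E a1 z1.
have k00 : (0 <= k%:E)%E by rewrite lee_fin ltW.
apply: (@not_compact_diff R N _ _ (fun m => (m%:R : R)^-1 ^+ (2 * N).-1 * (m%:R ^+ 2) `^ (- a) / m%:R ^+ 2)) => //.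
- move=> f1 f2 g c1 c2; rewrite !Hk !(muleCA 2%:E) -muleDr//; last first.
    by rewrite ge0_adde_def// inE mule_ge0// slices_ge0// => x; rewrite lee_fin; case: ifP => // _;
      rewrite mulr_ge0 ?cabs2_ge0 ?ball_pow_ge0.
  rewrite lee_wpmul2l//; apply: weighted_int_triangle => //; first exact: ball_pow_ge0.
  by move=> f cf; exact: coord_measurable_ball_weight.
- move=> eta e1; have [C C0 HC] := weighted_int_upper a1 e1.
  exists (k * C) => [|m f B m0 B0 fB]; first by rewrite mulr_ge0// ltW.
  rewrite Hk; apply: le_trans (lee_wpmul2l k00 (HC m f B m0 B0 fB)) _.
  by rewrite -EFinM lee_fin le_eqVlt; apply/orP; left; apply/eqP; ring.
- move=> z tau eps z1' tz eps0; have [c c0 Hc] := @weighted_int_lower R N a z tau eps z1' tz eps0.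
  exists (k * c) => [|]; first by rewrite mulr_gt0.
  apply: filterS Hc => m Hm f w w0 cf fw.
  rewrite Hk; apply: le_trans (lee_wpmul2l k00 (Hm f w w0 cf fw)).
  by rewrite -EFinM lee_fin le_eqVlt; apply/orP; left; apply/eqP; ring.
- move=> m m0; rewrite !mulr_gt0 ?invr_gt0 ?exprn_gt0 ?powR_gt0 ?invr_gt0 ?exprn_gt0 ?ltr0n//.
- move=> K; near=> m.
  have m1 : 1 <= m%:R :> R by rewrite ler1n; near: m; exact: nbhs_infty_gt.
  have Km : K <= m%:R by near: m; exact: nbhs_infty_ger.
  have m0 : 0 < m%:R :> R by lra.
  have r0 : 0 <= m%:R^-1 ^+ (2 * N).-1 * (m%:R ^+ 2) `^ (- a) / m%:R ^+ 2 :> R.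
    by rewrite !mulr_ge0 ?powR_ge0 ?invr_ge0 ?exprn_ge0 ?invr_ge0.
  apply: le_trans (ler_wpM2r r0 Km) _.
  have -> : (2 * N).-1 = (2 * N).-2.+1 by case: (N) N0 => // n _; rewrite mulnS.
  (* One tangential factor [1/m] absorbs [K <= m]; the rest is at most [1] because [-1 < a] gives
     [m^(-2a) <= m^2]. *)
  have E (q p n : R) : m%:R * (m%:R^-1 * q * p / n) = (m%:R / m%:R) * (q * (p / n)) by ring.
  rewrite exprS E divff ?gt_eqF// mul1r.
  apply: mulr_ile1; rewrite ?divr_ge0 ?powR_ge0 ?exprn_ge0 ?invr_ge0 ?(ltW m0)//.
    by rewrite exprn_ile1 ?invr_ge0 ?(ltW m0)// invf_le1.
  rewrite ler_pdivrMr ?exprn_gt0// mul1r -[leRHS]powRr1 ?exprn_ge0 ?(ltW m0)//.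
  by apply: ler_powR; [rewrite exprn_ege1|lra].
Unshelve. all: by end_near. Qed.

(** Radial projection to the sphere of radius [r]. The origin goes to [0], since the inverse of [0]
    is [0], and thus stays in the ball. *)
Definition cone_proj r x : nat -> R := fun i => r * ((Num.sqrt (rdot L x x))^-1 * x i).

Lemma vnorm2_cone_proj r x : vnorm2 (of_coords N (cone_proj r x)) = (if rdot L x x == 0 then 0 else r ^+ 2).
Proof.
rewrite vnorm2_of_coords_rev /cone_proj !(rdotZl, rdotZr).
have S0 := rdot_ge0 L x; case: eqP => [->|/eqP S1]; first by rewrite !mulr0.
rewrite -{3}(sqr_sqrtr S0); field.
by rewrite sqrtr_eq0 -ltNge lt0r S1.
Qed.

Lemma cone_proj_ball r x : 0 < r < 1 -> ballN N (of_coords N (cone_proj r x)).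
Proof.
move=> /andP[r0 r1]; rewrite /ballN/= vnorm2_cone_proj; case: eqP => // _.
by rewrite expr_lt1// ltW.
Qed.

Lemma coord_measurable_cone f r : 0 < r < 1 -> (forall z, ballN N z -> ceps_delta f z) ->
  coord_measurable (fun x => (if vnorm2 (of_coords N x) < 1 then
       cabs2 (f (of_coords N (cone_proj r x))) * 1 else 0)%:E).
Proof.
move=> r01 cf; apply: coord_measurable_if => d Y u mu0; split; first exact: measurable_ball_ind.
have mr := measurable_rdot L mu0 mu0.
have mp k : measurable_fun setT (fun t => cone_proj r (fun k => u k t) k).
  apply: measurable_funM; first exact: measurable_cst.
  by apply: measurable_funM => //; apply: measurable_inv_sqrt => // t; exact: rdot_ge0.
have := measurable_ceps_delta cf mp.
have -> // : (fun t => if vnorm2 (of_coords N ((fun k t => cone_proj r (fun k => u k t) k) ^~ t)) < 1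
    then cabs2 (f (of_coords N ((fun k t => cone_proj r (fun k => u k t) k) ^~ t))) else 0) =
  (fun t => cabs2 (f (of_coords N (cone_proj r (fun k => u k t)))) * 1).
by apply/funext => t; rewrite mulr1 ifT//; exact: cone_proj_ball.
Qed.

Lemma H2norm2E zeta : vnorm2 zeta = 1 -> exists2 k : R, 0 < k &
  forall f, H2norm2 f = ereal_sup [set (k%:E * weighted_int (cone_proj r) (fun=> 1%R) f)%E
            | r in [set r : R | 0 < r < 1]].
Proof.
move=> z1; have [k k0 Hk] := nu_intE z1; exists k => // f.
rewrite /H2norm2; congr ereal_sup; apply: eq_imagel => r _.
rewrite /sigma_int (Hk (fun z => cabs2 (f (r%:C *: ((vnorm z)^-1%:C *: z))))); last first.
  by move=> z; exact: cabs2_ge0.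
congr (_ * slices L _ _)%E; apply/funext => x; rewrite mulr1.
by rewrite /cone_proj !of_coordsZ /vnorm vnorm2_of_coords_rev.
Qed.

Lemma cone_int_upper eta : vnorm2 eta = 1 ->
  exists2 C : R, 0 <= C & forall m r f (B : R), 0 < r < 1 -> (0 < m)%N -> 0 <= B ->
    (forall z, ballN N z ->
       cabs2 (f z) <= B * expR (- ((m%:R : R) ^+ 2 / 4 * (1 - Re (cinner z eta))))) ->
    (weighted_int (cone_proj r) (fun=> 1%R) f <=
      (B * C * ((m%:R : R)^-1 ^+ (2 * N).-1))%:E)%E.
Proof.
move=> e1.
have h1 : rdot L (coords eta) (coords eta) = 1 by rewrite rdot_coords_rev Re_cinner_self.
have [C C0 H] := slices_peak_cone (fun=> 0) uL h1.
exists C => // m r f B r01 m0 B0 fB.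
have m1 : 1 <= m%:R :> R by rewrite ler1n.
have P0 x : (0 <= (if rdot L x x < 1 then
   expR (- (m%:R ^+ 2 / 4 * (1 - r * ((Num.sqrt (rdot L x x))^-1 * rdot L x (coords eta))))) else 0)%:E)%E.
  by rewrite lee_fin; case: ifP => // _; exact: expR_ge0.
have := H m%:R r m1 r01; rewrite szL.
move=> /(lee_wpmul2l (_ : (0 <= B%:E)%E)); rewrite lee_fin => /(_ B0) {}H.
rewrite -mulrA EFinM; apply: le_trans H.
have pt (F G : (nat -> R) -> \bar R) : F = G -> F (fun=> 0) = G (fun=> 0) by move=> ->.
rewrite -(pt _ _ (slicesZl L B0 P0 (measurable_cone_peak L (coords eta) (m%:R ^+ 2 / 4) r))).
apply: le_slices.
- by move=> x; rewrite lee_fin; case: ifP => // _; rewrite mulr_ge0 ?cabs2_ge0.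
- by move=> x; rewrite mule_ge0.
move=> y _; rewrite -EFinM lee_fin -vnorm2_of_coords_rev; case: ifP => [yb|_]; last by rewrite mulr0.
rewrite mulr1; apply: le_trans (fB _ (cone_proj_ball y r01)) _.
rewrite Re_cinner_of_coords_rev /cone_proj !rdotZl vnorm2_of_coords_rev; exact: lexx.
Qed.

(** The radius may depend on [m], because the Hardy norm is a supremum over [r]: each test function
    is probed on the sphere at its own scale. *)
Lemma cone_int_lower zeta tau (eps : R) : vnorm2 zeta = 1 -> Re (cinner tau zeta) = 0 ->
  0 < eps -> exists2 c : R, 0 < c & \forall m \near \oo, exists2 r : R, 0 < r < 1 &
    forall f (w : R), 0 <= w ->
    (forall z, ballN N z -> ceps_delta f z) ->
    (forall z, near_pt zeta tau eps m%:R z -> w <= cabs2 (f z)) ->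
    ((w * c * ((m%:R : R)^-1 ^+ (2 * N).-1))%:E <= weighted_int (cone_proj r) (fun=> 1%R) f)%E.
Proof.
move=> z1 tz eps0.
have h1 : rdot L (coords zeta) (coords zeta) = 1 by rewrite rdot_coords_rev Re_cinner_self.
have t0 : rdot L (coords tau) (coords zeta) = 0 by rewrite rdot_coords_rev.
have [c [m0 [c0 m02 H]]] := slices_lb_cone (fun=> 0) uL h1 t0 eps0.
exists c => //; near=> m.
have mm : m0 <= m%:R by near: m; exact: nbhs_infty_ger.
have m2 : 2 <= m%:R :> R by lra.
have n4 : 4 <= (m%:R : R) ^+ 2 by nra.
have q1 : 0 < 2 / (m%:R : R) ^+ 2 by rewrite divr_gt0// exprn_gt0//; lra.
have q2 : 2 / (m%:R : R) ^+ 2 <= 2^-1 by rewrite ler_pdivrMr; lra.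
pose r := Num.sqrt (1 - 2 / (m%:R : R) ^+ 2).
have r2 : r ^+ 2 = 1 - 2 / m%:R ^+ 2 by rewrite sqr_sqrtr//; lra.
have r0 : 0 < r by rewrite sqrtr_gt0; lra.
have r1 : r < 1 by rewrite -[ltRHS]sqrtr1 ltr_sqrt//; lra.
have r01 : 0 < r < 1 by rewrite r0.
exists r => // f w w0 cf fw.
have := H m%:R w _ mm w0 _ (coord_measurable_cone r01 cf); rewrite szL; apply.
- by move=> x; rewrite lee_fin; case: ifP => // _; rewrite mulr_ge0 ?cabs2_ge0.
move=> x; rewrite -vnorm2_of_coords_rev => x1 x0 xn; rewrite lee_fin x1 mulr1.
apply: fw; apply: near_pt_coords.
- exact: cone_proj_ball.
- by move: xn; rewrite /cone_proj -(vnorm2_of_coords_rev x).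
rewrite vnorm2_cone_proj -vnorm2_of_coords_rev gt_eqF// r2 opprB addrC subrK.
by rewrite mulrCA divff ?mulr1 ?gt_eqF//; lra.
Unshelve. all: by end_near. Qed.

Theorem H2_not_compact phi psi : (0 < N)%N ->
  linear_fractional_selfmap phi -> linear_fractional_selfmap psi -> separated phi psi ->
  ~ compact_diff (@in_H2 R N) (@H2norm2 R N) phi psi.
Proof.
move=> N0 Lphi Lpsi sep; have [zeta [_ [_ [_ [_ [_ [z1 _ _ _ _]]]]]]] := sep.
have [k k0 Hk] := H2norm2E z1.
have k00 : (0 <= k%:E)%E by rewrite lee_fin ltW.
apply: (@not_compact_diff R N _ _ (fun m => (m%:R : R)^-1 ^+ (2 * N).-1)) => //.
- move=> f1 f2 g c1 c2; rewrite [leLHS]Hk; apply: ge_ereal_sup => _ [r r01 <-].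
  have kr f : (k%:E * weighted_int (cone_proj r) (fun=> 1%R) f <= H2norm2 f)%E.
    by rewrite Hk; apply: ereal_sup_ubound; exists r.
  have W0 f : (0 <= weighted_int (cone_proj r) (fun=> 1%R) f)%E.
    by apply: slices_ge0 => x; rewrite lee_fin; case: ifP => // _; rewrite mulr_ge0 ?cabs2_ge0.
  apply: (@le_trans _ _ (2%:E * (k%:E * weighted_int (cone_proj r) (fun=> 1%R) (fun z => (f1 z - g z)%R)) +
     2%:E * (k%:E * weighted_int (cone_proj r) (fun=> 1%R) (fun z => (f2 z - g z)%R)))%E); last first.
    by apply: leeD; rewrite lee_pmul2l.
  rewrite !(muleCA 2%:E) -muleDr//; last by rewrite ge0_adde_def// inE mule_ge0.
  rewrite lee_wpmul2l//; apply: weighted_int_triangle => // f cf.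
  exact: coord_measurable_cone.
- move=> eta e1; have [C C0 HC] := cone_int_upper e1.
  exists (k * C) => [|m f B m0 B0 fB]; first by rewrite mulr_ge0// ltW.
  rewrite Hk; apply: ge_ereal_sup => _ [r r01 <-].
  apply: le_trans (lee_wpmul2l k00 (HC m r f B r01 m0 B0 fB)) _.
  by rewrite -EFinM lee_fin le_eqVlt; apply/orP; left; apply/eqP; ring.
- move=> z tau eps z1' tz eps0; have [c c0 Hc] := cone_int_lower z1' tz eps0.
  exists (k * c) => [|]; first by rewrite mulr_gt0.
  apply: filterS Hc => m [r r01 Hm] f w w0 cf fw.
  rewrite Hk; apply: (@le_trans _ _ (k%:E * weighted_int (cone_proj r) (fun=> 1%R) f)%E); last first.
    by apply: ereal_sup_ubound; exists r.
  apply: le_trans (lee_wpmul2l k00 (Hm f w w0 cf fw)).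
  by rewrite -EFinM lee_fin le_eqVlt; apply/orP; left; apply/eqP; ring.
- by move=> m m0; rewrite exprn_gt0// invr_gt0 ltr0n.
- move=> K; near=> m.
  have m1 : 1 <= m%:R :> R by rewrite ler1n; near: m; exact: nbhs_infty_gt.
  have Km : K <= m%:R by near: m; exact: nbhs_infty_ger.
  have m0 : 0 < m%:R :> R by lra.
  have r0 : 0 <= m%:R^-1 ^+ (2 * N).-1 :> R by rewrite exprn_ge0 ?invr_ge0.
  apply: le_trans (ler_wpM2r r0 Km) _.
  have -> : (2 * N).-1 = (2 * N).-2.+1 by case: (N) N0 => // n _; rewrite mulnS.
  rewrite exprS mulrA divff ?gt_eqF// mul1r.
  by rewrite exprn_ile1 ?invr_ge0 ?(ltW m0)// invf_le1.
Unshelve. all: by end_near. Qed.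

End norms.

Theorem theorem7 (R : realType) (N : nat)
  (phi psi : 'rV[R[i]]_N -> 'rV[R[i]]_N) :
  (1 < N)%N ->
  linear_fractional_selfmap phi -> linear_fractional_selfmap psi ->
  supnorm phi = 1 -> supnorm psi = 1 ->
  univalent_on_ball phi \/ univalent_on_ball psi ->
  (compact_diff (@in_H2 R N) (@H2norm2 R N) phi psi ->
     forall z, ballN N z -> phi z = psi z) /\
  (forall alpha : R, -1 < alpha ->
     compact_diff (@in_A2 R N alpha) (@A2norm2 R N alpha) phi psi ->
     forall z, ballN N z -> phi z = psi z).
Proof.
move=> N1 Lphi Lpsi sphi spsi _; have N0 : (0 < N)%N by exact: ltnW.
have sep z : ballN N z -> phi z != psi z -> separated phi psi.
  by move=> zb zn; apply: separated_of_neq => //; exists z.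
split=> [cpt z zb|alpha alpha1 cpt z zb]; apply/eqP/negPn/negP => /(sep z zb) S.
  exact: (H2_not_compact N0 Lphi Lpsi S).
exact: (A2_not_compact N0 alpha1 Lphi Lpsi S).
Qed.
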